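(* There exist finite groups $G$ such that $C_{\mathrm{comm}}(G)$ contains a prime dividing neither $|G|$ nor the degree of any irreducible complex character of $G$. The smallest group order at which this occurs is $64$. It is attained by $G=\mathrm{SmallGroup}(64,73)\cong(C_2\times C_2\times D_8)\rtimes C_2$, which is a CA-group with exactly $b=7$ maximal abelian subgroups, and, with the same Smith spectrum, by the groups of its isoclinism family $\mathrm{SmallGroup}(64,k)$, $k=73,\dots,82$: the commuting difference lattice has rank $7$ and a single nontrivial invariant factor, equal to $6$, and $C_{\mathrm{comm}}(G)=\operatorname{rad}(6)=\{2,3\}$, with $3\nmid 64$.
   Context: $\mathrm{SmallGroup}(n,k)$ is the $k$-th group of order $n$ in the SmallGroups library (GAP numbering); $D_8$ is the dihedral group of order $8$. A finite group $G$ is a CA-group if the centralizer of every non-central element is abelian. Commuting difference lattice: let $P$ be the $G\times G$ zero-one matrix with $P_{g,h}=1$ if $gh=hg$ and $P_{g,h}=0$ otherwise. Then $M_{\mathrm{comm}}(G)\subseteq\mathbb{Z}^{G}$ is the $\mathbb{Z}$-span of all differences of rows $P_g-P_{g'}$, $g,g'\in G$. The invariant factors of a lattice $M\subseteq\mathbb{Z}^N$ are the nonzero Smith normal form entries $d_1\mid\cdots\mid d_r$ of any integer matrix whose rows generate $M$; the nontrivial ones are those greater than $1$, and the Smith spectrum is the list of nontrivial invariant factors. The commuting conductor is the set of primes $C_{\mathrm{comm}}(G)=\{p \text{ prime}:\operatorname{rank}_{\mathbb{F}_p}(M_{\mathrm{comm}}(G)\bmod p)<\operatorname{rank}_{\mathbb{Q}}M_{\mathrm{comm}}(G)\}$.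 For a positive integer $n$, $\operatorname{rad}(n)$ denotes the set of primes dividing $n$. Two groups $G,H$ are isoclinic if there are isomorphisms $G/Z(G)\to H/Z(H)$ and $G'\to H'$ compatible with the commutator pairings $G/Z(G)\times G/Z(G)\to G'$ and $H/Z(H)\times H/Z(H)\to H'$. *)

(* Defs.v *)
From HB Require Import structures.
From mathcomp Require Import all_boot all_order all_algebra.
From mathcomp Require Import all_fingroup all_solvable all_field all_character.

Set Implicit Arguments.
Unset Strict Implicit.
Unset Printing Implicit Defensive.

Import GRing.Theory.
Local Open Scope ring_scope.

(* A lattice in Z^N is given by an integer matrix whose rows generate it.     *)

Definition in_lattice m N (A : 'M[int]_(m, N)) (v : 'rV[int]_N) : Prop :=
  exists c : 'rV[int]_m, v = c *m A.

Definition same_lattice m m' N (A : 'M[int]_(m, N)) (B : 'M[int]_(m', N)) :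
    Prop :=
  forall v, in_lattice A v <-> in_lattice B v.

(* The dimension over F of the span of the image of the lattice in F^N.       *)
Definition lattice_rank (F : fieldType) m N (A : 'M[int]_(m, N)) : nat :=
  \rank (map_mx intr A : 'M[F]_(m, N)).

(* d lists the nonzero diagonal entries only; the bound on size d rules out   *)
(* entries that would fall outside the matrix and so be left unconstrained.   *)
Definition smith_form m N (A : 'M[int]_(m, N)) (d : seq nat) : Prop :=
  [/\ sorted dvdn d, all (leq 1) d, (size d <= minn m N)%N
    & exists L R, [/\ L \in unitmx, R \in unitmx
    & A = L *m (\matrix_(i < m, j < N) ((nth 0%N d i)%:Z *+ (i == j :> nat)))
            *m R]].

Definition invariant_factors m N (A : 'M[int]_(m, N)) (d : seq nat) : Prop :=
  forall m' (B : 'M[int]_(m', N)), same_lattice A B -> smith_form B d.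

Definition smith_spectrum m N (A : 'M[int]_(m, N)) (s : seq nat) : Prop :=
  exists2 d, invariant_factors A d & s = [seq e <- d | 1 < e]%N.

Section CommutingLattice.

Variables (gT : finGroupType) (G : {group gT}).

(* The matrix P, with G indexed through enum_val. *)
Definition comm_mx : 'M[int]_#|G| :=
  \matrix_(i, j) (enum_val i * enum_val j == enum_val j * enum_val i)%g%:R.

(* One row P_g - P_g' for each pair (g, g'); the rows generate M_comm(G). *)
Definition comm_lattice : 'M[int]_(#|{: 'I_#|G| * 'I_#|G|}|, #|G|) :=
  \matrix_k (row (enum_val k).1 comm_mx - row (enum_val k).2 comm_mx).

Definition comm_conductor : nat_pred :=
  [pred p | prime p &
            (lattice_rank 'F_p comm_lattice < lattice_rank rat comm_lattice)%N].

(* p divides neither |G| nor the degree of any irreducible character of G;    *)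
(* characters take their values in the field algC of complex algebraic        *)
(* numbers, over which all complex representations of G are realised.         *)
Definition external_prime (p : nat) : Prop :=
  ~~ (p %| #|G|)%N /\ forall i : Iirr G, ~~ (p %| 'chi[G]_i 1%g)%C.

Definition has_external_conductor_prime : Prop :=
  exists2 p, p \in comm_conductor & external_prime p.

Definition CA_group : Prop :=
  forall x, x \in G :\: 'Z(G)%g -> abelian 'C_G[x]%g.

Definition max_abelian_subgroups : {set {group gT}} :=
  [set A : {group gT} | [max A | (A \subset G) && abelian A]%g].

End CommutingLattice.

(* The commutator pairing of the cosets of x and y is [~ x, y]. *)
Definition isoclinic (gT hT : finGroupType)
    (G : {group gT}) (H : {group hT}) : Prop :=
  exists (phi : {morphism (G / 'Z(G))%g >-> coset_of 'Z(H)%g})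
         (psi : {morphism G^`(1)%g >-> hT}),
  [/\ isom (G / 'Z(G)) (H / 'Z(H)) phi,
      isom G^`(1) H^`(1) psi
    & forall x y x' y', x \in G -> y \in G -> x' \in H -> y' \in H ->
        phi (coset 'Z(G) x) = coset 'Z(H) x' ->
        phi (coset 'Z(G) y) = coset 'Z(H) y' ->
        psi [~ x, y] = [~ x', y']]%g.

(* SmallGroup(64,k), 73 <= k <= 82. In the SmallGroups library these are the  *)
(* groups with polycyclic generators f1, ..., f6 and relations                *)
(*   [f2,f1] = f4, [f3,f1] = f5, [f3,f2] = f6,                                *)
(*   f4, f5, f6 central of order 2, and f1^2, f2^2, f3^2 \in <f4, f5, f6>     *)
(* where only the three squares depend on k; [squares64 k] lists them, each   *)
(* as the triple of its exponents at f4, f5, f6 (other k are junk).           *)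

Definition bits3 : predArgType := (bool * bool * bool)%type.

Definition squares64 (k : nat) : bits3 * bits3 * bits3 :=
  let o := (false, false, false) in
  let f5 := (false, true, false) in
  let f6 := (false, false, true) in
  let f56 := (false, true, true) in
  let f456 := (true, true, true) in
  match k with
  | 74 => (o, f6, f6)
  | 75 => (f6, o, o)
  | 76 => (f6, f6, f6)
  | 77 => (o, f6, f56)
  | 78 => (f6, o, f5)
  | 79 => (f6, f6, f5)
  | 80 => (o, f56, f6)
  | 81 => (f6, f56, f6)
  | 82 => (f6, f56, f456)
  | _  => (o, o, o)
  end.

Definition xor3 (a b : bits3) : bits3 :=
  (a.1.1 (+) b.1.1, a.1.2 (+) b.1.2, a.2 (+) b.2).

Definition scale3 (c : bool) (a : bits3) : bits3 :=
  (c && a.1.1, c && a.1.2, c && a.2).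

(* Collecting f1^a1 f2^a2 f3^a3 * f1^b1 f2^b2 f3^b3 into normal form leaves   *)
(* this element of <f4, f5, f6>.                                              *)
Definition tail3 (s : bits3 * bits3 * bits3) (a b : bits3) : bits3 :=
  xor3 (a.1.2 && b.1.1, a.2 && b.1.1, a.2 && b.1.2)
       (xor3 (scale3 (a.1.1 && b.1.1) s.1.1)
             (xor3 (scale3 (a.1.2 && b.1.2) s.1.2) (scale3 (a.2 && b.2) s.2))).

(* (a, z) stands for f1^a1 f2^a2 f3^a3 f4^z1 f5^z2 f6^z3. *)
Definition SmallGroup64 (k : nat) : predArgType := (bits3 * bits3)%type.

HB.instance Definition _ (k : nat) := Finite.on (SmallGroup64 k).

Section SmallGroup64Group.

Variable k : nat.
Implicit Types x y z : SmallGroup64 k.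

Definition sg64_mul x y : SmallGroup64 k :=
  (xor3 x.1 y.1, xor3 (tail3 (squares64 k) x.1 y.1) (xor3 x.2 y.2)).

Definition sg64_one : SmallGroup64 k :=
  ((false, false, false), (false, false, false)).

Definition sg64_inv x : SmallGroup64 k :=
  (x.1, xor3 (tail3 (squares64 k) x.1 x.1) x.2).

Fact xor3A : associative xor3.
Proof. by move=> ? ? ?; rewrite /xor3 /= !addbA. Qed.

Fact xor3C : commutative xor3.
Proof. by move=> [[? ?] ?] [[? ?] ?]; congr (_, _, _); apply: addbC. Qed.

Fact tail3Dl s a b c : tail3 s (xor3 a b) c = xor3 (tail3 s a c) (tail3 s b c).
Proof.
rewrite /tail3 /xor3 /scale3 /=.
by congr (_, _, _); rewrite !andb_addl; do ![case: (_ && _) => //=].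
Qed.

Fact tail3Dr s a b c : tail3 s a (xor3 b c) = xor3 (tail3 s a b) (tail3 s a c).
Proof.
rewrite /tail3 /xor3 /scale3 /=.
by congr (_, _, _); rewrite !andb_addr !andb_addl; do ![case: (_ && _) => //=].
Qed.

Fact sg64_mulA : associative sg64_mul.
Proof.
move=> x y z; rewrite /sg64_mul /= xor3A tail3Dl tail3Dr; congr pair.
move: (tail3 _ y.1 z.1) (tail3 _ x.1 y.1) (tail3 _ x.1 z.1) => t u v.
rewrite /xor3 /=; congr (_, _, _).
- by case: t.1.1; case: u.1.1; case: v.1.1; case: x.2.1.1; case: y.2.1.1;
    case: z.2.1.1.
- by case: t.1.2; case: u.1.2; case: v.1.2; case: x.2.1.2; case: y.2.1.2;
    case: z.2.1.2.
- by case: t.2; case: u.2; case: v.2; case: x.2.2; case: y.2.2; case: z.2.2.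
Qed.

Fact sg64_mul1 : left_id sg64_one sg64_mul.
Proof. by case=> [[[a b] c] [[d e] f]]. Qed.

Fact sg64_mulV : left_inverse sg64_one sg64_inv sg64_mul.
Proof.
move=> [a z]; rewrite /sg64_mul /sg64_inv /=.
have xorK b c : xor3 b (xor3 (xor3 b c) c) = (false, false, false).
  by rewrite /xor3 /= !addbK !addbb.
by rewrite xorK /xor3 !addbb.
Qed.

HB.instance Definition _ := Finite_isGroup.Build (SmallGroup64 k)
  sg64_mulA sg64_mul1 sg64_mulV.

End SmallGroup64Group.

Definition pcword (T : finGroupType) (f : nat -> T) (a z : bits3) : T :=
  (f 1%N ^+ a.1.1 * f 2%N ^+ a.1.2 * f 3%N ^+ a.2 *
   f 4%N ^+ z.1.1 * f 5%N ^+ z.1.2 * f 6%N ^+ z.2)%g.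

Definition pcgen (k i : nat) : SmallGroup64 k :=
  ((i == 1, i == 2, i == 3), (i == 4, i == 5, i == 6))%N.

Lemma SmallGroup64_normal_form k (x : SmallGroup64 k) :
  x = pcword (pcgen k) x.1 x.2.
Proof.
case: x => [[[a b] c] [[d e] f]].
by case: a; case: b; case: c; case: d; case: e; case: f.
Qed.

(* With the normal form, these relations identify SmallGroup64 k with the     *)
(* group of order 64 given by the polycyclic presentation.                    *)
Lemma SmallGroup64_relations k (f := pcgen k) (s := squares64 k)
    (o : bits3 := (false, false, false)) :
  [/\ [/\ f 1%N ^+ 2 = pcword f o s.1.1, f 2%N ^+ 2 = pcword f o s.1.2
        & f 3%N ^+ 2 = pcword f o s.2],
      [/\ [~ f 2%N, f 1%N] = f 4%N, [~ f 3%N, f 1%N] = f 5%N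
        & [~ f 3%N, f 2%N] = f 6%N]
    & forall i, (3 < i)%N -> f i ^+ 2 = 1 /\ forall x, commute (f i) x]%g.
Proof.
rewrite {}/f {}/s {}/o; split; [split | split |].
1-6: cbv -[squares64].
1-6: by case: (squares64 k) => [[[[[] []] []] [[[] []] []]] [[[] []] []]].
move=> [|[|[|[|i]]]] // _; rewrite /pcgen /=.
case: (_ == 4)%N (_ == 5)%N (_ == 6)%N => -[] []; split=> //.
all: by move=> [[[[] []] []] [[[] []] []]].
Qed.

(* Main.v *)
(* Modulo the row of a central element, M_comm(G) is spanned by the rows of the
   non-commuting matrix. In a CA-group commuting is an equivalence relation on
   the non-central elements, so this matrix is a blow-up of J - I of size b,
   where b is the number of centralizers of non-central elements; hence the
   invariant factors are 1 (b - 1 times) and b - 1. The groups SmallGroup(64,k)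
   have b = 7.

   Let now |G| < 64. If G has an abelian normal subgroup A of prime index then
   G is a CA-group and b - 1 = |A : Z(G)| divides |G|. Any other solvable G is
   an extension of a group of order at most 31 by a group of prime order; these
   extensions are enumerated through their multiplication tables, and Gaussian
   elimination with pivots dividing a power of |G| shows that the rank of the
   non-commuting matrix is the same over Q and over F_p for p prime to |G|. If G
   is not solvable, it is simple of order 60, and Sylow's theorem shows that it
   is a CA-group with b - 1 = 20.

   A group of order 64 isoclinic to SmallGroup(64,73) is generated modulo its
   centre by three elements with independent commutators and with squares in
   the derived subgroup; a change of generators brings the 512 possible triples
   of squares to the ten listed in [squares64]. *)
From Stdlib Require Import ZArith.
From HB Require Import structures.
Require Import Defs.
From mathcomp Require Import all_boot all_order all_algebra.
From mathcomp Require Import all_fingroup all_solvable all_field all_character.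
From mathcomp Require Import ssrZ zify.

Set Implicit Arguments.
Unset Strict Implicit.
Unset Printing Implicit Defensive.

Import GRing.Theory.
Local Open Scope ring_scope.

(** * Commuting lattices of CA-groups *)

(** [invariant_factors] speaks of every generating matrix of the lattice, so a Smith form has to be
    produced for an arbitrary [B]. Such a [B] factors through the b by b matrix J - I with outer
    factors that are one-sided invertible over the integers, and these extend to unimodular
    matrices.

    Below order 64 the obstacle is that a group need not be a CA-group, so ranks over different
    fields must be compared directly. One integer elimination with pivots dividing |G|^8 serves all
    fields in which |G| is nonzero at once. The enumeration must also stay small enough to be
    evaluated inside the proof: isomorphic tables are merged below order 32, automorphisms are taken
    modulo inner ones, and from order 32 on only commuting relations are formed, not tables.

    In the non-solvable case Burnside's p^a q^b theorem leaves the orders 30, 42 and 60; order 30 is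
    excluded by the same Sylow count that settles order 60. *)

Lemma left_invertible_pid m n (E : 'M[int]_(n, m)) (C : 'M[int]_(m, n)) :
  E *m C = 1%:M -> (n <= m)%N /\ exists2 L, L \in unitmx & C = L *m pid_mx n.
Proof.
move=> EC.
have le_nm: (n <= m)%N.
  have := congr1 (map_mx (intr : int -> rat)) EC.
  rewrite map_mxM map_mx1 => EC'.
  rewrite -(mxrank1 rat n) -EC' (leq_trans (mxrankM_maxr _ _)) //.
  exact: rank_leq_row.
split=> //; move: E C EC; rewrite -(subnKC le_nm); move: (m - n)%N => k E C EC.
have [L uL [R uR [d _ defC]]] := int_Smith_normal_form C.
set D := \matrix_(i, j) _ in defC.
have XD : (R *m E *m L) *m D = 1%:M.
  have: R *m (E *m C) *m invmx R = 1%:M by rewrite EC mulmx1 mulmxV.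
  by rewrite defC !mulmxA mulmxK.
(* R E L is a left inverse of the Smith diagonal D, which forces its diagonal entries to be units;
   they and R are then absorbed into the left factor. *)
have ud (j : 'I_n) : d`_j \is a GRing.unit.
  have := congr1 (fun M : 'M_n => M j j) XD; rewrite !mxE eqxx.
  rewrite (bigD1 (lshift k j)) //= [D _ _]mxE eqxx mulr1n big1 ?addr0 => [h|i].
    by apply/unitrP; exists ((R *m E *m L) j (lshift k j)); rewrite [d`_j * _]mulrC.
  by rewrite -val_eqE [D _ _]mxE /= => /negPf->; rewrite mulr0n mulr0.
pose U : 'M[int]_n := diag_mx (\row_i d`_i).
have uU : U \in unitmx.
  by rewrite unitmxE det_diag rpred_prod // => i _; rewrite mxE.
have defD : D = col_mx U 0.
  apply/matrixP=> i j; rewrite -(splitK i); case: (split i) => i' /=.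
    rewrite col_mxEu !mxE /=; have [->|ne] := eqVneq i' j; first by rewrite eqxx.
    by rewrite -val_eqE /= in ne; rewrite (negPf ne).
  rewrite col_mxEd !mxE /=; case: eqP => // e.
  by have := ltn_ord j; rewrite -e ltnNge leq_addr.
exists (L *m block_mx (U *m R) 0 0 1%:M).
  rewrite unitmx_mul uL unitmxE det_ublock det1 mulr1 -unitmxE.
  by rewrite unitmx_mul uU uR.
rewrite -mulmxA pid_mx_col mul_block_col !mul0mx mulmx1 mulmx0 !addr0.
by rewrite defC defD -mulmxA mul_col_mx mul0mx.
Qed.

Lemma right_invertible_pid n N (S : 'M[int]_(n, N)) (T : 'M[int]_(N, n)) :
  S *m T = 1%:M -> (n <= N)%N /\ exists2 R, R \in unitmx & S = pid_mx n *m R.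
Proof.
move=> /(congr1 trmx); rewrite trmx_mul trmx1.
move=> /left_invertible_pid[le_nN [L uL defS]]; split=> //; exists L^T.
  by rewrite unitmx_tr.
by rewrite -[S]trmxK defS trmx_mul tr_pid_mx.
Qed.

Definition smith_diag m N (d : seq nat) : 'M[int]_(m, N) :=
  \matrix_(i, j) ((nth 0%N d i)%:Z *+ (i == j :> nat)).

Lemma pid_smith_diag m n N d : (n <= m)%N -> (n <= N)%N -> size d = n ->
  (pid_mx n : 'M_(m, n)) *m smith_diag n n d *m (pid_mx n : 'M_(n, N))
    = smith_diag m N d.
Proof.
move=> le_nm le_nN sd.
have -> : smith_diag n n d = diag_mx (\row_i (nth 0%N d i)%:Z).
  by apply/matrixP=> i j; rewrite !mxE.
apply/matrixP=> i j; rewrite mul_mx_diag !mxE.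
have [lt_in|le_ni] := ltnP i n; last first.
  rewrite big1 => [|l _]; first by rewrite nth_default ?sd ?mul0rn.
  by rewrite !mxE (ltnNge i) le_ni andbF !mul0r.
rewrite (bigD1 (Ordinal lt_in)) //= !mxE /= eqxx lt_in mul1r.
rewrite big1 ?addr0 => [|l]; first by rewrite andbT mulrnAr mulr1.
rewrite -val_eqE /= => ne; rewrite !mxE /= [i == l :> nat]eq_sym.
by rewrite (negPf ne) !mul0r.
Qed.

Lemma same_lattice_mulP m m' N (A : 'M[int]_(m, N)) (B : 'M[int]_(m', N)) :
  same_lattice A B <-> (exists C, A = C *m B) /\ (exists C, B = C *m A).
Proof.
have sub p q (X : 'M[int]_(p, N)) (Y : 'M[int]_(q, N)) :
    (forall v, in_lattice X v -> in_lattice Y v) -> exists C, X = C *m Y.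
  move=> sXY; have row_in i : exists c : 'rV_q, row i X == c *m Y.
    have [|c ->] := sXY (row i X); first by exists (delta_mx 0 i); rewrite rowE.
    by exists c.
  exists (\matrix_i xchoose (row_in i)); apply/row_matrixP=> i.
  by rewrite row_mul rowK -(eqP (xchooseP (row_in i))).
split=> [sAB | [[C defA] [D defB]] v].
  by split; apply: sub => v; case: (sAB v).
by split=> -[c ->]; [exists (c *m C); rewrite defA | exists (c *m D); rewrite defB];
  rewrite mulmxA.
Qed.

Lemma same_lattice_rank (F : fieldType) m m' N
    (A : 'M[int]_(m, N)) (B : 'M[int]_(m', N)) :
  same_lattice A B -> lattice_rank F A = lattice_rank F B.
Proof.
case/same_lattice_mulP=> [[C defA] [D defB]]; rewrite /lattice_rank.
by apply/eqP; rewrite eqn_leq; apply/andP; split; [rewrite defA | rewrite defB];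
  rewrite map_mxM mxrankM_maxr.
Qed.

(** For k > 0, the invariant factors of J - I of size k + 1, whose determinant is k up to sign. *)
Definition near_trivial_factors k : seq nat := rcons (nseq k 1%N) k.

(** [L] and [R] stay invertible over [F], so the rank counts the diagonal entries that are nonzero
    in [F]: the k ones, and the last entry k unless it vanishes there. *)
Lemma smith_form_rank (F : fieldType) m N (A : 'M[int]_(m, N)) k :
  smith_form A (near_trivial_factors k) ->
  lattice_rank F A = (k + (k%:R != 0 :> F)%R)%N.
Proof.
set d := near_trivial_factors k.
have sd : size d = k.+1 by rewrite size_rcons size_nseq.
case=> _ _; rewrite leq_min sd => /andP[le_dm le_dN] [L [R [uL uR ->]]].
have unitF l (M : 'M[int]_l) : M \in unitmx -> map_mx intr M \in (@unitmx F l).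
  by rewrite !unitmxE det_map_mx; apply: rmorph_unit.
rewrite /lattice_rank !map_mxM mxrankMfree ?row_free_unit ?unitF //.
rewrite (eqmxMfull _ _) ?row_full_unit ?unitF //.
rewrite -/(smith_diag m N d).
rewrite -(pid_smith_diag le_dm le_dN sd) !map_mxM !map_pid_mx.
have freeN : row_free (pid_mx k.+1 : 'M[F]_(k.+1, N)).
  by rewrite /row_free rank_pid_mx.
have fullM : row_full (pid_mx k.+1 : 'M[F]_(m, k.+1)).
  by rewrite /row_full rank_pid_mx.
rewrite mxrankMfree // (eqmxMfull _ fullM).
have nth_d (i : 'I_k.+1) : nth 0%N d i = if (i < k)%N then 1%N else k.
  rewrite nth_rcons size_nseq nth_nseq; case: ltngtP => // lt_ki.
  by have := ltn_ord i; rewrite ltnNge lt_ki.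
have [k0|nk0] := eqVneq (k%:R : F) 0.
  rewrite addn0 -[RHS](rank_pid_mx F (leqnSn k) (leqnSn k)).
  congr (\rank _); apply/matrixP=> i j; rewrite !mxE nth_d.
  case: ltnP => _; rewrite ?andbT ?andbF; first by case: eqP.
  by case: eqP => // _; rewrite mulr1n -pmulrn.
rewrite addn1 mxrank_unit //.
have -> : map_mx intr (smith_diag k.+1 k.+1 d)
    = diag_mx (\row_i (nth 0%N d i)%:R) :> 'M[F]_k.+1.
  by apply/matrixP=> i j; rewrite !mxE -val_eqE /=; case: eqP.
rewrite unitmxE det_diag rpred_prod // => i _; rewrite mxE nth_d unitfE.
by case: ifP; rewrite ?oner_neq0.
Qed.

Definition off_diagonal b : 'M[int]_b := \matrix_(i, j) (i != j)%:R.

(** With u the all-ones column of length k, the matrix has blocks u u^T - 1 and u above u^T and 0.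
    The factorization into elementary block matrices rests on u^T u = k, which is where the last
    diagonal entry comes from. *)
Lemma off_diagonal_smith k :
  exists L R, [/\ L \in unitmx, R \in unitmx
    & off_diagonal k.+1
      = L *m smith_diag k.+1 k.+1 (near_trivial_factors k) *m R].
Proof.
rewrite -[k.+1]addn1.
pose u : 'cV[int]_k := const_mx 1.
pose L := block_mx 1%:M u 0 1%:M *m block_mx (- 1%:M) 0 (u^T) 1%:M.
pose R : 'M[int]_(k + 1) := block_mx 1%:M (- u) 0 1%:M.
have uT : u^T *m u = (k%:R)%:M.
  apply/matrixP=> i j; rewrite !mxE (eq_bigr (fun=> 1)) => [|l _]; last first.
    by rewrite !mxE mulr1.
  by rewrite !ord1 eqxx sumr_const card_ord.
exists L, R; split.
- by rewrite unitmxE det_mulmx det_ublock det_lblock !det1 !mulr1 mul1r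
    -scaleN1r detZ det1 mulr1 unitrX // unitrN.
- by rewrite unitmxE det_ublock !det1.
have -> : smith_diag (k + 1) (k + 1) (near_trivial_factors k)
    = block_mx 1%:M 0 0 (k%:R)%:M.
  apply/matrixP=> i j; rewrite -(splitK i) -(splitK j).
  case: (split i) => i' /=; case: (split j) => j' /=;
    rewrite ?block_mxEul ?block_mxEur ?block_mxEdl ?block_mxEdr !mxE /=;
    rewrite nth_rcons size_nseq nth_nseq ?ltn_ord //.
  - by rewrite ltn_eqF // (leq_trans (ltn_ord i')) ?leq_addr.
  - by rewrite [_ == nat_of_ord j']gtn_eqF ?mulr0n // (leq_trans (ltn_ord j')) ?leq_addr.
  - by rewrite !ord1 addn0 ltnn eqxx !mulr1n natz.
rewrite /L /R !mulmx_block !(mul1mx, mulmx1, mul0mx, mulmx0, addr0, add0r).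
rewrite mulmxDl !mulmxN !mulNmx mul1mx opprK -mulmxA uT subrK.
rewrite addNr; apply/matrixP=> i j; rewrite -(splitK i) -(splitK j).
case: (split i) => i' /=; case: (split j) => j' /=;
  rewrite ?block_mxEul ?block_mxEur ?block_mxEdl ?block_mxEdr !mxE -val_eqE /=.
- by rewrite big_ord1 !mxE mulr1 val_eqE; case: eqP => _; rewrite ?addNr ?oppr0 ?add0r.
- by rewrite ltn_eqF // (leq_trans (ltn_ord i')) ?leq_addr.
- by rewrite gtn_eqF // (leq_trans (ltn_ord j')) ?leq_addr.
- by rewrite !ord1 eqxx.
Qed.

(** From size 2 on all entries of the Smith diagonal are nonzero, so J - I has no left kernel. *)
Lemma off_diagonal_inj k m (X : 'M[int]_(m, k.+2)) :
  X *m off_diagonal k.+2 = 0 -> X = 0.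
Proof.
have [L [R [uL uR ->]]] := off_diagonal_smith k.+1.
set D := smith_diag _ _ _; rewrite !mulmxA => XLDR.
have XLD : X *m L *m D = 0.
  by rewrite -[LHS](mulmxK uR) XLDR mul0mx.
have XL : X *m L = 0.
  move: (X *m L) XLD => Y YD; apply/matrixP=> i j; have /matrixP/(_ i j) := YD.
  rewrite mxE (bigD1 j) //= big1 => [|l ne_lj]; last first.
    by rewrite !mxE val_eqE (negPf ne_lj) mulr0.
  rewrite addr0 [D _ _]mxE eqxx mulr1n nth_rcons size_nseq nth_nseq mxE => /eqP.
  rewrite mulf_eq0 => /orP[/eqP//|]; case: ltngtP => //.
  by have := ltn_ord j; rewrite ltnS leqNgt => /negPf->.
by rewrite -[LHS](mulmxK uL) XL mul0mx.
Qed.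

(* Cliques of the commuting relation modulo the centre: the lattice spanned by
   the rows of the non-commuting matrix is that of [off_diagonal b *m S]. *)
Lemma off_diagonal_blowup k n N (B : 'M[int]_(n, N)) (S : 'M[int]_(k.+2, N))
    (T : 'M[int]_(N, k.+2)) :
  S *m T = 1%:M -> same_lattice B (off_diagonal k.+2 *m S) ->
  smith_form B (near_trivial_factors k.+1).
Proof.
move=> ST /same_lattice_mulP[[C defB] [E defE]].
(* E C (J - I) S = (J - I) S; cancelling S by its right inverse and then J - I by injectivity leaves
   E C = 1. *)
have EC : E *m C = 1%:M.
  apply/eqP; rewrite -subr_eq0; apply/eqP/off_diagonal_inj.
  rewrite mulmxBl mul1mx; apply/eqP; rewrite subr_eq0; apply/eqP.
  by rewrite -[RHS]mulmx1 -ST mulmxA defE defB -!mulmxA ST mulmx1.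
have [L [R [uL uR defJ]]] := off_diagonal_smith k.+1.
(* B = (C L) D (R S), where C L has a left inverse and R S a right inverse, so that both extend to
   unimodular matrices. *)
have /left_invertible_pid[le_n [L' uL' defL']] : (invmx L *m E) *m (C *m L) = 1%:M.
  by rewrite mulmxA -[_ *m C]mulmxA EC mulmx1 mulVmx.
have /right_invertible_pid[le_N [R' uR' defR']] : (R *m S) *m (T *m invmx R) = 1%:M.
  by rewrite mulmxA -[_ *m T]mulmxA ST mulmx1 mulmxV.
have sd : size (near_trivial_factors k.+1) = k.+2.
  by rewrite size_rcons size_nseq.
split.
- apply/(sortedP 0%N) => i; rewrite sd ltnS => lt_ik.
  by rewrite !nth_rcons size_nseq lt_ik nth_nseq lt_ik dvd1n.
- by rewrite all_rcons all_nseq orbT.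
- by rewrite sd leq_min le_n.
exists L', R'; split=> //.
rewrite -/(smith_diag n N _) -(pid_smith_diag le_n le_N sd).
by rewrite !mulmxA -defL' -2!mulmxA -defR' !mulmxA -2!(mulmxA C) -defJ -mulmxA.
Qed.

Definition noncomm_mx (gT : finGroupType) (G : {group gT}) : 'M[int]_#|G| :=
  \matrix_(i, j) (enum_val i * enum_val j != enum_val j * enum_val i)%g%:R.

Lemma comm_lattice_noncomm (gT : finGroupType) (G : {group gT}) :
  same_lattice (comm_lattice G) (noncomm_mx G).
Proof.
have commE i j : Defs.comm_mx G i j = 1 - noncomm_mx G i j.
  by rewrite !mxE; case: eqP; rewrite ?subr0 ?subrr.
apply/same_lattice_mulP; split.
  exists (\matrix_k (delta_mx 0 (enum_val k).2 - delta_mx 0 (enum_val k).1)).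
  apply/row_matrixP=> k; rewrite row_mul !rowK mulmxBl -!rowE.
  apply/rowP=> j; rewrite [LHS]mxE [row _ _ _ j]mxE [X in _ + X]mxE.
  by rewrite [row _ _ _ j]mxE !commE !mxE opprB addrC subrKA.
(* Row i of the non-commuting matrix is P_1 - P_i, because 1 commutes with everything. *)
exists (\matrix_i delta_mx 0 (enum_rank (enum_rank_in (group1 G) 1%g, i))).
apply/row_matrixP=> i; rewrite row_mul !rowK -rowE rowK enum_rankK /=.
apply/rowP=> j; rewrite [RHS]mxE [X in X + _]mxE [X in _ + X]mxE.
rewrite [LHS]mxE [X in _ - X]mxE !commE opprB [RHS]addrC subrKA.
rewrite -[LHS]subr0; congr (_ - _).
by rewrite mxE enum_rankK_in ?group1 // mul1g mulg1 eqxx.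
Qed.

(** The label [None] marks the central elements, [Some i] the i-th commuting class. If S is the
    indicator matrix of the classes, the non-commuting matrix is S^T (J - I) S, and choosing a
    representative of each class gives a right inverse T of S. *)
Lemma comm_lattice_labelled (gT : finGroupType) (G : {group gT}) k
    (lab : gT -> option 'I_k.+2) :
  (forall x y, x \in G -> y \in G ->
     (x * y == y * x)%g = [|| lab x == None, lab y == None | lab x == lab y]) ->
  (forall i, exists2 x, x \in G & lab x = Some i) ->
  invariant_factors (comm_lattice G) (near_trivial_factors k.+1).
Proof.
move=> labC lab_surj m B sAB.
have ex_rep i : exists g : 'I_#|G|, lab (enum_val g) == Some i.
  have [x Gx lab_x] := lab_surj i.
  by exists (enum_rank_in Gx x); rewrite enum_rankK_in ?lab_x.
pose r i := xchoose (ex_rep i).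
have lab_r i : lab (enum_val (r i)) = Some i by apply/eqP/(xchooseP (ex_rep i)).
pose S : 'M[int]_(k.+2, #|G|) := \matrix_(i, g) (lab (enum_val g) == Some i)%:R.
pose T : 'M[int]_(#|G|, k.+2) := \matrix_(g, i) (g == r i)%:R.
have ST : S *m T = 1%:M.
  apply/matrixP=> i j; rewrite mxE (bigD1 (r j)) //= big1 => [|g /negPf ne].
    by rewrite !mxE addr0 lab_r eqxx mulr1 eq_sym.
  by rewrite !mxE ne mulr0.
have defQ : noncomm_mx G = S^T *m (off_diagonal k.+2 *m S).
  apply/matrixP=> g h; rewrite [LHS]mxE labC ?enum_valP // mulmxA !mxE.
  case lab_h: (lab (enum_val h)) => [j|]; last first.
    by rewrite orbT big1 // => l _; rewrite !mxE lab_h mulr0.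
  rewrite (bigD1 j) //= big1 => [|l ne]; last first.
    by rewrite !mxE lab_h (inj_eq Some_inj) eq_sym (negPf ne) mulr0.
  rewrite addr0 [S _ _]mxE lab_h eqxx mulr1 mxE.
  case lab_g: (lab (enum_val g)) => [i|]; last first.
    by rewrite big1 // => l _; rewrite !mxE lab_g mul0r.
  rewrite (bigD1 i) //= big1 => [|l ne]; last first.
    by rewrite !mxE lab_g (inj_eq Some_inj) eq_sym (negPf ne) mul0r.
  by rewrite addr0 !mxE lab_g eqxx mul1r (inj_eq Some_inj).
apply: (off_diagonal_blowup ST) => v; split=> [|].
  case/sAB/comm_lattice_noncomm=> c ->.
  by exists (c *m S^T); rewrite -mulmxA -defQ.
case=> c ->; apply/sAB/comm_lattice_noncomm; exists (c *m T^T).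
by rewrite defQ -mulmxA (mulmxA T^T) -trmx_mul ST trmx1 mul1mx.
Qed.

Lemma comm_lattice_labelled_rank (F : fieldType) (gT : finGroupType)
    (G : {group gT}) k :
  invariant_factors (comm_lattice G) (near_trivial_factors k) ->
  lattice_rank F (comm_lattice G) = (k + (k%:R != 0 :> F)%R)%N.
Proof. by move=> inv; apply/smith_form_rank/inv. Qed.

(** The rank is k + 1 over the rationals and drops to k over F_p exactly when p divides k. *)
Lemma comm_conductor_labelled (gT : finGroupType) (G : {group gT}) k :
  (0 < k)%N -> invariant_factors (comm_lattice G) (near_trivial_factors k) ->
  comm_conductor G =i \pi(k).
Proof.
move=> k_gt0 inv p; rewrite !inE mem_primes k_gt0 /=; apply: andb_id2l => pr_p.
rewrite !(comm_lattice_labelled_rank _ inv) ltn_add2l.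
rewrite Num.Theory.pnatr_eq0 -lt0n k_gt0 (GRing.dvdn_pcharf (pchar_Fp pr_p)).
by case: eqP.
Qed.

(** * Centralizers in CA-groups *)

Section CAGroup.

Variables (gT : finGroupType) (G : {group gT}).
Local Open Scope group_scope.
Local Open Scope nat_scope.
Implicit Types x y : gT.

Definition noncentral_centralizers : {set {set gT}} :=
  [set 'C_G[x] | x in G :\: 'Z(G)].

Local Notation Cs := noncentral_centralizers.

Lemma subcent1_eqG x : x \in G -> ('C_G[x] == G :> {set gT}) = (x \in 'Z(G)).
Proof.
move=> Gx; rewrite eqEsubset subcent1_sub subsetI subxx sub_cent1 /=.
by rewrite inE Gx.
Qed.

Lemma noncentral_centralizersP x :
  x \in G -> ('C_G[x] \in Cs) = (x \notin 'Z(G)).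
Proof.
move=> Gx; apply/imsetP/idP=> [[y /setDP[Gy nZy] eqC]|nZx].
  by rewrite -subcent1_eqG // eqC subcent1_eqG.
by exists x; rewrite // inE nZx.
Qed.

Lemma noncentral_centralizers_gt1 : ~~ abelian G -> 1 < #|Cs|.
Proof.
move=> nabG; have /subsetPn[x Gx nZx]: ~~ (G \subset 'Z(G)).
  by rewrite subsetI subxx.
have: ~~ (G \subset 'C_G[x]).
  by apply: contra nZx; rewrite -subcent1_eqG // eqEsubset subcent1_sub.
case/subsetPn=> y Gy nCxy.
have nZy: y \notin 'Z(G).
  by apply: contra nCxy => /setIP[_ /centP cGy]; rewrite inE Gy; apply/cent1P/cGy.
apply/card_gt1P; exists 'C_G[x], 'C_G[y]; rewrite !noncentral_centralizersP //.
by split=> //; apply: contraNneq nCxy => ->; rewrite subcent1_id.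
Qed.

(** If v lies in the abelian group C(u), all of C(u) commutes with v, so C(u) is contained in C(v);
    by symmetry the two are equal. *)
Lemma CA_subcent1_eq x y :
  CA_group G -> x \in G -> y \in G -> x \notin 'Z(G) -> y \notin 'Z(G) ->
  (x * y == y * x)%g = ('C_G[x] == 'C_G[y] :> {set gT}).
Proof.
move=> CA_G Gx Gy nZx nZy; apply/eqP/eqP=> [cxy | eqC]; last first.
  have: x \in 'C_G[y] by rewrite -eqC subcent1_id.
  case/setIP=> _;
  by rewrite cent1E => /eqP.
have sub u v : u \in G -> v \in G -> u \notin 'Z(G) -> (u * v = v * u)%g ->
    'C_G[u] \subset 'C_G[v].
  move=> Gu Gv nZu cuv; rewrite subsetI subcent1_sub sub_cent1.
  have abCu : abelian 'C_G[u] by apply: CA_G; rewrite inE nZu.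
  apply: (subsetP abCu); rewrite inE Gv; exact/cent1P.
by apply/eqP; rewrite eqEsubset !sub.
Qed.

Lemma CA_comm_lattice : CA_group G -> ~~ abelian G ->
  1 < #|Cs| /\ invariant_factors (comm_lattice G) (near_trivial_factors #|Cs|.-1).
Proof.
move=> CA_G nabG; have C_gt1 := noncentral_centralizers_gt1 nabG; split=> //.
have [k defb]: exists k, #|Cs| = k.+2 by case: #|Cs| C_gt1 => [|[|k]] // _; exists k.
rewrite defb /=.
(* A central element has centralizer G, which is not in [Cs]: its index is out of range and [insub]
   returns [None]. *)
pose lab x : option 'I_k.+2 := insub (index 'C_G[x] (enum Cs)).
have lab0 x : x \in G -> (lab x == None) = (x \in 'Z(G)).
  move=> Gx; rewrite -[RHS]negbK -noncentral_centralizersP // -mem_enum -index_mem.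
  by rewrite -cardE defb /lab; case: insubP => [u -> _|/negPf->].
apply: (@comm_lattice_labelled _ _ _ lab) => [x y Gx Gy | i].
  rewrite !lab0 //; have [/centerP[_ ->]|nZx] := boolP (x \in _); rewrite ?eqxx //.
  have [/centerP[_ ->]|nZy] := boolP (y \in _); rewrite ?eqxx //=.
  rewrite CA_subcent1_eq //.
  have ltC z : z \in G -> z \notin 'Z(G) -> index 'C_G[z] (enum Cs) < k.+2.
    by move=> Gz nZz; rewrite -defb cardE index_mem mem_enum noncentral_centralizersP.
  rewrite /lab !insubT ?ltC // => ltx lty; rewrite (inj_eq Some_inj) -[RHS]val_eqE /=.
  apply/eqP/eqP=> [->//|eqI].
  have := index_inj set0 _ _ eqI.
  by apply; rewrite mem_enum noncentral_centralizersP.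
have lt_i : i < size (enum Cs) by rewrite -cardE defb.
have /imsetP[x /setDP[Gx _] def_x] : nth set0 (enum Cs) i \in Cs.
  by rewrite -mem_enum mem_nth.
exists x => //; rewrite /lab -def_x index_uniq ?enum_uniq //.
by rewrite insubT // => lt_i'; congr Some; apply: val_inj.
Qed.

(** The elements with the same centralizer as a noncentral x are those of C(x) outside the centre,
    so the right side sums over a partition of the noncentral elements. *)
Lemma CA_card_centralizers : CA_group G ->
  #|G| - #|'Z(G)| = \sum_(C in Cs) (#|C| - #|'Z(G)|).
Proof.
move=> CA_G; rewrite -cardsDS ?center_sub // -sum1_card.
rewrite (partition_big_imset (fun x => 'C_G[x])) /=; apply: eq_bigr => C.
case/imsetP=> x /setDP[Gx nZx] ->; rewrite sum1dep_card.
have sZC : 'Z(G) \subset 'C_G[x].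
  apply/subsetP=> z /centerP[Gz cGz]; rewrite inE Gz.
  by apply/cent1P/cGz.
rewrite -cardsDS //; apply: eq_card => y.
rewrite [LHS]inE /= 2!in_setD -andbA; apply: andb_id2l => nZy.
rewrite [RHS]inE; apply: andb_id2l => Gy.
by rewrite -CA_subcent1_eq // cent1E.
Qed.

Lemma prime_index_between (A H : {group gT}) :
  prime #|G : A| -> A \subset H -> H \subset G ->
  H :=: A \/ H :=: G.
Proof.
move=> pr_q sAH sHG; have := pr_q; rewrite -(Lagrange_index sHG sAH) => pr_m.
have [/eqP|nGH] := eqVneq #|G : H| 1; last have [/eqP|nHA] := eqVneq #|H : A| 1.
- by rewrite indexg_eq1 => sGH; right; apply/eqP; rewrite eqEsubset sHG.
- by rewrite indexg_eq1 => sHA; left; apply/eqP; rewrite eqEsubset sHA.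
case/primeP: pr_m => _ /(_ #|G : H| (dvdn_mulr _ (dvdnn _))).
rewrite (negPf nGH) /= -{1}[#|G : H|]muln1 eqn_pmul2l ?indexg_gt0 // eq_sym.
by rewrite (negPf nHA).
Qed.

(** Noncentral elements of [A] have centralizer [A]. For x outside [A], C(x) meets [A] in Z(G) and
    has order q |Z(G)|, where q = |G : A|. Counting noncentral elements gives |G| - |A| = (b - 1)(q
    - 1)|Z(G)|, whence b - 1 = |A : Z(G)|. *)
Lemma prime_index_CA (A : {group gT}) :
  ~~ abelian G -> A <| G -> abelian A -> prime #|G : A| ->
  CA_group G /\ #|Cs|.-1 = #|A : 'Z(G)|.
Proof.
move=> nabG nsAG abA pr_q; have [sAG nAG] := andP nsAG.
have betwA := prime_index_between pr_q.
have not_AG : A :<>: G by move=> eAG; rewrite -eAG abA in nabG.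
have sZA : 'Z(G) \subset A.
  have sAZ : A <*> 'Z(G) \subset G by rewrite join_subG sAG center_sub.
  have [|eAZ|eAZ] := betwA (A <*> 'Z(G))%G _ sAZ; first exact: joing_subl.
    by rewrite -eAZ joing_subr.
  case/negP: nabG; rewrite -[gval G]eAZ /= abelianY abA center_abelian.
  by rewrite (subset_trans (subsetIr _ _)) ?centS.
have C_A x : x \in A -> x \notin 'Z(G) -> 'C_G[x] = A.
  move=> Ax nZx; have Gx := subsetP sAG x Ax.
  have [||//|eC] := betwA 'C_G[x]%G; rewrite ?subcent1_sub //.
    by rewrite subsetI sAG sub_cent1 (subsetP abA).
  by case/negP: nZx; rewrite -subcent1_eqG // -[X in _ == X]eC.
have C_nA x : x \in G -> x \notin A ->
    A :&: 'C_G[x] = 'Z(G) /\ #|'C_G[x]| = (#|G : A| * #|'Z(G)|)%N.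
  move=> Gx nAx.
  have eZ : A :&: 'C_G[x] = 'Z(G).
    apply/eqP; rewrite eqEsubset subsetI sZA subsetI center_sub sub_cent1.
    have -> /= : x \in 'C('Z(G)).
      by apply: (subsetP _ _ Gx); rewrite centsC subsetIr.
    rewrite andbT.
    apply/subsetP=> z /setIP[Az /subcent1P[Gz cxz]]; apply: contraR nAx => nZz.
    by rewrite -(C_A z) // inE Gx; apply/cent1P.
  split=> //; have sAC : A <*> 'C_G[x] \subset G by rewrite join_subG sAG subcent1_sub.
  have [|eAC|eAC] := betwA (A <*> 'C_G[x])%G _ sAC; first exact: joing_subl.
    by case/negP: nAx; rewrite -eAC (subsetP (joing_subr _ _)) ?subcent1_id.
  have := mul_cardG A 'C_G[x]; rewrite eZ -norm_joinEr; last first.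
    by rewrite (subset_trans _ nAG) ?subcent1_sub.
  rewrite eAC -(Lagrange sAG) -!mulnA => /eqP.
  by rewrite eqn_pmul2l ?cardG_gt0 // => /eqP.
have CA_G : CA_group G.
  move=> x /setDP[Gx nZx]; have [Ax|nAx] := boolP (x \in A); first by rewrite C_A.
  have [eZ cC] := C_nA x Gx nAx.
  have sZC : 'Z(G) \subset 'C_G[x] by rewrite -eZ subsetIr.
  apply: (@cyclic_factor_abelian _ 'Z(G)%G).
    by rewrite subsetI sZC centsC (subset_trans (subcent1_sub _ _)) // centsC subsetIr.
  apply: prime_cyclic; rewrite card_quotient; last first.
    by rewrite (subset_trans (subcent1_sub _ _)) // gFnorm.
  by rewrite -divgS // cC mulnK ?cardG_gt0.
split=> //.
have /subsetPn[x Ax nZx] : ~~ (A \subset 'Z(G)).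
  apply: contra nabG => sAZ; apply: (@cyclic_factor_abelian _ A) => //.
  by apply: prime_cyclic; rewrite card_quotient.
have Gx := subsetP sAG x Ax.
have CsA : gval A \in Cs by rewrite -(C_A x) // noncentral_centralizersP.
have := CA_card_centralizers CA_G; rewrite (bigD1 (gval A)) //=.
rewrite (eq_bigr (fun=> (#|G : A|.-1 * #|'Z(G)|)%N)); last first.
  move=> C /andP[/imsetP[y /setDP[Gy nZy] ->] nCA].
  have [Ay|nAy] := boolP (y \in A); first by rewrite C_A ?eqxx in nCA.
  by have [_ ->] := C_nA y Gy nAy; rewrite -[X in _ - X]mul1n -mulnBl subn1.
rewrite sum_nat_cond_const.
have -> : #|[set C in Cs | C != A]| = #|Cs|.-1.
  by rewrite (cardsD1 (gval A) Cs) CsA /= ; apply: eq_card => C; rewrite !inE andbC.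
rewrite -(Lagrange sAG) -(Lagrange sZA).
have := cardG_gt0 'Z(G); have := prime_gt1 pr_q.
case: #|G : A| => // q; rewrite ltnS => q_gt0 z_gt0 /=.
have le_z : #|'Z(G)| <= #|'Z(G)| * #|A : 'Z(G)| by rewrite leq_pmulr ?indexg_gt0.
rewrite mulnS -addnBAC // => /addnI/eqP.
rewrite (mulnC #|'Z(G)|) -mulnA (mulnC _ q) eqn_pmul2r ?muln_gt0 ?q_gt0 //.
by move/eqP.
Qed.

End CAGroup.

(** An external prime does not divide |G|, so this property excludes external conductor primes. *)
Definition internal_conductor (gT : finGroupType) (G : {group gT}) :=
  forall p, p \in comm_conductor G -> (p %| #|G|)%N.

Lemma abelian_internal (gT : finGroupType) (G : {group gT}) :
  abelian G -> internal_conductor G.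
Proof.
move=> abG p; rewrite inE !(same_lattice_rank _ (@comm_lattice_noncomm _ G)).
have -> : noncomm_mx G = 0.
  apply/matrixP=> i j; rewrite !mxE (centsP abG) ?enum_valP ?eqxx //.
by rewrite /lattice_rank !map_mx0 !mxrank0 andbF.
Qed.

Lemma CA_internal (gT : finGroupType) (G : {group gT}) :
  CA_group G -> ~~ abelian G -> (#|noncentral_centralizers G|.-1 %| #|G|)%N ->
  internal_conductor G.
Proof.
move=> CA_G nabG dvG p; have [C_gt1 inv] := CA_comm_lattice CA_G nabG.
rewrite (comm_conductor_labelled _ inv); last by rewrite -subn1 subn_gt0.
by rewrite mem_primes => /and3P[_ _ /dvdn_trans->].
Qed.

Lemma prime_index_internal (gT : finGroupType) (G A : {group gT}) :
  (A <| G)%g -> abelian A -> prime #|G : A|%g -> internal_conductor G.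
Proof.
move=> nsAG abA pr_q; have [/abelian_internal//|nabG] := boolP (abelian G).
have [CA_G eqb] := prime_index_CA nabG nsAG abA pr_q.
apply: CA_internal => //; rewrite eqb.
exact: dvdn_trans (dvdn_indexg _ _) (cardSg (normal_sub nsAG)).
Qed.

Local Open Scope nat_scope.

(** * Enumeration of solvable groups by multiplication tables *)

(* Unlike [all], [has] and [&&], these are lazy under call-by-value reduction. *)
Fixpoint lazy_all (A : Type) (P : pred A) s :=
  if s is x :: s' then if P x then lazy_all P s' else false else true.

Fixpoint lazy_has (A : Type) (P : pred A) s :=
  if s is x :: s' then if P x then true else lazy_has P s' else false.

Fixpoint eqns (s t : seq nat) :=
  match s, t with
  | [::], [::] => true
  | a :: s', b :: t' => if eqn a b then eqns s' t' else false
  | _, _ => false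
  end.

(** Multiplication tables on indices 0, ..., n - 1; index 0 is the identity. *)
Definition table := seq (seq nat).

Definition op (T : table) i j := nth 0 (nth [::] T i) j.

Definition transpose (T : table) : table :=
  [seq [seq nth 0 r b | r <- T] | b <- iota 0 (size T)].

Definition noncomm_table T : seq bitseq :=
  [seq [seq ~~ eqn y.1 y.2 | y <- zip x.1 x.2] | x <- zip T (transpose T)].

Definition elt_order (T : table) a :=
  find (eqn 0) (traject (fun b => op T b a) a (size T)).

(** Invariants that restrict the images of an element under an isomorphism: its order (less one, as
    [elt_order] counts from 0) and the number of elements not commuting with it. *)
Definition elt_keys T :=
  [seq (elt_order T x.1, count id x.2) | x <- zip (iota 0 (size T)) (noncomm_table T)].

Definition eq_key (k l : nat * nat) := if eqn k.1 l.1 then eqn k.2 l.2 else false.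

Fixpoint find_word (T' : table) gens i : option (nat * nat) :=
  if gens is b :: gens' then
    let a := find (eqn i) (nth [::] T' b) in
    if a < i then Some (a, b) else find_word T' gens' i
  else None.

(** Greedy generators: each element is either a product of a smaller index and an earlier generator,
    or becomes a new generator. A homomorphism is thus determined by its values at the [None]
    entries. *)
Definition words_step T' (acc : seq nat * seq (option (nat * nat))) i :=
  if find_word T' acc.1 i is Some w then (acc.1, rcons acc.2 (Some w))
  else (rcons acc.1 i, rcons acc.2 None).

Definition words T := foldl (words_step (transpose T)) ([::], [::]) (iota 0 (size T)).

Definition hom_at (T U : table) (f : seq nat) b :=
  let k := size f in let fb := nth 0 f b in
  lazy_all (fun x => let c := nth 0 x.1 b in
    if k <= c then true else eqn (nth 0 f c) (op U x.2 fb)) (zip T f).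

Definition partial_hom (T U : table) gens (f : seq nat) :=
  lazy_all (fun b => if b < size f then hom_at T U f b else true) gens.

Definition choices keyU key (f : seq nat) :=
  [seq v <- iota 0 (size keyU) | if eq_key (nth (0, 0) keyU v) key
                                 then ~~ lazy_has (eqn v) f else false].

Definition homs_step (T U : table) keyT keyU gens ws (P : seq (seq nat)) i :=
  let Q := flatten [seq
    match nth None ws i with
    | Some (a, b) => [:: rcons f (op U (nth 0 f a) (nth 0 f b))]
    | None => [seq rcons f v | v <- choices keyU (nth (0, 0) keyT i) f]
    end | f <- P] in
  (* The homomorphism test waits until all images forced by the chosen generators are filled in. *)
  if nth None ws i.+1 is Some _ then Q else filter (partial_hom T U gens) Q.

(* All isomorphisms are found; further members are harmless, as they merely add
   tables to those being checked. *)
Definition homs (T U : table) keyT keyU :=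
  let w := words T in
  foldl (homs_step T U keyT keyU w.1 w.2) [:: [::]] (iota 0 (size T)).

(** The certificate for merging two tables: [f] is checked to be a bijection that fixes index 0 and
    respects products, and [T] to be well formed, whatever search produced [f]. *)
Definition embeds T U f :=
  let n := size T in
  if eqn (size U) n then if eqn (size f) n then if uniq f then if lazy_all (gtn n) f then
  if eqn (nth 0 f 0) 0 then
    lazy_all (fun x => let Ua := nth [::] U x.2 in
      if eqn (size x.1) n then lazy_all (fun y => if y.1 < n then
        eqn (nth 0 f y.1) (nth 0 Ua y.2) else false) (zip x.1 f) else false) (zip T f)
  else false else false else false else false else false.

Fixpoint search_iso T U keyT keyU gens ws l f :=
  if l is i :: l' then
    let next f' :=
      if (if nth None ws i.+1 is Some _ then true else partial_hom T U gens f')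
      then search_iso T U keyT keyU gens ws l' f' else false in
    match nth None ws i with
    | Some (a, b) => next (rcons f (op U (nth 0 f a) (nth 0 f b)))
    | None => lazy_has (fun v => next (rcons f v)) (choices keyU (nth (0, 0) keyT i) f)
    end
  else embeds T U f.

(** A cheap comparison made before a search; a negative answer merely keeps one more table. *)
Definition same_keys (k l : seq (nat * nat)) :=
  eq_key (sumn (unzip1 k), sumn (unzip2 k)) (sumn (unzip1 l), sumn (unzip2 l)).

(** * Outer actions and cyclic extensions *)

Definition conj_table T :=
  [seq let inv := find (eqn 0) (nth [::] T a) in
       [seq op T (op T a b) inv | b <- iota 0 (size T)] | a <- iota 0 (size T)].

Definition outer_eq (C : table) (r s : seq nat) :=
  if eqn (size r) (size s) then
    lazy_has (fun c => let n := size c in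
      lazy_all (fun x => if x.1 < n then eqn (nth 0 c x.1) x.2 else false) (zip r s)) C
  else false.

Definition outer_reps C (A : seq (seq nat)) :=
  foldl (fun acc s => if lazy_has (fun r => outer_eq C r s) acc then acc else s :: acc)
    [::] A.

Definition powers n s p : table := traject (map (nth 0 s)) (iota 0 n) p.+1.

Definition ext_roots C p s (sp : table) :=
  [seq z <- iota 0 (size C) |
    if eqn (nth 0 s z) z then eqns (nth [::] sp p) (nth [::] C z) else false].

Definition outer_actions T :=
  let key := elt_keys T in
  let C := conj_table T in
  (C, outer_reps C (homs T T key key)).

(** Index i n + a stands for a x^i. The product of a x^i and b x^j is a s^i(b) x^(i + j), where x^p
    is replaced by z once the exponent reaches p. *)
Definition ext_table (T : table) p (sp : table) z : table :=
  let n := size T in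
  [seq let si := nth [::] sp i in let Ta := nth [::] T a in
    [seq let c := nth 0 Ta (nth 0 si b) in
         let k := i + j in if k < p then k * n + c else (k - p) * n + op T c z
      | j <- iota 0 p, b <- iota 0 n]
   | i <- iota 0 p, a <- iota 0 n].

(* The extensions of [T] generated by x with x b x^-1 = s b and x^p = z, where
   z is fixed by s and s^p is conjugation by z; it is enough to take s modulo
   inner automorphisms. *)
Definition extensions T p : seq table :=
  let x := outer_actions T in
  flatten [seq let sp := powers (size T) s p in
               [seq ext_table T p sp z | z <- ext_roots x.1 p s sp] | s <- x.2].

(* The commuting relation on a cyclic extension does not depend on the choice
   of the [p]-th power. *)
Definition noncomm_ext T p (sp : table) : seq bitseq :=
  let X := [seq [seq [seq nth 0 r v | v <- s] | r <- T] | s <- take p sp] in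
  let Y := [seq transpose Xj | Xj <- X] in
  flatten [seq [seq flatten [seq [seq ~~ eqn y.1 y.2 | y <- zip x.2 (nth [::] Yj x.1)]
      | Yj <- Y] | x <- zip (iota 0 (size T)) Xi] | Xi <- X].

Definition commutative_table (T : table) := lazy_all (fun r => ~~ lazy_has id r) (noncomm_table T).

Definition dedupe (l : seq table) : seq table :=
  unzip1 (foldl (fun (acc : seq (table * (seq (nat * nat) * (seq nat * _)))) T =>
      let k := elt_keys T in
      if lazy_has (fun x => if same_keys x.2.1 k then
            search_iso x.1 T x.2.1 k x.2.2.1 x.2.2.2 (iota 0 (size x.1)) [::]
          else false) acc
      then acc else (T, (k, words T)) :: acc) [::] l).

Definition small_primes := [:: 2; 3; 5; 7; 11; 13; 17; 19; 23; 29; 31].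

Definition candidates (L : seq (seq table)) n :=
  flatten [seq flatten [seq extensions T p | T <- nth [::] L (n %/ p)]
    | p <- small_primes & p %| n].

(* From 16 on a level only serves to form groups of order less than 64, and
   the extensions of an abelian group by a prime are already understood. *)
Definition next_level (L : seq (seq table)) n :=
  let c := candidates L n in
  dedupe (if n < 16 then c else [seq T <- c | ~~ commutative_table T]).

(** Lists are indexed by the group order, whence the empty entry 0 and the trivial table at 1. *)
Definition levels := foldl (fun L n => rcons L (next_level L n))
   [:: [::]; [:: [:: [:: 0]]]] (iota 2 30).

(* An integer dividing a power of [n] is invertible in every field in which [n]
   is; the exponent 8 is large enough for the pivots met in practice. *)
Definition is_unit (N v : Z) := Z.eqb (Z.modulo N v) 0.

Definition eqZs (r s : seq Z) := lazy_all (fun x => Z.eqb x.1 x.2) (zip r s).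

(** Dividing by the gcd keeps entries small. It is done only if the gcd divides [N], and the
    quotient is checked by multiplying back. *)
Definition normalize N (r : seq Z) :=
  let g := foldl Z.gcd Z0 r in
  let r' := [seq Z.div x g | x <- r] in
  if is_unit N g then if eqZs [seq Z.mul g x | x <- r'] r then r' else r else r.

Definition reduce_row N (r : seq Z) j (w : seq Z) :=
  let b := nth Z0 w j in
  if Z.eqb b 0 then w else
  let a := nth Z0 r j in
  normalize N [seq Z.sub (Z.mul a x.1) (Z.mul b x.2) | x <- zip w r].

Definition find_unit N (r : seq Z) := find (is_unit N) r.

Fixpoint pick_row N (s : seq (seq Z)) : option (seq Z * seq (seq Z)) :=
  if s is r :: s' then
    if find_unit N r < size r then Some (r, s') else
    if pick_row N s' is Some (r', s'') then Some (r', r :: s'') else None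
  else None.

Definition nonzero_row (r : seq Z) := lazy_has (fun x => ~~ Z.eqb x 0) r.

Fixpoint eliminate N fuel (s : seq (seq Z)) : option nat :=
  if fuel is k.+1 then
    match s with
    | [::] => Some 0
    | _ => if pick_row N s is Some (r, s') then
        let j := find_unit N r in
        if eliminate N k [seq w <- [seq reduce_row N r j w | w <- s'] | nonzero_row w]
          is Some rk then Some rk.+1 else None
      else None
    end
  else None.

Fixpoint eqbs (s t : bitseq) :=
  match s, t with
  | [::], [::] => true
  | a :: s', b :: t' => if eqb a b then eqbs s' t' else false
  | _, _ => false
  end.

Definition row_reps_step (acc : seq (nat * bitseq)) x :=
  if lazy_has (fun y => eqbs y.2 x.2) acc then acc else x :: acc.

Definition row_reps (M : seq bitseq) : seq (nat * bitseq) :=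
  foldl row_reps_step [::] (zip (iota 0 (size M)) M).

(** The commuting relation is symmetric, so keeping one index for each distinct row, both as a row
    and as a column, preserves the rank. *)
Definition rank_of (M : seq bitseq) :=
  let R := row_reps M in
  let l := unzip1 R in
  let N := Z.pow (Z.of_nat (size M)) 8 in
  let s := [seq [seq (if nth false x.2 b then (Zpos xH) else Z0) | b <- l] | x <- R] in
  eliminate N (size M) [seq w <- s | nonzero_row w].

Definition has_rank M := if rank_of M is Some _ then true else false.

Definition check_extensions (L : seq (seq table)) n :=
  lazy_all (fun p => if p %| n then
     lazy_all (fun T => if commutative_table T then true else
       let x := outer_actions T in
       lazy_all (fun s => let sp := powers (size T) s p in
          if ext_roots x.1 p s sp is [::] then true else has_rank (noncomm_ext T p sp)) x.2)
      (nth [::] L (n %/ p)) else true) small_primes.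

Definition check_tables (L : seq (seq table)) :=
  if lazy_all (lazy_all (fun T => has_rank (noncomm_table T))) L
  then lazy_all (check_extensions L) (iota 32 32)
  else false.

Lemma lazy_allE (A : Type) (P : pred A) s : lazy_all P s = all P s.
Proof. by elim: s => //= x s ->; case: (P x). Qed.

Lemma lazy_hasE (A : Type) (P : pred A) s : lazy_has P s = has P s.
Proof. by elim: s => //= x s ->; case: (P x). Qed.

Lemma eqnsP s t : reflect (s = t) (eqns s t).
Proof.
elim: s t => [|a s IHs] [|b t] /=; try by constructor.
case: (@eqnP a b) => [->|ne]; last by constructor=> -[].
by apply: (iffP (IHs t)) => [->|[]].
Qed.

Lemma eqbsP s t : reflect (s = t) (eqbs s t).
Proof.
elim: s t => [|a s IHs] [|b t] /=; try by constructor.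
by case: a; case: b => /=; try (by constructor); apply: (iffP (IHs t)) => [->|[]].
Qed.

(** * Correctness of the elimination over a field *)

Section RankCertificate.

Variables (F : fieldType) (N : Z) (m : nat).
Local Open Scope ring_scope.

Definition ZtoF (z : Z) : F := (int_of_Z z)%:~R.

Lemma ZtoFM a b : ZtoF (Z.mul a b) = ZtoF a * ZtoF b.
Proof. by rewrite /ZtoF -[Z.mul a b]/(a * b)%R !rmorphM. Qed.

Lemma ZtoFB a b : ZtoF (Z.sub a b) = ZtoF a - ZtoF b.
Proof. by rewrite /ZtoF -[Z.sub a b]/(a - b)%R !rmorphB. Qed.

Definition Zrow (r : seq Z) : 'rV[F]_m := \row_j ZtoF (nth Z0 r j).

Definition Zrows (s : seq (seq Z)) : 'M[F]_(size s, m) :=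
  \matrix_(i < size s) Zrow (nth [::] s i).

Lemma Zrows_subP k (W : 'M[F]_(k, m)) s :
  reflect {in s, forall r, Zrow r <= W}%MS (Zrows s <= W)%MS.
Proof.
apply: (iffP row_subP) => [sW r /(nthP [::])[i lti <-] | sW i].
  by have := sW (Ordinal lti); rewrite rowK.
by rewrite rowK sW ?mem_nth.
Qed.

Lemma Zrows_sub s r : r \in s -> (Zrow r <= Zrows s)%MS.
Proof. by move: r; apply/Zrows_subP. Qed.

Lemma Zrows_rank s t :
  {in s, forall r, Zrow r <= Zrows t}%MS -> {in t, forall r, Zrow r <= Zrows s}%MS ->
  \rank (Zrows s) = \rank (Zrows t).
Proof.
move=> /Zrows_subP st /Zrows_subP ts.
by apply/eqP; rewrite eqn_leq !mxrankS.
Qed.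

Lemma nonzero_rowPn r : ~~ nonzero_row r -> Zrow r = 0.
Proof.
rewrite /nonzero_row lazy_hasE => /hasPn r0; apply/rowP=> j; rewrite !mxE.
have [ltj|lej] := ltnP j (size r); last by rewrite nth_default.
by have := r0 _ (mem_nth Z0 ltj); rewrite negbK => /Z.eqb_spec->.
Qed.

Lemma Zrows_filter s : \rank (Zrows [seq r <- s | nonzero_row r]) = \rank (Zrows s).
Proof.
apply: Zrows_rank => r; rewrite ?mem_filter; first by case/andP=> _ /Zrows_sub.
have [nz sr|/nonzero_rowPn-> _] := boolP (nonzero_row r); last exact: sub0mx.
by apply: Zrows_sub; rewrite mem_filter nz.
Qed.

(** One elimination step: up to nonzero scalars, the rows of [s'] are those of [s] corrected by
    multiples of the pivot row r. As r is nonzero in column j, where all of [s'] vanishes, r is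
    independent of [s']. *)
Lemma Zrows_pivot r s s' (j : 'I_m) :
  Zrow r 0 j != 0 -> {in s', forall w, Zrow w 0 j = 0} ->
  {in s, forall w, exists2 w', w' \in s' & exists g u v,
      [/\ g != 0, u != 0 & g *: Zrow w' = u *: Zrow w - v *: Zrow r]} ->
  {in s', forall w', exists2 w, w \in s & exists g u v,
      [/\ g != 0, u != 0 & g *: Zrow w' = u *: Zrow w - v *: Zrow r]} ->
  \rank (Zrows (r :: s)) = (\rank (Zrows s')).+1.
Proof.
move=> rj s'j ss' s's.
have dx : (Zrow r :&: Zrows s' = 0)%MS.
  apply/eqP; rewrite -submx0; apply/rV_subP=> v; rewrite sub_capmx => /andP[].
  case/sub_rVP=> c -> /submxP[d dv].
  have: (c *: Zrow r) 0 j = 0.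
    rewrite dv mxE big1 // => i _.
    have -> : Zrows s' i j = Zrow (nth [::] s' i) 0 j by rewrite /Zrows mxE.
    by rewrite s'j ?mulr0 ?mem_nth.
  rewrite mxE => /eqP; rewrite mulf_eq0 (negPf rj) orbF => /eqP->.
  by rewrite scale0r sub0mx.
have <- : \rank (Zrow r + Zrows s')%MS = (\rank (Zrows s')).+1.
  rewrite mxrank_disjoint_sum // rank_rV.
  have -> //: Zrow r != 0 by apply: contraNneq rj => ->; rewrite mxE.
apply/eqP; rewrite eqn_leq; apply/andP; split; apply: mxrankS.
  apply/Zrows_subP=> w; rewrite inE => /predU1P[->|/ss'[w' sw' [g [u [v [g0 u0 e]]]]]].
    exact: addsmxSl.
  rewrite -(scalerK u0 (Zrow w)) scalemx_sub //.
  rewrite -[u *: _](subrK (v *: Zrow r)) -e addmx_sub // scalemx_sub ?addsmxSl //.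
  by rewrite (submx_trans (Zrows_sub sw')) ?addsmxSr.
rewrite addsmx_sub Zrows_sub ?mem_head // andTb; apply/Zrows_subP=> w'.
case/s's=> w sw [g [u [v [g0 u0 e]]]].
rewrite -(scalerK g0 (Zrow w')) scalemx_sub // e.
by apply: addmx_sub; [|rewrite eqmx_opp]; apply: scalemx_sub; apply: Zrows_sub;
  rewrite ?mem_head // inE sw orbT.
Qed.

Hypothesis N_neq0 : ZtoF N != 0.

Lemma is_unit_neq0 v : is_unit N v -> ZtoF v != 0.
Proof.
rewrite /is_unit => /Z.eqb_spec; have [->|/eqP nv] := eqVneq v Z0.
  (* By convention N mod 0 is N, so 0 would pass the test only if N were 0. *)
  by rewrite Zmod_0_r => N0; case/eqP: N_neq0; rewrite N0.
move=> Nv; have := Z.div_mod N v nv; rewrite Nv Z.add_0_r => defN.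
by move: N_neq0; rewrite defN ZtoFM mulf_eq0 negb_or => /andP[].
Qed.

Lemma normalizeP r : size r = m ->
  size (normalize N r) = m /\
  exists2 g, g != 0 & Zrow r = g *: Zrow (normalize N r).
Proof.
move=> sr; rewrite /normalize; set g := foldl _ _ _; set r' := [seq Z.div x g | x <- r].
have triv : size r = m /\ exists2 g, g != 0 & Zrow r = g *: Zrow r.
  by split=> //; exists 1; rewrite ?oner_neq0 ?scale1r.
case: ifP => // /is_unit_neq0 g0; case: ifP => //; rewrite /eqZs lazy_allE => eqr.
split; first by rewrite size_map.
exists (ZtoF g) => //; apply/rowP=> j; rewrite !mxE -ZtoFM; congr ZtoF.
have ltj : (j < size r)%N by rewrite sr.
have := (all_nthP (Z0, Z0) eqr) (nat_of_ord j); rewrite size_zip !size_map minnn => /(_ ltj).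
by rewrite nth_zip ?size_map //= => /Z.eqb_spec <-; rewrite (nth_map Z0) ?size_map.
Qed.

Lemma reduce_rowP r w (j : 'I_m) : size r = m -> size w = m ->
  ZtoF (nth Z0 r j) != 0 ->
  let w' := reduce_row N r j w in
  [/\ size w' = m, Zrow w' 0 j = 0 & exists g u v,
    [/\ g != 0, u != 0 & g *: Zrow w' = u *: Zrow w - v *: Zrow r]].
Proof.
move=> sr sw rj; rewrite /reduce_row; case: Z.eqb_spec => [wj|_] /=.
  split=> //; first by rewrite mxE wj.
  by exists 1, 1, 0; rewrite oner_neq0 !scale1r scale0r subr0.
set a := nth _ r j in rj *; set b := nth _ w j; set w0 := [seq _ | x <- _].
have sw0 : size w0 = m by rewrite size_map size_zip sr sw minnn.
have [sw' [g g0 e]] := normalizeP sw0.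
have ew0 : Zrow w0 = ZtoF a *: Zrow w - ZtoF b *: Zrow r.
  apply/rowP=> i; rewrite !mxE (nth_map (Z0, Z0)) ?size_zip ?sr ?sw ?minnn //.
  by rewrite nth_zip ?sr ?sw //= ZtoFB !ZtoFM.
split=> //; last by exists g, (ZtoF a), (ZtoF b); rewrite -e.
apply: (mulfI g0); rewrite mulr0; have := congr1 (fun v : 'rV_m => v 0 j) ew0.
by rewrite e !mxE => ->; rewrite mulrC subrr.
Qed.

Lemma pick_rowP s r s' : pick_row N s = Some (r, s') ->
  s =i r :: s' /\ (find_unit N r < size r)%N.
Proof.
elim: s r s' => //= r0 s IHs r s'; case: ifP => [lt_r0 [<- <-] //|_].
case def_s: (pick_row N s) => [[r1 s1]|] // [<- <-].
have [eq_s lt_r1] := IHs _ _ def_s; split=> // x.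
by rewrite !inE eq_s !inE orbCA.
Qed.

Lemma eliminateP fuel s k : {in s, forall r, size r = m} ->
  eliminate N fuel s = Some k -> \rank (Zrows s) = k.
Proof.
elim: fuel s k => //= fuel IH [|r0 s0] k ss.
  by case=> <-; apply/eqP; rewrite -leqn0 rank_leq_row.
move: {r0 s0} (r0 :: s0) ss => s ss; case def_s: pick_row => [[r s1]|] //.
have [eq_s lt_j] := pick_rowP def_s.
have sr : size r = m by apply: ss; rewrite eq_s mem_head.
have ss1 : {in s1, forall w, size w = m}.
  by move=> w s1w; apply: ss; rewrite eq_s inE s1w orbT.
have lt_jm : (find_unit N r < m)%N by rewrite -sr.
pose j := Ordinal lt_jm; rewrite -[find_unit N r]/(nat_of_ord j).
have rj : ZtoF (nth Z0 r j) != 0.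
  by apply: is_unit_neq0; apply: nth_find; rewrite has_find.
case def_k: eliminate => [k'|] // [<-].
have red w : w \in s1 -> _ := fun s1w => reduce_rowP sr (ss1 w s1w) rj.
rewrite -(IH _ _ _ def_k) => [|w]; last first.
  by rewrite mem_filter => /andP[_ /mapP[w0 /red[sw _ _] ->]].
rewrite Zrows_filter -(@Zrows_pivot r s1 _ j); first 1 last.
- by rewrite mxE.
- by move=> w /mapP[w0 /red[_ ? _] ->].
- move=> w s1w; exists (reduce_row N r j w); first exact: map_f.
  by have [_ _] := red w s1w.
- by move=> w /mapP[w0 s1w0 ->]; exists w0 => //; have [_ _] := red w0 s1w0.
by apply: Zrows_rank => w sw; apply: Zrows_sub; rewrite ?eq_s // -eq_s.
Qed.

End RankCertificate.

Lemma ZtoF_of_nat (F : fieldType) n : ZtoF F (Z.of_nat n) = n%:R%R.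
Proof.
rewrite /ZtoF; have -> : int_of_Z (Z.of_nat n) = n by lia.
by rewrite -pmulrn.
Qed.

Lemma row_reps_sound M x : x \in row_reps M ->
  x.1 < size M /\ x.2 = nth [::] M x.1.
Proof.
pose ok (y : nat * bitseq) := y.1 < size M /\ y.2 = nth [::] M y.1.
rewrite -/(ok x) /row_reps; set Z := zip _ _.
have ZP y : y \in Z -> ok y.
  case/(nthP (0, [::])) => i; rewrite size_zip size_iota minnn => lt_i <-.
  by rewrite nth_zip ?size_iota // /ok /= nth_iota.
have: forall y, y \in [::] -> ok y by [].
elim: Z ZP [::] => /= [_ acc accP /accP // | y Z IHZ ZP acc accP].
apply: IHZ => [z Zz|z]; first by apply: ZP; rewrite inE Zz orbT.
rewrite /row_reps_step; case: ifP => _; rewrite ?inE; first exact: accP.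
by case/predU1P=> [->|]; [apply: ZP; rewrite mem_head | apply: accP].
Qed.

Lemma row_reps_complete M i : i < size M ->
  exists2 x, x \in row_reps M & x.2 = nth [::] M i.
Proof.
move=> lt_i; rewrite /row_reps; set Z := zip _ _.
have: (i, nth [::] M i) \in Z.
  apply/(nthP (0, [::])); exists i; first by rewrite size_zip size_iota minnn.
  by rewrite nth_zip ?size_iota ?nth_iota.
have acc_keep acc W x : x \in acc -> x \in foldl row_reps_step acc W.
  elim: W acc => //= y W IHW acc acc_x; apply: IHW; rewrite /row_reps_step.
  by case: ifP; rewrite // inE acc_x orbT.
move: (nth [::] M i) => r.
elim: Z [::] => //= y Z IHZ acc; rewrite inE => /predU1P[<-|]; last exact: IHZ.
rewrite {2}/row_reps_step; case: ifP => [|_]; rewrite ?lazy_hasE.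
  by case/hasP=> x acc_x /eqbsP /= <-; exists x; first exact: acc_keep.
by exists (i, r) => //; apply: acc_keep; rewrite mem_head.
Qed.

(** * Ranks of non-commuting matrices *)

Definition enumerates (gT : finGroupType) (G : {group gT}) (f : nat -> gT) :=
  {in gtn #|G| &, injective f} /\ (forall i, i < #|G| -> f i \in G).

Lemma enumerates_onto (gT : finGroupType) (G : {group gT}) f x :
  enumerates G f -> x \in G -> exists2 i, i < #|G| & f i = x.
Proof.
case=> f_inj Gf Gx; pose s := [seq f i | i <- iota 0 #|G|].
have us : uniq s.
  rewrite map_inj_in_uniq ?iota_uniq // => i j; rewrite !mem_iota => lti ltj.
  exact: f_inj.
have sG : {subset s <= enum G}.
  by move=> y /mapP[i]; rewrite mem_iota mem_enum => lti ->; apply: Gf.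
have /(_ x) : s =i enum G.
  by apply: (uniq_min_size us sG _).2; rewrite size_map size_iota -cardE.
rewrite mem_enum Gx => /mapP[i]; rewrite mem_iota => lti ->; by exists i.
Qed.

Section NoncommutingRank.

Variables (gT : finGroupType) (G : {group gT}) (f : nat -> gT) (M : seq bitseq).
Hypotheses (fG : enumerates G f) (sM : size M = #|G|)
  (rowM : forall i, i < #|G| -> nth [::] M i =
     [seq (f i * f j != f j * f i)%g | j <- iota 0 #|G|]).

(** All pivots divide |G|^8, hence are nonzero in [F]; the computed value is therefore the rank over
    every such field. *)
Lemma rank_of_noncomm (F : fieldType) k : (#|G|%:R != 0 :> F)%R ->
  rank_of M = Some k -> lattice_rank F (comm_lattice G) = k.
Proof.
move=> nzF; rewrite /rank_of; set R := row_reps M; set l := unzip1 R.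
set N := Z.pow _ _; set s := [seq [seq _ | b <- l] | x <- R].
have N_neq0 : (ZtoF F N != 0)%R.
  pose c := Z.of_nat #|G|.
  have -> : N = Z.mul (Z.mul (Z.mul c c) (Z.mul c c)) (Z.mul (Z.mul c c) (Z.mul c c)).
    by rewrite /N sM -/c; lia.
  by rewrite !ZtoFM ZtoF_of_nat !GRing.mulf_neq0.
have ltl (i : 'I_(size l)) : nth 0 l i < #|G|.
  rewrite -sM; have /mapP[x Rx ->] : nth 0 l i \in l by apply: mem_nth.
  by case: (row_reps_sound Rx).
pose e (i : 'I_(size l)) := f (nth 0 l i).
have Ge i : e i \in G by apply: fG.2.
have rep x : x \in G ->
    exists i, forall y, y \in G -> (x * y != y * x)%g = (e i * y != y * e i)%g.
  move=> Gx; have [a lt_a <-] := enumerates_onto fG Gx.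
  have [z Rz def_z] : exists2 x, x \in R & x.2 = nth [::] M a.
    by apply: row_reps_complete; rewrite sM.
  have lt_z : index z R < size l by rewrite size_map index_mem.
  exists (Ordinal lt_z) => y Gy; have [b lt_b <-] := enumerates_onto fG Gy.
  have [ltz1 defz2] := row_reps_sound Rz; rewrite sM in ltz1.
  have -> : e (Ordinal lt_z) = f z.1.
    by rewrite /e /= (nth_map z) ?index_mem // nth_index.
  have := congr1 (nth false ^~ b) def_z; rewrite defz2 !rowM //.
  by rewrite !(nth_map 0) ?size_iota // nth_iota.
move=> elim_s; rewrite (same_lattice_rank F (@comm_lattice_noncomm _ G)).
pose A : 'M[F]_(size l, #|G|) := (\matrix_(i, j) (e i * enum_val j != enum_val j * e i)%g%:R)%R.
pose B : 'M[F]_(size l, size l) := (\matrix_(i, j) (e i * e j != e j * e i)%g%:R)%R.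
have rankA : lattice_rank F (noncomm_mx G) = \rank A.
  apply/eqP; rewrite eqn_leq; apply/andP; split; apply: mxrankS; apply/row_subP=> i.
    have [j ej] := rep _ (enum_valP i).
    suff -> : row i (map_mx intr (noncomm_mx G)) = row j A by apply: row_sub.
    by apply/rowP=> h; rewrite !mxE ej ?enum_valP // GRing.rmorph_nat.
  suff -> : row i A = row (enum_rank_in (Ge i) (e i)) (map_mx intr (noncomm_mx G)).
    by apply: row_sub.
  by apply/rowP=> h; rewrite !mxE enum_rankK_in // GRing.rmorph_nat.
(* After transposition, the symmetry of commuting permits the same reduction for columns as for
   rows. *)
have rankB : \rank A = \rank B.
  rewrite -mxrank_tr; apply/eqP; rewrite eqn_leq; apply/andP.
  split; apply: mxrankS; apply/row_subP=> i.
    have [j ej] := rep _ (enum_valP i).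
    suff -> : row i A^T%R = row j B by apply: row_sub.
    by apply/rowP=> h; rewrite !mxE eq_sym ej // .
  suff -> : row i B = row (enum_rank_in (Ge i) (e i)) A^T%R by apply: row_sub.
  by apply/rowP=> h; rewrite !mxE enum_rankK_in // eq_sym.
have ss : {in s, forall r, size r = size l}.
  by move=> r /mapP[x _ ->]; rewrite size_map.
rewrite rankA rankB -(@eliminateP F N (size l) N_neq0 _ _ _ _ elim_s); last first.
  by move=> r; rewrite mem_filter => /andP[_ /ss].
rewrite Zrows_filter; have ssl : size s = size l by rewrite !size_map.
have nth_s (i j : 'I_(size l)) : ZtoF F (nth Z0 (nth [::] s i) j) = B i j.
  have lti : i < size R by rewrite -(size_map fst).
  rewrite (nth_map (0, [::])) // (nth_map 0) //.
  have [_ ->] := row_reps_sound (mem_nth (0, [::]) lti).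
  have eqi : (nth (0, [::]) R i).1 = nth 0 l i by rewrite (nth_map (0, [::])).
  by rewrite eqi rowM // (nth_map 0) ?size_iota // nth_iota // mxE; case: (_ != _).
apply/eqP; rewrite eqn_leq; apply/andP; split; apply: mxrankS.
  apply/row_subP=> i; suff -> : row i B = Zrow F (size l) (nth [::] s i).
    by apply: Zrows_sub; rewrite mem_nth ?ssl.
  by apply/rowP=> j; rewrite [LHS]mxE [RHS]mxE nth_s.
apply/Zrows_subP=> r /(nthP [::])[i]; rewrite ssl => lti <-.
suff -> : Zrow F (size l) (nth [::] s i) = row (Ordinal lti) B by apply: row_sub.
by apply/rowP=> j; rewrite [LHS]mxE [RHS]mxE -nth_s.
Qed.

Lemma has_rank_internal : has_rank M -> internal_conductor G.
Proof.
rewrite /has_rank; case def_k: (rank_of M) => [k|] // _ p.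
rewrite inE => /andP[pr_p]; apply: contraTT => npG.
rewrite !(rank_of_noncomm _ def_k) ?ltnn //.
  by rewrite Num.Theory.pnatr_eq0 -lt0n cardG_gt0.
by rewrite -(GRing.dvdn_pcharf (pchar_Fp pr_p)).
Qed.

End NoncommutingRank.

(** * Tables and their automorphisms *)

Definition square_table n (T : table) :=
  [/\ size T = n, (forall i, i < n -> size (nth [::] T i) = n) &
      forall i j, i < n -> j < n -> op T i j < n].

Lemma nth_transpose n T i : square_table n T -> i < n ->
  nth [::] (transpose T) i = [seq op T j i | j <- iota 0 n].
Proof.
case=> sT rT _ lti; rewrite (nth_map 0) ?size_iota ?sT // nth_iota ?sT //=.
apply: (@eq_from_nth _ 0); rewrite !size_map ?size_iota ?sT // => j ltj.
by rewrite (nth_map [::]) ?sT // (nth_map 0) ?size_iota // nth_iota.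
Qed.

Lemma size_transpose T : size (transpose T) = size T.
Proof. by rewrite size_map size_iota. Qed.

Lemma size_noncomm_table T : size (noncomm_table T) = size T.
Proof. by rewrite size_map size_zip size_transpose minnn. Qed.

Lemma nth_noncomm_table n T i : square_table n T -> i < n ->
  nth [::] (noncomm_table T) i = [seq op T i j != op T j i | j <- iota 0 n].
Proof.
move=> sqT lti; have [sT rT _] := sqT.
rewrite (nth_map ([::], [::])) ?size_zip ?size_transpose ?sT ?minnn //.
rewrite nth_zip ?size_transpose //= (nth_transpose sqT) //.
apply: (@eq_from_nth _ false).
  by rewrite !size_map size_zip rT // size_map size_iota minnn.
move=> j; rewrite size_map size_zip rT // size_map size_iota minnn => ltj.
rewrite (nth_map (0, 0)) ?size_zip ?rT ?size_map ?size_iota ?minnn //.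
rewrite (nth_map 0) ?size_iota // nth_zip ?rT ?size_map ?size_iota //=.
by rewrite (nth_map 0) ?size_iota // !nth_iota.
Qed.

Lemma iota0S k : iota 0 k.+1 = rcons (iota 0 k) k.
Proof. by rewrite -[k.+1]addn1 iotaD cats1. Qed.

Section TableAutomorphism.

Variables (n : nat) (T : table) (phi : nat -> nat).
Hypotheses (sqT : square_table n T) (phi_lt : forall i, i < n -> phi i < n)
  (phi_inj : {in gtn n &, injective phi}) (phi0 : 0 < n -> phi 0 = 0)
  (phiM : forall i j, i < n -> j < n -> phi (op T i j) = op T (phi i) (phi j)).

Let sT : size T = n. Proof. by case: sqT. Qed.
Let opT i j : i < n -> j < n -> op T i j < n. Proof. by case: sqT => _ _; apply. Qed.

Lemma elt_order_aut i : i < n -> elt_order T (phi i) = elt_order T i.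
Proof.
move=> lti; rewrite /elt_order sT; have n_gt0 : 0 < n by apply: leq_trans lti.
have phi_eq0 a : a < n -> eqn 0 (phi a) = eqn 0 a.
  move=> lta; rewrite -{1}(phi0 n_gt0) -[eqn 0 a]/(0 == a).
  by rewrite -[eqn _ _]/(phi 0 == phi a) (inj_in_eq phi_inj).
have gen k a : a < n -> find (eqn 0) (traject (fun b => op T b (phi i)) (phi a) k)
    = find (eqn 0) (traject (fun b => op T b i) a k).
  by elim: k a => //= k IHk a lta; rewrite phi_eq0 // -phiM // IHk ?opT.
exact: gen.
Qed.

Lemma perm_aut : perm_eq [seq phi i | i <- iota 0 n] (iota 0 n).
Proof.
have u : uniq [seq phi i | i <- iota 0 n].
  rewrite map_inj_in_uniq ?iota_uniq // => i j; rewrite !mem_iota => lti ltj.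
  exact: phi_inj.
apply: uniq_perm; rewrite ?iota_uniq //.
have sub : {subset [seq phi i | i <- iota 0 n] <= iota 0 n}.
  by move=> _ /mapP[i + ->]; rewrite !mem_iota => lti; apply: phi_lt.
by apply: (uniq_min_size u sub _).2; rewrite size_map.
Qed.

Lemma elt_keys_aut i : i < n ->
  nth (0, 0) (elt_keys T) (phi i) = nth (0, 0) (elt_keys T) i.
Proof.
have nthK a : a < n -> nth (0, 0) (elt_keys T) a
    = (elt_order T a, count (fun b => op T a b != op T b a) (iota 0 n)).
  move=> lta; rewrite (nth_map (0, [::])); last first.
    by rewrite size_zip size_iota size_noncomm_table minnn sT.
  rewrite nth_zip ?size_iota ?size_noncomm_table // nth_iota ?sT //=.
  by rewrite (nth_noncomm_table sqT) // count_map.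
move=> lti; rewrite !nthK ?phi_lt // elt_order_aut //; congr (_, _).
rewrite -(seq.permP perm_aut) count_map; apply: eq_in_count => b; rewrite mem_iota => ltb /=.
by rewrite -!phiM // (inj_in_eq phi_inj) // inE opT.
Qed.

Lemma find_wordP gens i a b : {in gens, forall c, c < n} -> i < n ->
  find_word (transpose T) gens i = Some (a, b) ->
  [/\ a < i, b \in gens & op T a b = i].
Proof.
move=> + lti; elim: gens => //= c gens IHg ltg.
have ltc : c < n by apply: ltg; rewrite mem_head.
rewrite (nth_transpose sqT) //; set s := map _ _.
case: ifP => [ltf [<- <-]|_ /IHg[d gd|-> gb ->]]; last by rewrite inE gb orbT.
  rewrite mem_head; split=> //.
  have ss : size s = n by rewrite size_map size_iota.
  have: has (eqn i) s by rewrite has_find ss (ltn_trans ltf).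
  move/(nth_find 0)/eqnP; rewrite (nth_map 0) ?size_iota; last exact: ltn_trans lti.
  by rewrite nth_iota // (ltn_trans ltf).
by apply: ltg; rewrite inE gd orbT.
Qed.

Lemma wordsP i a b : i < n -> nth None (words T).2 i = Some (a, b) ->
  [/\ a < i, b < i & op T a b = i].
Proof.
rewrite /words sT.
suff: forall k, k <= n -> let w := foldl (words_step (transpose T)) ([::], [::]) (iota 0 k) in
    [/\ size w.2 = k, {in w.1, forall c, c < k} &
      forall j c d, j < k -> nth None w.2 j = Some (c, d) ->
        [/\ c < j, d < j & op T c d = j]].
  by move=> /(_ n (leqnn n))[_ _ ok] lti /ok; apply.
elim=> [//|k IHk] ltk; rewrite iota0S foldl_rcons.
case: (IHk (ltnW ltk)); case: foldl => gens ws /= sw ltg ok.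
rewrite /words_step /=; case def_w: find_word => [[c d]|] /=; rewrite size_rcons sw.
  split=> // [e ge | j e g]; first exact: leqW (ltg _ ge).
  rewrite ltnS leq_eqVlt => /predU1P[->|ltj]; last by rewrite nth_rcons sw ltj; apply: ok.
  rewrite nth_rcons sw ltnn eqxx => -[<- <-].
  have [|//|ltc gd ->] := find_wordP _ _ def_w.
    by move=> h gh; apply: leq_trans (ltg _ gh) (ltnW _).
  by split=> //; apply: ltg.
split=> // [e|j e g].
  by rewrite mem_rcons inE => /predU1P[->|/ltg/leqW].
rewrite ltnS leq_eqVlt => /predU1P[->|ltj]; last by rewrite nth_rcons sw ltj; apply: ok.
by rewrite nth_rcons sw ltnn eqxx.
Qed.

Lemma partial_hom_aut gens k : k <= n -> partial_hom T T gens (mkseq phi k).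
Proof.
move=> lekn; rewrite /partial_hom lazy_allE; apply/allP=> b _.
rewrite size_mkseq; case: ifP => // ltb; rewrite /hom_at size_mkseq lazy_allE.
apply/(all_nthP ([::], 0)) => a; rewrite size_zip size_mkseq sT (minn_idPr lekn) => lta.
rewrite nth_zip_cond size_zip size_mkseq sT (minn_idPr lekn) lta /=.
case: leqP => // ltc; rewrite !nth_mkseq // phiM ?(leq_trans lta) ?(leq_trans ltb) //.
exact/eqnP.
Qed.

(** By induction the prefix of [phi] of length k survives k steps: images of words are forced by
    multiplicativity, images of generators are new and have the right key, and every partial test
    holds for [phi]. *)
Lemma homs_aut : mkseq phi n \in homs T T (elt_keys T) (elt_keys T).
Proof.
have sK : size (elt_keys T) = n.
  by rewrite size_map size_zip size_iota size_noncomm_table minnn.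
suff gen k : k <= n -> mkseq phi k \in
    foldl (homs_step T T (elt_keys T) (elt_keys T) (words T).1 (words T).2) [:: [::]] (iota 0 k).
  by rewrite /homs sT; apply: gen.
elim: k => [//|k IHk] ltk.
rewrite iota0S foldl_rcons; move: {IHk}(IHk (ltnW ltk)); move: (foldl _ _ _) => P Pk.
rewrite /homs_step; set Q := flatten _.
have Qk : mkseq phi k.+1 \in Q.
  apply/flatten_mapP; exists (mkseq phi k) => //; rewrite mkseqS.
  case def_w: nth => [[a b]|].
    have [lta ltb def_k] := wordsP ltk def_w.
    rewrite !nth_mkseq // -phiM ?(ltn_trans _ ltk) // def_k.
    by rewrite mem_head.
  apply: map_f; rewrite mem_filter mem_iota sK add0n phi_lt // andbT.
  rewrite elt_keys_aut // /eq_key !eqnE !eqxx lazy_hasE andbT.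
  apply/hasPn=> v /mapP[j]; rewrite mem_iota => /= ltj ->; apply/eqP=> /phi_inj.
  by rewrite !inE ltk (ltn_trans ltj) // => /(_ isT isT) e; rewrite e ltnn in ltj.
by case: nth => [w|] //; rewrite mem_filter partial_hom_aut.
Qed.

End TableAutomorphism.

(** * Multiplication tables of groups *)

Definition tabulates (gT : finGroupType) (G : {group gT}) (T : table) f :=
  [/\ square_table #|G| T, enumerates G f, f 0 = 1%g &
    forall i j, i < #|G| -> j < #|G| -> f (op T i j) = (f i * f j)%g].

Definition table_of (gT : finGroupType) (G : {group gT}) T :=
  exists f, tabulates G T f.

Lemma outer_reps_complete C A s : s \in A ->
  exists2 r, r \in outer_reps C A & r = s \/ outer_eq C r s.
Proof.
rewrite /outer_reps; set step := (X in foldl X).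
have keep W acc r : r \in acc -> r \in foldl step acc W.
  elim: W acc => //= t W IHW acc acc_r; apply: IHW; rewrite /step.
  by case: ifP; rewrite // inE acc_r orbT.
elim: A [::] => //= t A IHA acc; rewrite inE => /predU1P[<-{t}|]; last exact: IHA.
rewrite {2}/step; case: ifP => [|_]; rewrite ?lazy_hasE.
  by case/hasP=> r acc_r eq_rs; exists r; [apply: keep | right].
by exists s; [apply: keep; rewrite mem_head | left].
Qed.

Section Tabulates.

Variables (gT : finGroupType) (G : {group gT}) (T : table) (f : nat -> gT).
Hypothesis tab : tabulates G T f.
Local Notation n := #|G|.

Let sqT : square_table n T. Proof. by case: tab. Qed.
Let fG : enumerates G f. Proof. by case: tab. Qed.
Let f0 : f 0 = 1%g. Proof. by case: tab. Qed.
Let fM i j : i < n -> j < n -> f (op T i j) = (f i * f j)%g.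
Proof. by case: tab => _ _ _; apply. Qed.
Let sT : size T = n. Proof. by case: sqT. Qed.
Let opT i j : i < n -> j < n -> op T i j < n. Proof. by case: sqT => _ _; apply. Qed.
Let f_inj i j : i < n -> j < n -> f i = f j -> i = j. Proof. exact: fG.1. Qed.

Definition pos x := index x (mkseq f n).

Lemma posP x : x \in G -> pos x < n /\ f (pos x) = x.
Proof.
move=> Gx; have fx : x \in mkseq f n.
  have [i lti <-] := enumerates_onto fG Gx; apply/mapP; exists i => //.
  by rewrite mem_iota.
have ltx : pos x < n by rewrite -[X in _ < X](size_mkseq f) index_mem.
by split=> //; rewrite -[RHS](nth_index 1%g fx) nth_mkseq.
Qed.

Lemma noncomm_table_row i : i < n ->
  nth [::] (noncomm_table T) i = [seq (f i * f j != f j * f i)%g | j <- iota 0 n].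
Proof.
move=> lti; rewrite (nth_noncomm_table sqT) //; apply/eq_in_map => j.
rewrite mem_iota => ltj; rewrite -!fM //; congr (~~ _).
by apply/eqP/eqP=> [->//|/f_inj->]; rewrite ?opT.
Qed.

Lemma tabulated_internal : has_rank (noncomm_table T) -> internal_conductor G.
Proof.
apply: (has_rank_internal fG); first by rewrite size_noncomm_table.
exact: noncomm_table_row.
Qed.

Lemma tabulated_abelian : commutative_table T = abelian G.
Proof.
rewrite /commutative_table lazy_allE; apply/allP/centsP=> [comm x Gx y Gy | abG r].
  have [[ltx fx] [lty fy]] := (posP Gx, posP Gy).
  have: nth [::] (noncomm_table T) (pos x) \in noncomm_table T.
    by rewrite mem_nth // size_noncomm_table sT.
  move/comm; rewrite lazy_hasE noncomm_table_row // => /hasPn.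
  move/(_ (x * y != y * x)%g) => c; apply/eqP; rewrite -[_ == _]negbK; apply: c.
  by apply/mapP; exists (pos y); rewrite ?mem_iota // fx fy.
case/(nthP [::])=> i; rewrite size_noncomm_table sT => lti <-.
rewrite noncomm_table_row // lazy_hasE; apply/hasPn=> _ /mapP[j + ->].
by rewrite mem_iota => ltj; rewrite abG ?eqxx ?fG.2.
Qed.

Lemma size_conj_table : size (conj_table T) = n.
Proof. by rewrite size_map size_iota. Qed.

Lemma conj_tableP a : a < n -> let c := nth [::] (conj_table T) a in
  size c = n /\ forall b, b < n -> nth 0 c b < n /\ f (nth 0 c b) = (f a * f b * (f a)^-1)%g.
Proof.
move=> lta /=; rewrite (nth_map 0) ?size_iota ?sT // nth_iota ?sT //=.
set inv := find _ _; have [_ rT _] := sqT.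
have [lti fi] := posP (groupVr (fG.2 _ lta)).
have has0 : has (eqn 0) (nth [::] T a).
  apply/(has_nthP 0); exists (pos (f a)^-1%g); rewrite ?rT //; apply/eqnP.
  by apply: f_inj; rewrite ?cardG_gt0 ?opT // f0 fM // fi mulgV.
have lt_inv : inv < n by rewrite -(rT _ lta) -has_find.
have f_inv : f inv = (f a)^-1%g.
  apply/eqP; rewrite eq_sym eq_invg_mul -fM // -f0; apply/eqP; congr f.
  by have /eqnP := nth_find 0 has0.
split=> [|b ltb]; first by rewrite size_map size_iota.
rewrite (nth_map 0) ?size_iota // nth_iota //=.
by rewrite !fM ?opT // f_inv.
Qed.

End Tabulates.

(** * Extensions by a group of prime order *)

Section Extension.

Variables (gT : finGroupType) (G N : {group gT}) (T : table) (f : nat -> gT).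
Hypotheses (tabN : tabulates N T f) (nsNG : (N <| G)%g) (pr_p : prime #|G : N|%g).
Local Notation n := #|N|.
Local Notation p := #|G : N|%g.

Let sqT : square_table n T. Proof. by case: tabN. Qed.
Let fN : enumerates N f. Proof. by case: tabN. Qed.
Let fM i j : i < n -> j < n -> f (op T i j) = (f i * f j)%g.
Proof. by case: tabN => _ _ _; apply. Qed.
Let sT : size T = n. Proof. by case: sqT. Qed.
Let opT i j : i < n -> j < n -> op T i j < n. Proof. by case: sqT => _ _; apply. Qed.
Let sNG : N \subset G. Proof. by case/andP: nsNG. Qed.

Let conjN x y : x \in G -> y \in N -> (x * y * x^-1)%g \in N.
Proof.
move=> Gx Ny; rewrite -mulgA -{1}[x]invgK -conjgE.
by rewrite (memJ_norm _ (subsetP (normal_norm nsNG) _ (groupVr Gx))).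
Qed.

Definition represents_conj x s :=
  size s = n /\ forall i, i < n -> nth 0 s i < n /\ f (nth 0 s i) = (x * f i * x^-1)%g.

Lemma conj_in_homs x : x \in G ->
  exists2 s, s \in homs T T (elt_keys T) (elt_keys T) & represents_conj x s.
Proof.
move=> Gx; pose phi i := pos N f (x * f i * x^-1)%g.
have phiP i : i < n -> phi i < n /\ f (phi i) = (x * f i * x^-1)%g.
  by move=> lti; apply: (posP tabN); rewrite conjN ?fN.2.
exists (mkseq phi n); last first.
  by split=> [|i lti]; rewrite ?size_mkseq // nth_mkseq //; apply: phiP.
apply: homs_aut => // [i /phiP[]//|i j lti ltj eq_phi|n_gt0|i j lti ltj].
- have [[_ fi] [_ fj]] := (phiP i lti, phiP j ltj).
  by apply: fN.1 => //; apply: (mulgI x); apply: (mulIg x^-1%g); rewrite -fi -fj eq_phi.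
- have [_ fphi] := phiP 0 n_gt0; have [_ _ f0 _] := tabN.
  apply: fN.1 => //; first by rewrite inE; case: (phiP 0 n_gt0).
  by rewrite fphi f0 mulg1 mulgV.
have [[li fi] [lj fj]] := (phiP i lti, phiP j ltj).
have [lij fij] := phiP _ (opT lti ltj).
apply: fN.1; rewrite ?inE ?opT // fij !fM // fi fj.
by rewrite !mulgA mulgKV.
Qed.

(** Conjugation by x0 is found only up to an inner automorphism, say conjugation by f a; replacing
    x0 by (f a)^-1 x0 turns the listed representative into an actual conjugation. *)
Lemma outer_action_complete : exists x s,
  [/\ x \in G, x \notin N, represents_conj x s & s \in (outer_actions T).2].
Proof.
have /subsetPn[x0 Gx0 nNx0] : ~~ (G \subset N).
  by apply: contraL pr_p => sGN; rewrite (eqP (_ : p == 1)) // indexg_eq1.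
have [s As xs] := conj_in_homs Gx0; have [ss sP] := xs.
have [r Rr [eq_rs|]] := outer_reps_complete (conj_table T) As.
  by exists x0, r; split=> //; rewrite eq_rs.
rewrite /outer_eq; case: eqnP => // sr; rewrite lazy_hasE => /(has_nthP [::])[a].
rewrite (size_conj_table tabN) => lta; have [sc cP] := conj_tableP tabN lta.
set c := nth _ _ a in sc cP *; rewrite lazy_allE sc => /(all_nthP (0, 0)) eq_cr.
have Nfa : f a \in N by apply: fN.2.
exists ((f a)^-1 * x0)%g, r; split=> //.
- by rewrite groupMl // groupV (subsetP sNG).
- by rewrite groupMl ?groupV.
split=> [|i lti]; first by rewrite sr.
have := eq_cr i; rewrite size_zip sr ss minnn => /(_ lti).
rewrite nth_zip ?sr //=; case: ifP => // ltr /eqnP eq_i; split=> //.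
have [_ fc] := cP _ ltr; have [_] := sP i lti; rewrite -eq_i fc => eq_f.
apply: (mulgI (f a)); apply: (mulIg (f a)^-1%g).
by rewrite eq_f !mulgA mulgV mul1g invMg invgK !mulgA mulgK.
Qed.

Lemma powersP x s i : x \in G -> represents_conj x s -> i <= p ->
  represents_conj (x ^+ i) (nth [::] (powers n s p) i).
Proof.
move=> Gx [ss sP] leip; rewrite /powers (set_nth_default (iota 0 n)) ?size_traject //.
rewrite nth_traject //; elim: i {leip} => [|i [st tP]].
  split=> [|i lti]; first by rewrite size_iota.
  by rewrite nth_iota // expg0 mul1g invg1 mulg1.
split=> [|j ltj]; first by rewrite iterS size_map.
rewrite iterS (nth_map 0) ?st //; have [ltt ft] := tP j ltj.
have [lts fs] := sP _ ltt; split=> //; rewrite fs ft expgS invMg !mulgA //.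
Qed.

Section ExtensionTable.

Variables (x : gT) (s : seq nat).
Hypotheses (Gx : x \in G) (nNx : x \notin N) (xs : represents_conj x s).

Let nNx' : (x \in 'N(N))%g. Proof. exact: (subsetP (normal_norm nsNG)). Qed.

Lemma order_coset_p : #[coset N x]%g = p.
Proof.
have oG : #|(G / N)%g| = p by rewrite card_quotient ?normal_norm.
apply/prime_nt_dvdP => //; last by rewrite -oG order_dvdG ?mem_quotient.
by rewrite order_eq1; apply: contra nNx => /eqP/coset_idr->.
Qed.

Lemma expg_p_in : (x ^+ p)%g \in N.
Proof.
by apply: coset_idr; rewrite ?groupX // morphX // -order_coset_p expg_order.
Qed.

Definition root_pos := pos N f (x ^+ p)%g.

(** The element x^p of N commutes with x, and conjugation by it is the p-th power of conjugation by
    x. *)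
Lemma root_in_ext_roots :
  root_pos \in ext_roots (conj_table T) p s (powers n s p).
Proof.
have [ltz fz] := posP tabN expg_p_in; rewrite -/root_pos in ltz fz.
have [ss sP] := xs.
rewrite mem_filter mem_iota (size_conj_table tabN) leq0n ltz !andbT.
have [lts fs] := sP _ ltz.
have -> : eqn (nth 0 s root_pos) root_pos.
  by apply/eqnP/fN.1; rewrite ?inE // fs fz -expgS expgSr mulgK.
have [sz cz] := conj_tableP tabN ltz.
have [sp_s sp_p] := powersP Gx xs (leqnn p).
rewrite -[X in is_true X]/(eqns _ _); apply/eqnsP/(@eq_from_nth _ 0); rewrite sp_s ?sz // => i lti.
have [[lt1 f1] [lt2 f2]] := (sp_p i lti, cz i lti).
by apply: fN.1; rewrite ?inE // f1 f2 fz.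
Qed.

Definition ext_fun k := (f (k %% n) * x ^+ (k %/ n))%g.

Lemma nth_allpairs (A : Type) (a0 : A) (g : nat -> nat -> A) q m i a : i < q -> a < m ->
  nth a0 [seq g j b | j <- iota 0 q, b <- iota 0 m] (i * m + a) = g i a.
Proof.
move=> ltiq ltam; suff gen k : nth a0 [seq g j b | j <- iota k q, b <- iota 0 m]
    (i * m + a) = g (k + i) a by apply: gen.
elim: q k i ltiq => // q IHq k [_|i ltiq] /=; rewrite nth_cat size_map size_iota.
  by rewrite ltam (nth_map 0) ?size_iota // nth_iota // addn0.
rewrite mulSn -addnA ltnNge leq_addr addKn IHq //.
by rewrite addnS.
Qed.

(** Since x generates G modulo N, each element is uniquely f a x^i with i < p; the product rule is
    x^i b = s^i(b) x^i together with the carry x^p. *)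
Lemma ext_fun_tabulates : tabulates G (ext_table T p (powers n s p) root_pos) ext_fun.
Proof.
set U := ext_table _ _ _ _.
have n_gt0 : 0 < n by apply: cardG_gt0.
have oG : #|G| = p * n by rewrite mulnC Lagrange.
have [ltz fz] := posP tabN expg_p_in; rewrite -/root_pos in ltz fz.
have dm k : k < #|G| -> [/\ k %/ n < p, k %% n < n & k = k %/ n * n + k %% n].
  by move=> ltk; rewrite ltn_divLR // -oG ltk ltn_pmod // -divn_eq.
have nthU k l : k < #|G| -> l < #|G| -> op U k l =
    let c := op T (k %% n) (nth 0 (nth [::] (powers n s p) (k %/ n)) (l %% n)) in
    let i := k %/ n + l %/ n in
    if i < p then i * n + c else (i - p) * n + op T c root_pos.
  move=> /dm[ltki ltka ek] /dm[ltlj ltlb el].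
  by rewrite /op {1}ek /U /ext_table sT nth_allpairs // {1}el nth_allpairs.
have ext_fun_small i a : i < p -> a < n ->
    i * n + a < #|G| /\ ext_fun (i * n + a) = (f a * x ^+ i)%g.
  move=> lti lta; rewrite /ext_fun modnMDl modn_small // divnMDl // divn_small //.
  rewrite addn0 oG; split=> //; apply: (@leq_trans (i.+1 * n)).
    by rewrite mulSn addnC ltn_add2r.
  by rewrite leq_mul2r lti orbT.
have opU k l : k < #|G| -> l < #|G| ->
    op U k l < #|G| /\ ext_fun (op U k l) = (ext_fun k * ext_fun l)%g.
  move=> ltk ltl; have [[ltki ltka ek] [ltlj ltlb el]] := (dm k ltk, dm l ltl).
  rewrite nthU // [ext_fun k]/ext_fun [ext_fun l]/ext_fun.
  move: (k %/ n) (k %% n) (l %/ n) (l %% n) ltki ltka ltlj ltlb => i a j b lti lta ltj ltb.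
  have [_ /(_ b ltb)[lts fs]] := powersP Gx xs (ltnW lti).
  rewrite /=; set b' := nth 0 _ b in lts fs *.
  have ltc := opT lta lts.
  have fc : (f a * x ^+ i * (f b * x ^+ j) = f (op T a b') * x ^+ (i + j))%g.
    by rewrite fM // fs expgD !mulgA mulgKV.
  rewrite {}fc; case: (ltnP (i + j)) => [ltij|leij].
    exact: ext_fun_small.
  have ltijp : i + j - p < p by rewrite ltn_subLR // -addnS leq_add // ltnW.
  have [-> ->] := ext_fun_small _ _ ltijp (opT ltc ltz); split=> //.
  by rewrite fM // fz -mulgA -expgD subnKC.
have sU : size U = #|G| by rewrite size_allpairs !size_iota oG sT.
split.
- split=> [//|k ltk|k l ltk ltl]; last by case: (opU k l ltk ltl).
  have [ltki ltka ek] := dm k ltk.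
  by rewrite ek /U /ext_table sT nth_allpairs // size_allpairs !size_iota oG.
- split=> [k l|k /dm[ltki ltka _]]; last first.
    by rewrite groupM ?groupX // (subsetP sNG) // fN.2.
  rewrite !inE => /dm[ltki ltka {2}->] /dm[ltlj ltlb {2}->] /=; rewrite /ext_fun.
  move: (k %/ n) (k %% n) (l %/ n) (l %% n) ltki ltka ltlj ltlb => i a j b lti lta ltj ltb eq_ab.
  (* The exponent is read off in G / N, where the coset of x has order p. *)
  have eq_ij : i = j.
    have cos c m : c < n -> coset N (f c * x ^+ m)%g = (coset N x ^+ m)%g.
      move=> ltc; have Nc : f c \in N by apply: fN.2.
      rewrite morphM ?groupX ?(subsetP (normG N) _ Nc) // morphX //=.
      by rewrite coset_id // mul1g.
    have := congr1 (coset N) eq_ab; rewrite /= !cos // => /eqP.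
    by rewrite eq_expg_mod_order order_coset_p !modn_small // => /eqP.
  by move: eq_ab; rewrite eq_ij => /mulIg/fN.1->.
- by rewrite /ext_fun div0n mod0n; case: tabN => _ _ -> _; rewrite mul1g.
by move=> k l ltk ltl; case: (opU k l ltk ltl).
Qed.

End ExtensionTable.

Lemma extension_complete : exists2 U, U \in extensions T p & table_of G U.
Proof.
have [x [s [Gx nNx xs Os]]] := outer_action_complete.
exists (ext_table T p (powers n s p) (root_pos x)); last first.
  by exists (ext_fun x); apply: ext_fun_tabulates.
apply/flatten_mapP; exists s => //; apply/mapP.
by exists (root_pos x); rewrite ?sT // root_in_ext_roots.
Qed.

End Extension.

(** Both products of a x^i and b x^j carry the factor x^(i + j), so the two commute exactly when a
    s^i(b) = b s^j(a). The definition of [noncomm_ext] shares the products a s^i(b) between entries;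
    this is its entrywise form. *)
Lemma noncomm_extE n T p (sp : table) : square_table n T -> size sp = p.+1 ->
    (forall i, i < p -> size (nth [::] sp i) = n) ->
  let h i a j b := ~~ eqn (op T a (nth 0 (nth [::] sp i) b)) (op T b (nth 0 (nth [::] sp j) a)) in
  noncomm_ext T p sp =
    [seq [seq h i a j b | j <- iota 0 p, b <- iota 0 n] | i <- iota 0 p, a <- iota 0 n].
Proof.
move=> sqT ssp rsp h; have [sT rT opT] := sqT; rewrite /noncomm_ext.
set X := [seq _ | s <- take p sp].
pose X_ i : table := [seq [seq nth 0 r v | v <- nth [::] sp i] | r <- T].
have -> : X = [seq X_ i | i <- iota 0 p].
  rewrite /X /X_ -{1}(mkseq_nth [::] (take p sp)) size_takel ?ssp //.
  rewrite -map_comp; apply/eq_in_map => i; rewrite mem_iota => /= lti.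
  by rewrite nth_take.
rewrite -!map_comp /=; congr flatten; apply/eq_in_map => i; rewrite mem_iota => /= lti.
have sX j : size (X_ j) = n by rewrite size_map.
have X_E j a b : j < p -> a < n -> b < n -> op (X_ j) a b = op T a (nth 0 (nth [::] sp j) b).
  by move=> ltj lta ltb; rewrite /op (nth_map [::]) ?sT // (nth_map 0) ?rsp.
have -> : zip (iota 0 (size T)) (X_ i) = [seq (a, nth [::] (X_ i) a) | a <- iota 0 n].
  rewrite sT -{1}(map_id (iota 0 n)) -{1}(mkseq_nth [::] (X_ i)) sX /mkseq.
  by elim: (iota 0 n) => //= a s ->.
rewrite -map_comp; apply/eq_in_map => a; rewrite mem_iota => /= lta.
rewrite /= -?map_comp; congr flatten; rewrite -?map_comp.
apply/eq_in_map => j; rewrite mem_iota => /= ltj.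
rewrite (nth_map 0) ?size_iota ?sX // nth_iota ?sX //=.
apply: (@eq_from_nth _ false).
  by rewrite !size_map size_zip size_map sX (nth_map [::]) ?sT // size_map rsp // minnn size_iota.
rewrite size_map size_zip (nth_map [::]) ?sT // !size_map rsp // sT minnn => b ltb.
rewrite (nth_map (0, 0)) ?size_zip ?size_map ?rsp ?sT ?minnn //.
rewrite nth_zip ?size_map ?rsp ?sT //= add0n (nth_map 0) ?rsp //.
rewrite (nth_map [::]) ?sX // (nth_map 0) ?size_iota // nth_iota // add0n.
congr (~~ eqn _ _); exact: X_E.
Qed.

Section ExtensionRank.

Variables (gT : finGroupType) (G N : {group gT}) (T : table) (f : nat -> gT).
Hypotheses (tabN : tabulates N T f) (nsNG : (N <| G)%g) (pr_p : prime #|G : N|%g).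

Lemma noncomm_ext_internal x s :
  x \in G -> x \notin N -> represents_conj N f x s ->
  has_rank (noncomm_ext T #|G : N|%g (powers #|N| s #|G : N|%g)) -> internal_conductor G.
Proof.
move=> Gx nNx xs; have [sqT fN _ fM] := tabN; have [_ _ opT] := sqT.
set p := #|G : N|%g; set sp := powers _ _ _.
have ssp : size sp = p.+1 by rewrite size_traject.
have rsp i : i < p -> represents_conj N f (x ^+ i)%g (nth [::] sp i).
  by move=> lti; exact: powersP Gx xs (ltnW lti).
have [_ eG _ _] := ext_fun_tabulates tabN nsNG pr_p Gx nNx xs.
have oG : #|G| = p * #|N| by rewrite mulnC Lagrange ?normal_sub.
have rowE := noncomm_extE sqT ssp (fun i lti => (rsp i lti).1).
apply: (has_rank_internal eG); first by rewrite rowE size_allpairs !size_iota.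
move=> k ltk; rewrite rowE.
have dm l : l < #|G| -> [/\ l %/ #|N| < p, l %% #|N| < #|N| & l = l %/ #|N| * #|N| + l %% #|N|].
  by move=> ltl; rewrite ltn_divLR ?cardG_gt0 // -oG ltl ltn_pmod ?cardG_gt0 // -divn_eq.
have [ltki ltka ek] := dm k ltk; rewrite {1}ek nth_allpairs //.
apply: (@eq_from_nth _ false); first by rewrite size_allpairs size_map !size_iota.
rewrite size_allpairs !size_iota -oG => l ltl; have [ltlj ltlb el] := dm l ltl.
rewrite {1}el nth_allpairs // (nth_map 0) ?size_iota // nth_iota // add0n; congr (~~ _).
rewrite /ext_fun; move: (k %/ #|N|) (k %% #|N|) (l %/ #|N|) (l %% #|N|) ltki ltka ltlj ltlb.
move=> i a j b lti lta ltj ltb.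
have prodE i' a' j' b' : i' < p -> a' < #|N| -> b' < #|N| ->
    (op T a' (nth 0 (nth [::] sp i') b') < #|N|) *
    ((f a' * x ^+ i' * (f b' * x ^+ j'))%g =
      (f (op T a' (nth 0 (nth [::] sp i') b')) * x ^+ (i' + j'))%g).
  move=> lti' lta' ltb'; have [_ /(_ b' ltb')[lts fs]] := rsp i' lti'.
  by split; rewrite ?opT // fM // fs expgD !mulgA mulgKV.
rewrite !prodE // [j + i]addnC (inj_eq (mulIg _)); apply/eqnP/eqP=> [->//|].
by apply: fN.1; rewrite inE prodE.
Qed.

Lemma check_extension_internal (L : seq (seq table)) n :
  #|G| = n -> n < 64 -> T \in nth [::] L #|N| -> ~~ abelian N -> check_extensions L n ->
  internal_conductor G.
Proof.
move=> oG lt_n LT nabN; have sNG := normal_sub nsNG.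
have eN : #|N| = n %/ #|G : N|%g by rewrite -oG -(Lagrange sNG) mulnK ?indexg_gt0.
have N_gt1 : 1 < #|N|.
  rewrite cardG_gt1; apply: contra nabN => /eqP->; exact: abelian1.
(* As |N| is at least 2, the index is at most half of an order below 64, hence lies in
   [small_primes]. *)
have lt_p : #|G : N|%g < 32.
  rewrite -(@ltn_pmul2l 2) // (leq_ltn_trans _ lt_n) // -oG -(Lagrange sNG).
  by rewrite leq_mul2r N_gt1 orbT.
have sp : #|G : N|%g \in small_primes.
  have : all (fun p => prime p ==> (p \in small_primes)) (iota 0 32) by [].
  by move/allP/(_ _ _)/implyP; apply; rewrite ?mem_iota.
have dp : #|G : N|%g %| n by rewrite -oG dvdn_indexg.
rewrite /check_extensions lazy_allE => /allP/(_ _ sp); rewrite dp lazy_allE -eN.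
move/allP/(_ _ LT); rewrite (tabulated_abelian tabN) (negPf nabN) lazy_allE.
have [x [s [Gx nNx xs Os]]] := outer_action_complete tabN nsNG pr_p.
have [[sT _ _] _ _ _] := tabN.
move/allP/(_ _ Os); rewrite sT.
have rz := root_in_ext_roots tabN nsNG pr_p Gx nNx xs.
rewrite -[(outer_actions T).1]/(conj_table T) => chk.
apply: (noncomm_ext_internal Gx nNx xs); move: chk.
by case: (ext_roots _ _ _ _) rz.
Qed.

End ExtensionRank.

(** * Completeness of the enumeration *)

Lemma embeds_table_of (gT : finGroupType) (G : {group gT}) T U h :
  embeds T U h -> table_of G U -> table_of G T.
Proof.
move=> emb [f [[sU rU opU] [f_inj Gf] f0 fM]]; move: emb; rewrite /embeds.
case: eqnP => // sUT; case: eqnP => // sh; case: ifP => // uh; rewrite lazy_allE.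
case: ifP => // /allP lth; case: eqnP => // h0; rewrite lazy_allE => /(all_nthP ([::], 0)) allT.
have sT : size T = #|G| by rewrite -sUT sU.
have hlt i : i < #|G| -> nth 0 h i < #|G|.
  by move=> lti; rewrite -sT; apply: lth; rewrite mem_nth // sh sT.
have rows i : i < #|G| -> size (nth [::] T i) = #|G| /\ forall j, j < #|G| ->
    op T i j < #|G| /\ nth 0 h (op T i j) = op U (nth 0 h i) (nth 0 h j).
  move=> lti; have := allT i; rewrite size_zip sh minnn sT => /(_ lti).
  rewrite nth_zip ?sh //=; case: eqnP => // srow; rewrite lazy_allE => /(all_nthP (0, 0)) row_i.
  split=> // j ltj; have := row_i j; rewrite size_zip srow sh sT minnn => /(_ ltj).
  by rewrite nth_zip ?srow ?sh //=; case: ifP => // lt_op /eqnP.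
exists (fun i => f (nth 0 h i)); split.
- split=> // [i /rows[]//|i j lti ltj]; by have [_ /(_ j ltj)[]] := rows i lti.
- split=> [i j lti ltj /f_inj eq_h|i lti]; last by rewrite Gf ?hlt.
  apply/eqP; rewrite -(nth_uniq 0 _ _ uh) ?sh ?sT //; apply/eqP/eq_h; exact: hlt.
- by rewrite h0.
by move=> i j lti ltj; have [_ /(_ j ltj)[lt_op ->]] := rows i lti; rewrite fM ?hlt.
Qed.

Lemma search_iso_sound T U kT kU gens ws l f :
  search_iso T U kT kU gens ws l f -> exists h, embeds T U h.
Proof.
elim: l f => [|i l IHl] f /=; first by exists f.
have next f' : (if if nth None ws i.+1 is Some _ then true else partial_hom T U gens f'
    then search_iso T U kT kU gens ws l f' else false) -> exists h, embeds T U h.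
  by case: ifP => // _; apply: IHl.
by case: nth => [[a b]|]; [apply: next | rewrite lazy_hasE => /hasP[v _]; apply: next].
Qed.

(** A table is dropped only when some kept table has a certified isomorphism to it, and the kept
    table then tabulates the same groups. *)
Lemma dedupe_complete (gT : finGroupType) (G : {group gT}) l T :
  T \in l -> table_of G T -> exists2 U, U \in dedupe l & table_of G U.
Proof.
move=> lT GT; rewrite /dedupe; set step := (X in foldl X).
have keep W acc x : List.In x acc -> List.In x (foldl step acc W).
  elim: W acc => //= U W IHW acc acc_x; apply: IHW; rewrite /step.
  by case: ifP => // _; right.
suff [x accx Gx] : exists2 x, List.In x (foldl step [::] l) & table_of G x.1.
  exists x.1 => //; elim: (foldl _ _ _) accx => //= y s IHs [->|/IHs]; rewrite inE ?eqxx //.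
  by move->; rewrite orbT.
elim: l lT [::] => //= U l IHl; rewrite inE => /predU1P[<-{U}|lT] acc; last exact: IHl.
rewrite {2}/step; case: ifP => [|_]; rewrite ?lazy_hasE; last first.
  by exists (T, (elt_keys T, words T)) => //; apply: keep; left.
move=> has_acc; suff [x accx Gx] : exists2 x, List.In x acc & table_of G x.1.
  by exists x => //; apply: keep.
elim: acc has_acc => //= x acc IHacc /orP[|/IHacc[y]]; last by exists y => //; right.
case: ifP => // _ /search_iso_sound[h /embeds_table_of/(_ GT)]; exists x => //; exact: or_introl.
Qed.

Lemma solvable_prime_index (gT : finGroupType) (G : {group gT}) :
  solvable G -> 1 < #|G| ->
  exists N : {group gT}, [/\ (N <| G)%g, prime #|G : N|%g & solvable N].
Proof.
rewrite cardG_gt1 => solG ntG; have [N maxN] := ex_maxnormal_ntrivg ntG.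
have nsNG := maxnormal_normal maxN; exists N; split=> //.
  exact: index_maxnormal_sol_prime maxN.
exact: solvableS (normal_sub nsNG) solG.
Qed.

Definition covers n (l : seq table) := forall (gT : finGroupType) (G : {group gT}),
  #|G| = n -> solvable G -> (16 <= n -> ~~ abelian G) ->
  exists2 T, T \in l & table_of G T.

(** The normal subgroup of prime index has order at most n / 2 < 16, a range in which the lists
    contain abelian groups as well. *)
Lemma next_level_covers L n : 1 < n < 32 ->
  (forall m, m < n -> covers m (nth [::] L m)) -> covers n (next_level L n).
Proof.
case/andP=> n_gt1 lt_n covL gT G oG solG nabG.
have [N [nsNG pr_p solN]] : exists N : {group gT},
    [/\ (N <| G)%g, prime #|G : N|%g & solvable N].
  by apply: solvable_prime_index; rewrite ?oG.
have sNG := normal_sub nsNG.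
have eN : #|N| = n %/ #|G : N|%g by rewrite -oG -(Lagrange sNG) mulnK ?indexg_gt0.
have lt_N : #|N| < 16.
  rewrite -(@ltn_pmul2r 2) // (leq_ltn_trans _ lt_n) // -oG -(Lagrange sNG).
  by rewrite leq_mul2l prime_gt1 ?orbT.
have ltNn : #|N| < n.
  by rewrite -oG proper_card // properE sNG -indexg_eq1 neq_ltn prime_gt1 ?orbT.
have [|T LT [f tabN]] := covL _ ltNn _ N (erefl _) solN.
  by move=> le16; rewrite leqNgt lt_N in le16.
have [U extU GU] := extension_complete tabN nsNG pr_p.
have candU : U \in candidates L n.
  apply/flatten_mapP; exists #|G : N|%g.
    have dp : #|G : N|%g %| n by rewrite -oG dvdn_indexg.
    rewrite mem_filter dp; have lt_p : #|G : N|%g < 32.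
      by rewrite (leq_ltn_trans _ lt_n) // dvdn_leq // ltnW.
    have : all (fun p => prime p ==> (p \in small_primes)) (iota 0 32) by [].
    by move/allP/(_ _ _)/implyP; apply; rewrite ?mem_iota.
  by apply/flatten_mapP; exists T; rewrite // -eN.
rewrite /next_level; case: ifP => n16; first exact: dedupe_complete candU GU.
apply: (dedupe_complete _ GU); rewrite mem_filter candU andbT; have [g tabG] := GU.
by rewrite (tabulated_abelian tabG) nabG // leqNgt n16.
Qed.

Lemma levels_cover n : n < 32 -> covers n (nth [::] levels n).
Proof.
rewrite /levels; set step := (X in foldl X); set L0 := [:: _; _].
suff gen k : k <= 30 -> let L := foldl step L0 (iota 2 k) in
    size L = k.+2 /\ forall m, m < k.+2 -> covers m (nth [::] L m).
  by move=> lt_n; have [_ covL] := gen 30 isT; exact: (covL n lt_n).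
elim: k => [_|k IHk ltk].
  split=> // -[|[|//]] _ gT G oG solG _; first by have := cardG_gt0 G; rewrite oG.
  exists [:: [:: 0]] => //; exists (fun=> 1%g).
  split=> //; last by move=> i j _ _; rewrite mulg1.
    by rewrite oG; split=> [//|[|//]|[|//] [|//]].
  by rewrite /enumerates oG; split=> [[|//] [|//] | i _]; rewrite ?group1.
have -> : iota 2 k.+1 = rcons (iota 2 k) k.+2.
  by have := iotaD 2 k 1; rewrite addn1 cats1.
rewrite foldl_rcons; have [sL covL] := IHk (ltnW ltk).
move: (foldl _ _ _) sL covL => L sL covL; split; first by rewrite size_rcons sL.
move=> m; rewrite ltnS leq_eqVlt nth_rcons sL => /predU1P[->|ltm].
  by rewrite ltnn eqxx; apply: next_level_covers.
by rewrite ltm; apply: covL.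
Qed.

Lemma check_levels : check_tables levels = true.
Proof. vm_cast_no_check (erefl true). Qed.

(** The list [L] is arbitrary, which keeps the computed [levels] folded. Orders below 32 are read
    off the list; beyond, a normal subgroup of prime index is either abelian or in the list and
    treated by [check_extensions]. *)
Lemma check_tables_internal L :
  (forall n, n < 32 -> covers n (nth [::] L n)) -> check_tables L = true ->
  forall (gT : finGroupType) (G : {group gT}),
    solvable G -> #|G| < 64 -> internal_conductor G.
Proof.
move=> covL; rewrite /check_tables; case: ifP => //.
rewrite !lazy_allE => /allP rankL /allP extL gT G solG lt_G.
have [/abelian_internal//|nabG] := boolP (abelian G).
have [lt32|ge32] := ltnP #|G| 32.
  have [T LT [f tabG]] := covL _ lt32 _ G (erefl _) solG (fun=> nabG).
  have lt_s : #|G| < size L.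
    by rewrite ltnNge; apply: contraL LT => le_s; rewrite nth_default.
  apply: (tabulated_internal tabG); move: (rankL _ (mem_nth [::] lt_s)).
  by rewrite lazy_allE => /allP/(_ T LT).
have [N [nsNG pr_p solN]] : exists N : {group gT},
    [/\ (N <| G)%g, prime #|G : N|%g & solvable N].
  by apply: solvable_prime_index => //; apply: leq_trans ge32.
have [abN|nabN] := boolP (abelian N); first exact: prime_index_internal abN pr_p.
have lt_N : #|N| < 32.
  rewrite -(@ltn_pmul2r 2) // (leq_ltn_trans _ lt_G) // -(Lagrange (normal_sub nsNG)).
  by rewrite leq_mul2l prime_gt1 ?orbT.
have [T LT [f tabN]] := covL _ lt_N _ N (erefl _) solN (fun=> nabN).
apply: (check_extension_internal tabN nsNG pr_p (erefl _) lt_G LT nabN).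
by apply: extL; rewrite mem_iota ge32.
Qed.

Lemma solvable_internal (gT : finGroupType) (G : {group gT}) :
  solvable G -> #|G| < 64 -> internal_conductor G.
Proof. exact: (check_tables_internal levels_cover check_levels). Qed.

(** * Non-solvable groups of order less than 64 *)

Section SimpleOfOrder30Or60.

Variables (gT : finGroupType) (G : {group gT}).
Hypotheses (simpleG : forall N : {group gT}, (N <| G)%g -> N :=: 1%g \/ N :=: G)
  (nabG : ~~ abelian G) (oG : #|G| \in [:: 30; 60]).
Local Open Scope group_scope.
Local Open Scope nat_scope.

Let Z1 : 'Z(G) = 1%g.
Proof.
have [//|eZG] := simpleG (center_normal G).
by case/negP: nabG; rewrite -eZG center_abelian.
Qed.

Lemma Sylow_card (r : nat) (P : {group gT}) :
  r \in [:: 3; 5] -> P \subset G -> (r.-Sylow(G) P = (#|P| == r)).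
Proof.
move=> r35 sPG; rewrite pHallE sPG p_part /=; congr (_ == _).
by move: oG r35; rewrite !inE => /pred2P[]-> /pred2P[]->.
Qed.

(** Simplicity excludes the value 1; the listed numbers are the other divisors of 30 or 60 congruent
    to 1 modulo r. *)
Lemma card_Syl_simple (r : nat) : r \in [:: 3; 5] ->
  #|'Syl_r(G)| \in (if r == 5 then [:: 6] else [:: 4; 10]).
Proof.
move=> r35; have pr_r : prime r by move: r35; rewrite !inE => /pred2P[]->.
have := card_Syl_mod G pr_r; have := card_Syl_dvd r G.
have : #|'Syl_r(G)| != 1.
  apply/eqP=> n1; have [P sylP] := Sylow_exists r G.
  have oP : #|P| = r by apply/eqP; rewrite -Sylow_card // (pHall_sub sylP).
  have: #|G : 'N_G(P)| == 1 by rewrite -(card_Syl sylP) n1.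
  rewrite indexg_eq1 subsetI subxx /= => nPG.
  have [P1|eP] := simpleG (introT andP (conj (pHall_sub sylP) nPG)).
    by move: oP r35; rewrite P1 cards1 => <-.
  by move: oG r35; rewrite -eP oP !inE => /pred2P[]->.
have lt_c : forall c, c %| #|G| -> c \in iota 0 61.
  move=> c /(dvdn_leq (cardG_gt0 G)) lec; rewrite mem_iota /= ltnS (leq_trans lec) //.
  by move: oG; rewrite !inE => /pred2P[]->.
move=> n1 dc /eqP m1; have := lt_c _ dc; move: n1 dc m1; move: #|'Syl_r(G)| => c.
pose chk n r := all (fun c => [&& c != 1, c %| n & c %% r == 1] ==>
  (c \in if r == 5 then [:: 6] else [:: 4; 10])) (iota 0 61).
have : all (fun n => all (chk n) [:: 3; 5]) [:: 30; 60] by [].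
by move/allP/(_ _ oG)/allP/(_ _ r35)/allP => chk_c n1 dc m1 /chk_c; rewrite n1 dc m1.
Qed.

Lemma normaliser_card (r : nat) x : r \in [:: 3; 5] -> x \in G -> #[x] = r ->
  (#|'Syl_r(G)| * #|'N_G(<[x]>)|)%N = #|G|.
Proof.
move=> r35 Gx ox; have sylx : r.-Sylow(G) <[x]>.
  by rewrite Sylow_card ?cycle_subG // -orderE ox.
by rewrite (card_Syl sylx) mulnC Lagrange ?subsetIl.
Qed.

(** The normaliser of <x> in H is the one in G, so the quotient is the number of Sylow r-subgroups
    of H. *)
Lemma card_Syl_subgroup (r : nat) (H : {group gT}) x :
  r \in [:: 3; 5] -> x \in G -> #[x] = r ->
  H \subset G -> 'N_G(<[x]>) \subset H -> (#|H| %/ #|'N_G(<[x]>)|) %% r = 1.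
Proof.
move=> r35 Gx ox sHG sNH; have pr_r : prime r by move: r35; rewrite !inE => /pred2P[]->.
have sxN : <[x]> \subset 'N_G(<[x]>) by rewrite subsetI cycle_subG Gx normG.
have sylx : r.-Sylow(H) <[x]>.
  have sylG : r.-Sylow(G) <[x]> by rewrite Sylow_card ?cycle_subG // -orderE ox.
  exact: pHall_subl (subset_trans sxN sNH) sHG sylG.
have eN : 'N_H(<[x]>) = 'N_G(<[x]>).
  by apply/eqP; rewrite eqEsubset setSI // subsetI sNH subsetIr.
have := card_Syl_mod H pr_r; rewrite (card_Syl sylx) -divgS ?subsetIl //.
by rewrite /= eN.
Qed.

Lemma subcent1_card_dvd (r : nat) x : r \in [:: 3; 5] -> x \in G -> #[x] = r ->
  (r %| #|'C_G[x]|) && (#|'C_G[x]| %| #|'N_G(<[x]>)|).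
Proof.
move=> r35 Gx ox; rewrite -{1}ox order_dvdG ?subcent1_id //=.
by rewrite cardSg // subsetI subcent1_sub subcent1_cycle_norm.
Qed.

Lemma normaliser_card5 x : x \in G -> #[x] = 5 -> #|'N_G(<[x]>)| = #|G| %/ 6.
Proof.
move=> Gx ox; have := card_Syl_simple (r := 5) isT; rewrite inE => /eqP n5.
by rewrite -(normaliser_card _ Gx ox) // n5 mulKn.
Qed.

(** Four Sylow 3-subgroups would give order 60 and normalisers of order 15. A group of order 15
    normalises its Sylow 5-subgroup, whose normaliser in G has order only 60 / 6 = 10. *)
Lemma card_Syl3_simple : #|'Syl_3(G)| = 10.
Proof.
have := card_Syl_simple (r := 3) isT; rewrite !inE => /pred2P[n3|//].
have [y Gy oy] : {y | y \in G & #[y] = 3}.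
  by apply: Cauchy => //; move: oG; rewrite !inE => /pred2P[]->.
have oN : 4 * #|'N_G(<[y]>)| = #|G| by rewrite -n3 (normaliser_card _ Gy oy).
have oG60 : #|G| = 60.
  move: oG oN; rewrite !inE => /pred2P[]-> // e.
  by have := dvdn_mulr #|'N_G(<[y]>)| (dvdnn 4); rewrite e.
have oK : #|'N_G(<[y]>)| = 15 by apply/eqP; rewrite -(@eqn_pmul2l 4) // oN oG60.
have [x Kx ox] : {x | x \in 'N_G(<[y]>) & #[x] = 5} by apply: Cauchy; rewrite ?oK.
have Gx : x \in G by case/setIP: Kx.
have := card_Syl_mod 'N_G(<[y]>)%G (isT : prime 5).
have := card_Syl_dvd 5 'N_G(<[y]>)%G; rewrite oK.
have sylx : 5.-Sylow('N_G(<[y]>)) <[x]>.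
  by rewrite pHallE cycle_subG Kx oK -orderE ox p_part.
rewrite (card_Syl sylx) /= => d15 m1.
have n1 : #|'N_G(<[y]>) : 'N_('N_G(<[y]>))(<[x]>)| = 1.
  move: d15 m1; move: #|_ : _| => c d15 m1.
  have ltc : c \in iota 0 16 by rewrite mem_iota /= add0n ltnS dvdn_leq.
  have /allP/(_ c ltc): all (fun c => (c %| 15) && (c %% 5 == 1) ==> (c == 1)) (iota 0 16).
    by [].
  by rewrite d15 m1 => /eqP.
have : 15 %| #|'N_G(<[x]>)|.
  rewrite -oK -(Lagrange (subsetIl _ 'N(<[x]>))) n1 muln1 cardSg //.
  by rewrite setSI // subsetIl.
by rewrite normaliser_card5 // oG60.
Qed.

(** The normaliser of <x> has order r if |G| = 30 and 2r if |G| = 60. In the latter case suppose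
    that C(x) has order 2r. Then it is abelian, equals the normaliser and contains an involution t.
    So |C(t)| is a proper divisor of 60 divisible by 2r and, Sylow 2-subgroups having order 4, by 4:
    it is 12 for r = 3 and 20 for r = 5. Both contradict the Sylow congruence in C(t). *)
Lemma subcent1_card (r : nat) x : r \in [:: 3; 5] -> x \in G -> #[x] = r -> #|'C_G[x]| = r.
Proof.
move=> r35 Gx ox; have pr_r : prime r by move: r35; rewrite !inE => /pred2P[]->.
have /andP[rC CN] := subcent1_card_dvd r35 Gx ox.
have oN : #|'N_G(<[x]>)| = if #|G| == 30 then r else r.*2.
  move: (r35) ox; rewrite !inE => /pred2P[]-> ox.
    have := normaliser_card (r := 3) isT Gx ox; rewrite card_Syl3_simple => e.
    apply/eqP; rewrite -(@eqn_pmul2l 10) // e.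
    by move: oG; rewrite !inE => /pred2P[]->.
  by rewrite normaliser_card5 //; move: oG; rewrite !inE => /pred2P[]->.
move: oG; rewrite !inE => /pred2P[] oGn; rewrite oGn /= in oN.
  by apply/eqP; rewrite eqn_dvd rC andbT -[X in _ %| X]oN.
have [//|oC] : #|'C_G[x]| = r \/ #|'C_G[x]| = r.*2.
  rewrite oN in CN; have /dvdnP[k ek] := rC; move: CN.
  rewrite ek -muln2 mulnC dvdn_pmul2l ?prime_gt0 //.
  case/primeP: (isT : prime 2) => _ /(_ k) + dk2; rewrite dk2 => /(_ isT)/pred2P[]->.
    by left; rewrite ?mul1n ?muln1.
  by right; rewrite ?muln2 ?mul2n.
have abC : abelian 'C_G[x].
  apply: (@cyclic_factor_abelian _ <[x]>%G).
    by rewrite subsetI subcent1_cycle_sub // cycle_subG; apply/centP=> y /subcent1P[].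
  apply: prime_cyclic; rewrite card_quotient ?subcent1_cycle_norm //.
  by rewrite -divgS ?subcent1_cycle_sub // oC -orderE ox -muln2 mulKn ?prime_gt0.
have eN : 'N_G(<[x]>) = 'C_G[x].
  apply/eqP; rewrite eq_sym eqEcard oN oC leqnn andbT.
  by rewrite subsetI subcent1_sub subcent1_cycle_norm.
have [t Ct ot] : {t | t \in 'C_G[x] & #[t] = 2}.
  by apply: Cauchy; rewrite // oC -muln2 dvdn_mull.
have Gt : t \in G by case/setIP: Ct.
have sNH : 'N_G(<[x]>) \subset 'C_G[t].
  by rewrite eN subsetI subcent1_sub sub_cent1 (subsetP abC).
have := card_Syl_subgroup (H := 'C_G[t]%G) r35 Gx ox (subcent1_sub _ _) sNH.
rewrite oN /=; have dC : r.*2 %| #|'C_G[t]| by rewrite -oN cardSg.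
have d4 : 4 %| #|'C_G[t]|.
  have t2 : 2.-group <[t]> by rewrite /pgroup -orderE ot.
  have stG : <[t]> \subset G by rewrite cycle_subG.
  have [S sylS tS] := Sylow_superset stG t2.
  have oS : #|S| = 4 by rewrite (card_Hall sylS) p_part oGn.
  rewrite -oS cardSg // subsetI (pHall_sub sylS) sub_cent1.
  apply: subsetP (card_p2group_abelian (isT : prime 2) oS) _ _.
  by rewrite -cycle_subG.
have ne60 : #|'C_G[t]| != 60.
  rewrite -oGn; apply/eqP=> eC; have: 'C_G[t] == G :> {set gT}.
    by rewrite eqEcard subcent1_sub eC /=.
  by rewrite subcent1_eqG // Z1 inE -order_eq1 ot.
have dG : #|'C_G[t]| %| 60 by rewrite -oGn cardSg ?subcent1_sub.
pose chk r h := [&& h %| 60, 4 %| h, r.*2 %| h & h != 60] ==> (h %/ r.*2 %% r != 1).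
have chkP : all (fun r => all (chk r) (iota 0 61)) [:: 3; 5] by [].
have ltC : #|'C_G[t]| \in iota 0 61 by rewrite mem_iota /= add0n ltnS dvdn_leq.
by have := allP (allP chkP _ r35) _ ltC; rewrite /chk dG d4 dC ne60 => /eqP.
Qed.

(** If 3 or 5 divides |C(x)|, an element of that order r in C(x) has x in its own centralizer of
    order r, so x itself has order r. Otherwise C(x) is a 2-group of order dividing 4, and in order
    60 it contains a Sylow 2-subgroup through x. *)
Lemma subcent1_simple x : x \in G -> x != 1%g ->
  abelian 'C_G[x] /\ (#|'C_G[x]| \in [:: 3; 5] \/ #|'C_G[x]| %| 4 /\ (#|G| = 60 -> #|'C_G[x]| = 4)).
Proof.
move=> Gx ntx; have pr35 r : r \in [:: 3; 5] -> prime r by rewrite !inE => /pred2P[]->.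
have C35 r : r \in [:: 3; 5] -> r %| #|'C_G[x]| -> #|'C_G[x]| = r.
  move=> r35 /(Cauchy (pr35 _ r35))[y /subcent1P[Gy cxy] oy].
  apply: subcent1_card => //; apply/prime_nt_dvdP; rewrite ?order_eq1 ?pr35 //.
  rewrite -(subcent1_card r35 Gy oy) order_dvdG // inE Gx; exact/cent1P/commute_sym.
have abC r : r \in [:: 3; 5] -> #|'C_G[x]| = r -> abelian 'C_G[x].
  by move=> r35 oC; rewrite cyclic_abelian // prime_cyclic // oC pr35.
have [d3|n3] := boolP (3 %| #|'C_G[x]|).
  have oC := C35 3 isT d3; rewrite oC (abC 3) //; split=> //; by left.
have [d5|n5] := boolP (5 %| #|'C_G[x]|).
  have oC := C35 5 isT d5; rewrite oC (abC 5) //; split=> //; by left.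
have dG : #|'C_G[x]| %| 60.
  by apply: dvdn_trans (cardSg (subcent1_sub _ _)) _; move: oG; rewrite !inE => /pred2P[]->.
have dC4 : #|'C_G[x]| %| 4.
  pose chk h := [&& h %| 60, ~~ (3 %| h) & ~~ (5 %| h)] ==> (h %| 4).
  have chkP : all chk (iota 0 61) by [].
  have ltC : #|'C_G[x]| \in iota 0 61 by rewrite mem_iota /= add0n ltnS dvdn_leq.
  by have := allP chkP _ ltC; rewrite /chk dG n3 n5.
have x2 : 2.-group <[x]>.
  have : #[x] %| 4 by apply: dvdn_trans dC4; rewrite order_dvdG ?subcent1_id.
  by rewrite /pgroup -orderE => d4; apply: pnat_dvd d4 _.
have C2 : 2.-group 'C_G[x] by rewrite /pgroup (pnat_dvd dC4).
split; first by rewrite (p2group_abelian C2) // (dvdn_leq_log _ _ dC4).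
right; split=> // oG60; apply/eqP; rewrite eqn_dvd dC4 /=.
have sxG : <[x]> \subset G by rewrite cycle_subG.
have [S sylS tS] := Sylow_superset sxG x2.
have oS : #|S| = 4 by rewrite (card_Hall sylS) p_part oG60.
rewrite -oS cardSg // subsetI (pHall_sub sylS) sub_cent1.
apply: subsetP (card_p2group_abelian (isT : prime 2) oS) _ _.
by rewrite -cycle_subG.
Qed.

Let CA_G : CA_group G.
Proof.
move=> x /setDP[Gx]; rewrite Z1 inE => ntx.
by case: (subcent1_simple Gx ntx).
Qed.

Local Notation Cs := (noncentral_centralizers G).

(** Subgroups of order r are self-centralizing, so the centralizers of order r are the Sylow
    r-subgroups. *)
Lemma card_centralizers (r : nat) : r \in [:: 3; 5] ->
  #|[set C in Cs | #|C| == r]| = #|'Syl_r(G)|.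
Proof.
move=> r35; rewrite -[RHS](card_imset _ (@val_inj _ _ _)); apply: eq_card => C; rewrite !inE.
have pr_r : prime r by move: r35; rewrite !inE => /pred2P[]->.
apply/andP/imsetP=> [[/imsetP[x /setDP[Gx nZx] ->] oC] | [P]].
  by exists 'C_G[x]%G; rewrite // inE Sylow_card ?subcent1_sub.
rewrite inE => sylP ->; have sPG := pHall_sub sylP.
have oP : #|P| = r by apply/eqP; rewrite -Sylow_card.
split; last exact/eqP.
have rP : r %| #|P| by rewrite oP.
have [x Px ox] := Cauchy pr_r rP.
have Gx := subsetP sPG x Px.
have -> : val P = 'C_G[x].
  apply/eqP; rewrite eqEcard subsetI sPG sub_cent1 (subcent1_card r35 Gx ox) -oP leqnn andbT.
  by apply: subsetP Px; apply: cyclic_abelian; rewrite prime_cyclic ?oP.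
rewrite noncentral_centralizersP // Z1 inE -order_eq1 ox.
by move: r35; rewrite !inE => /pred2P[]->.
Qed.

Let big_centralizers := [set C in Cs | (#|C| != 5) && (#|C| != 3)].

Lemma sum_centralizers (F : {set gT} -> nat) c5 c3 :
  (forall C : {set gT}, #|C| = 5 -> F C = c5) ->
  (forall C : {set gT}, #|C| = 3 -> F C = c3) ->
  \sum_(C in Cs) F C = 6 * c5 + (10 * c3 + \sum_(C in big_centralizers) F C).
Proof.
move=> F5 F3; have n5 : #|'Syl_5(G)| = 6.
  by have := card_Syl_simple (r := 5) isT; rewrite inE => /eqP.
rewrite (bigID (fun C : {set gT} => #|C| == 5)) /=; congr (_ + _).
  rewrite -n5 -card_centralizers // -sum_nat_const.
  by apply: eq_big => [C|C /andP[_ /eqP/F5]]; rewrite ?inE.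
rewrite (bigID (fun C : {set gT} => #|C| == 3)) /=; congr (_ + _); last first.
  by apply: eq_bigl => C; rewrite !inE andbA.
rewrite -card_Syl3_simple -card_centralizers // -sum_nat_const.
apply: eq_big => [C|C /andP[_ /eqP/F3]]; rewrite ?inE // -andbA.
by case: (#|C| =P 3) => [->|]; rewrite ?andbF ?andbT.
Qed.

(** 44 = 6 * 4 + 10 * 2 counts the non-identity elements in the centralizers of orders 5 and 3. *)
Lemma simple_card_equation :
  #|G| - 1 = 44 + \sum_(C in big_centralizers) (#|C| - 1).
Proof.
have := CA_card_centralizers CA_G; rewrite Z1 cards1 => ->.
by rewrite (sum_centralizers (c5 := 4) (c3 := 2)) // => C ->.
Qed.

(** The 44 elements already counted are too many for order 30. *)
Lemma simple_order60 : #|G| = 60.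
Proof.
have := simple_card_equation; move: oG; rewrite !inE => /pred2P[]-> //.
Qed.

(** The other centralizers have order 4 and share the remaining 59 - 44 = 15 non-identity elements,
    so there are 5 of them. This makes 6 + 10 + 5 = 21 centralizers, and 20 divides 60. *)
Lemma simple_internal : internal_conductor G.
Proof.
have := simple_card_equation; rewrite simple_order60.
rewrite (eq_bigr (fun=> 3)) => [|C]; last first.
  rewrite !inE => /andP[/imsetP[x /setDP[Gx]]]; rewrite Z1 inE => ntx -> /andP[C5 C3].
  have [_ []] := subcent1_simple Gx ntx; first by rewrite !inE (negPf C3) (negPf C5).
  by case=> _ ->; rewrite ?simple_order60.
rewrite sum_nat_const => eB; apply: CA_internal => //.
have -> : #|Cs| = 21; last by rewrite simple_order60.
rewrite -sum1_card (sum_centralizers (c5 := 1) (c3 := 1)) // sum1_card; lia.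
Qed.

End SimpleOfOrder30Or60.

(** These are the orders below 64 with three prime divisors; Burnside's theorem makes the other
    groups solvable. *)
Lemma nonsolvable_order (gT : finGroupType) (G : {group gT}) :
  ~~ solvable G -> #|G| < 64 -> #|G| \in [:: 30; 42; 60].
Proof.
move=> nsolG lt_G.
pose chk n := (2 < size (primes n)) ==> (n \in [:: 30; 42; 60]).
have chkP : all chk (iota 0 64) by vm_compute.
have ltG : #|G| \in iota 0 64 by rewrite mem_iota.
have := allP chkP _ ltG; rewrite /chk ltnNge; case: leqP => // /Burnside_p_a_q_b.
by rewrite (negPf nsolG).
Qed.

Lemma nonsolvable42 (gT : finGroupType) (G : {group gT}) : #|G| = 42 -> solvable G.
Proof.
move=> oG; have [P sylP] := Sylow_exists 7 G.
have oP : #|P| = 7 by rewrite (card_Hall sylP) p_part oG.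
have nsPG : (P <| G)%g.
  rewrite /normal (pHall_sub sylP) /=.
  have := card_Syl_mod G (isT : prime 7); have := card_Syl_dvd 7 G; rewrite oG.
  rewrite (card_Syl sylP) => d42 m1.
  pose chk c := (c %| 42) && (c %% 7 == 1) ==> (c == 1).
  have chkP : all chk (iota 0 43) by [].
  have ltc : #|G : 'N_G(P)%g|%g \in iota 0 43.
    by rewrite mem_iota /= add0n ltnS dvdn_leq.
  have := allP chkP _ ltc; rewrite /chk d42 m1 /= indexg_eq1 => sGN.
  exact: subset_trans sGN (subsetIr _ _).
rewrite (series_sol nsPG) abelian_sol ?cyclic_abelian ?prime_cyclic ?oP //=.
apply: Burnside_p_a_q_b; rewrite card_quotient ?normal_norm // -divgS ?normal_sub //.
by rewrite oG oP.
Qed.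

Lemma nonsolvable_simple (gT : finGroupType) (G : {group gT}) : ~~ solvable G ->
  (forall (hT : finGroupType) (H : {group hT}),
     #|H| < #|G| -> #|H| %| #|G| -> solvable H) ->
  forall N : {group gT}, (N <| G)%g -> (N :=: 1 \/ N :=: G)%g.
Proof.
move=> nsolG minG N nsNG; have [sNG nNG] := andP nsNG.
have [/card_le1_trivg->|N_gt1] := leqP #|N| 1; first by left.
have [eNG|ltNG] := eqVneq #|N| #|G|.
  by right; apply/eqP; rewrite eqEcard sNG eNG /=.
case/negP: nsolG; rewrite (series_sol nsNG) !minG ?cardSg ?dvdn_quotient //.
  by rewrite card_quotient // -divgS // ltn_Pdiv ?cardG_gt0.
by rewrite ltn_neqAle ltNG subset_leq_card.
Qed.

Lemma solvable_or_order60 (gT : finGroupType) (G : {group gT}) :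
  #|G| < 64 -> solvable G \/ #|G| = 60 /\
    forall N : {group gT}, (N <| G)%g -> (N :=: 1 \/ N :=: G)%g.
Proof.
move=> lt_G; have [|nsolG] := boolP (solvable G); [by left | right].
have nabG : ~~ abelian G by apply: contra nsolG => /abelian_sol.
(* A non-solvable group of order at most 30 has order 30; all smaller groups being solvable, it
   would be simple, against [simple_order60]. *)
have sol30 (hT : finGroupType) (H : {group hT}) : #|H| <= 30 -> solvable H.
  move=> leH; apply: contraT => nsolH; have nabH : ~~ abelian H.
    by apply: contra nsolH => /abelian_sol.
  have oH : #|H| = 30.
    have := nonsolvable_order nsolH (leq_ltn_trans leH (isT : 30 < 64)); rewrite !inE.
    by case/or3P=> /eqP oH //; rewrite oH in leH.
  suff simpleH : forall N : {group hT}, (N <| H)%g -> (N :=: 1 \/ N :=: H)%g.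
    by have := simple_order60 simpleH nabH; rewrite oH => e; have := e isT.
  apply: nonsolvable_simple => // kT K; rewrite oH => ltK _; apply: contraT => nsolK.
  have := nonsolvable_order nsolK (ltn_trans ltK (isT : 30 < 64)); rewrite !inE.
  by case/or3P=> /eqP oK; rewrite oK in ltK.
have oG : #|G| \in [:: 30; 60].
  have := nonsolvable_order nsolG lt_G; rewrite !inE => /or3P[->//|/eqP o42|->].
    by rewrite nonsolvable42 in nsolG.
  by rewrite orbT.
have simpleG := nonsolvable_simple nsolG.
have oG60 : #|G| = 60.
  by move: oG; rewrite !inE => /pred2P[] // o30; rewrite sol30 ?o30 in nsolG.
(* A proper divisor of 60 is at most 30. *)
split=> //; apply: simpleG => hT H ltH dH; apply: sol30.
rewrite oG60 in ltH dH; case/dvdnP: dH => k ek.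
case: k ek ltH => [|[|k]] // ek; first by rewrite mul1n in ek; rewrite -ek ltnn.
by move=> _; lia.
Qed.

Lemma small_internal (gT : finGroupType) (G : {group gT}) :
  #|G| < 64 -> internal_conductor G.
Proof.
move=> lt_G; have [/abelian_internal//|nabG] := boolP (abelian G).
have [solG|[oG simpleG]] := solvable_or_order60 lt_G; first exact: solvable_internal.
by apply: simple_internal; rewrite ?oG.
Qed.

Lemma external_order (gT : finGroupType) (G : {group gT}) :
  has_external_conductor_prime G -> 64 <= #|G|.
Proof.
case=> p pG [npG _]; rewrite leqNgt; apply: contra npG => lt_G.
exact: small_internal.
Qed.

(** * The groups SmallGroup(64,k) *)

Section FamilyInvariants.

Local Open Scope group_scope.
Local Open Scope nat_scope.

Lemma xor3K b a : xor3 (xor3 a b) b = a.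
Proof. by case: a => [[? ?] ?]; rewrite /xor3 /= !addbK. Qed.

Definition zero3 : bits3 := (false, false, false).

(** The commutator has the 2 by 2 minors of x.1 and y.1 over F_2 as exponents, so it vanishes
    exactly when these vectors are linearly dependent. *)
Lemma sg64_commute k (x y : SmallGroup64 k) :
  (x * y == y * x)%g = [|| x.1 == zero3, y.1 == zero3 | x.1 == y.1].
Proof.
have xor3I c : injective (xor3^~ c) by apply: (can_inj (g := xor3^~ c)) => a; apply: xor3K.
rewrite -[(x * y)%g]/(sg64_mul x y) -[(y * x)%g]/(sg64_mul y x) /sg64_mul.
rewrite xpair_eqE xor3C eqxx [xor3 y.2 x.2]xor3C (inj_eq (xor3I _)) /tail3.
have sym (b c : bool) s : scale3 (b && c) s = scale3 (c && b) s by rewrite andbC.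
rewrite (sym y.1.1.1) (sym y.1.1.2) (sym y.1.2) (inj_eq (xor3I _)).
by move: x.1 y.1 => [[[] []] []] [[[] []] []].
Qed.

(** Binary value with complemented bits: the seven nonzero vectors get 0, ..., 6, and the zero
    vector gets 7, which is out of range and so labelled [None]. *)
Definition sg64_code (a : bits3) : nat := (~~ a.1.1) + ((~~ a.1.2) + (~~ a.2).*2).*2.

Definition sg64_label k (x : SmallGroup64 k) : option 'I_7 := insub (sg64_code x.1).

Lemma sg64_invariant_factors k :
  invariant_factors (comm_lattice [set: SmallGroup64 k]%G) (near_trivial_factors 6).
Proof.
apply: (@comm_lattice_labelled _ _ 5 (@sg64_label k)) => [x y _ _ | i].
  have lab0 (z : SmallGroup64 k) : (sg64_label z == None) = (z.1 == zero3).
    rewrite /sg64_label; case: insubP => [u|]; first by move: z.1 => [[[] []] []].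
    by move: z.1 => [[[] []] []].
  rewrite sg64_commute !lab0; have [//|nx] := eqVneq x.1 zero3.
  have [//|ny] := eqVneq y.1 zero3; rewrite /sg64_label.
  have ltx : sg64_code x.1 < 7 by move: x.1 nx => [[[] []] []].
  have lty : sg64_code y.1 < 7 by move: y.1 ny => [[[] []] []].
  rewrite (insubT (fun c => c < 7) ltx) (insubT (fun c => c < 7) lty).
  rewrite (inj_eq Some_inj) -[RHS]val_eqE /=.
  by move: x.1 y.1 {nx ny ltx lty} => [[[] []] []] [[[] []] []].
exists (((~~ odd i, ~~ odd i./2), ~~ odd i./2./2), zero3) => //.
rewrite /sg64_label insubT; first by case: i => [] [|[|[|[|[|[|[|]]]]]]].
move=> lti; congr Some; apply: val_inj => /=.
by case: i lti => [] [|[|[|[|[|[|[|]]]]]]].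
Qed.

Lemma sg64_order k : #|[set: SmallGroup64 k]| = 64.
Proof. by rewrite cardsT !card_prod !card_bool. Qed.

Lemma sg64_conductor k : comm_conductor [set: SmallGroup64 k]%G =i \pi(6).
Proof. exact: (comm_conductor_labelled _ (@sg64_invariant_factors k)). Qed.

Lemma sg64_external k : has_external_conductor_prime [set: SmallGroup64 k]%G.
Proof.
exists 3; first by rewrite sg64_conductor.
have n3 : ~~ (3 %| #|[set: SmallGroup64 k]%G|) by rewrite sg64_order.
split=> // i; apply: contra n3 => d3.
have := dvdC_trans d3 (dvd_irr1_cardG i).
by rewrite dvdC_nat.
Qed.

Lemma sg64_spectrum k : smith_spectrum (comm_lattice [set: SmallGroup64 k]%G) [:: 6].
Proof. by exists (near_trivial_factors 6); first exact: sg64_invariant_factors. Qed.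

Lemma sg64_rank k : lattice_rank rat (comm_lattice [set: SmallGroup64 k]%G) = 7.
Proof. by rewrite (comm_lattice_labelled_rank _ (@sg64_invariant_factors k)). Qed.

End FamilyInvariants.

(** An abelian subgroup lies in C(x) for a noncentral x, taken inside the subgroup if it is not
    central. As C(x) is abelian, the maximal abelian subgroups are exactly these centralizers. *)
Lemma CA_max_abelian (gT : finGroupType) (G : {group gT}) :
  CA_group G -> ~~ abelian G ->
  #|max_abelian_subgroups G| = #|noncentral_centralizers G|.
Proof.
move=> CA_G nabG; rewrite -(card_imset _ (@val_inj _ _ _)); apply: eq_card => C.
apply/imsetP/imsetP=> [[A] | [x /setDP[Gx nZx] ->]].
  rewrite inE => /maxgroupP[/andP[sAG abA] maxA] ->.
  have [x [Gx nZx sAC]] : exists x, [/\ x \in G, x \notin 'Z(G)%g & A \subset 'C_G[x]%g].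
    have [sAZ|/subsetPn[x Ax nZx]] := boolP (A \subset 'Z(G)%g).
      have /subsetPn[x Gx nZx]: ~~ (G \subset 'Z(G)%g) by rewrite subsetI subxx.
      exists x; split=> //; apply: subset_trans sAZ _; apply/subsetP=> z /centerP[Gz cz].
      by rewrite inE Gz; apply/cent1P/cz.
    exists x; split; rewrite ?(subsetP sAG) // subsetI sAG sub_cent1.
    exact: (subsetP abA).
  exists x; first by rewrite inE nZx.
  apply/esym/maxA => //=; rewrite subcent1_sub; apply: CA_G; rewrite inE nZx.
  exact: Gx.
exists 'C_G[x]%G => //; rewrite inE; apply/maxgroupP; split.
  by rewrite subcent1_sub; apply: CA_G; rewrite inE nZx.
move=> B /andP[sBG abB] sCB; apply/eqP; rewrite eqEsubset sCB andbT subsetI sBG.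
by rewrite sub_cent1 (subsetP abB) // (subsetP sCB) ?subcent1_id.
Qed.

(** * Centre and maximal abelian subgroups of the family *)

Section Structure.

Local Open Scope nat_scope.

Lemma sg64_center k (x : SmallGroup64 k) :
  (x \in 'Z([set: SmallGroup64 k])%g) = (x.1 == zero3).
Proof.
apply/centerP/eqP=> [[_ cx]|x0]; last first.
  split=> [|y _]; first exact: in_setT.
  by apply/eqP; rewrite sg64_commute x0 eqxx.
have c (a : bits3) := cx ((a, zero3) : SmallGroup64 k) (in_setT _).
have cE (a : bits3) : [|| x.1 == zero3, a == zero3 | x.1 == a].
  by rewrite -(sg64_commute x (a, zero3)) (c a).
have := cE (true, false, false); have := cE (false, true, false).
by move: x.1 => [[[] []] []].
Qed.

Lemma sg64_CA k : CA_group [set: SmallGroup64 k]%G.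
Proof.
move=> x; rewrite inE sg64_center inE andbT => nx0.
apply/centsP=> y /subcent1P[_ /eqP] + z /subcent1P[_ /eqP].
rewrite -!/(_ == _) => cy cz; apply/eqP; move: cy cz; rewrite !sg64_commute.
rewrite (negPf nx0) /= => /orP[->//|/eqP->] /orP[->|/eqP->]; rewrite ?orbT //.
by rewrite eqxx !orbT.
Qed.

Lemma sg64_nonabelian k : ~~ abelian [set: SmallGroup64 k]%g.
Proof.
apply/negP=> /center_idP ZG.
by have := sg64_center (((true, false, false), zero3) : SmallGroup64 k); rewrite ZG in_setT.
Qed.

Lemma sg64_max_abelian k : #|max_abelian_subgroups [set: SmallGroup64 k]%G| = 7.
Proof.
rewrite CA_max_abelian ?sg64_nonabelian //; last exact: sg64_CA.
pose B (a : bits3) := ('C_[set: SmallGroup64 k][((a, zero3) : SmallGroup64 k)])%g.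
have BP (a : bits3) (y : SmallGroup64 k) : (y \in B a) = [|| a == zero3, y.1 == zero3 | a == y.1].
  by rewrite inE in_setT cent1E eq_sym sg64_commute.
have -> : noncentral_centralizers [set: SmallGroup64 k]%G = [set B a | a in ~: [set zero3]].
  apply/setP=> C; apply/imsetP/imsetP=> [[x]|[a]].
    rewrite inE sg64_center inE andbT => nx0 ->; exists x.1; first by rewrite !inE.
    by apply/setP=> y; rewrite BP inE in_setT cent1E eq_sym sg64_commute.
  by rewrite !inE => na ->; exists (a, zero3); rewrite // inE sg64_center inE andbT.
rewrite card_in_imset => [|a b]; first by rewrite cardsC1 !card_prod card_bool.
rewrite !inE => na nb eqB; have := BP a (b, zero3); rewrite eqB BP /= eqxx !orbT.
by rewrite (negPf na) (negPf nb) => /esym/eqP.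
Qed.

End Structure.

(** * The semidirect decomposition of SmallGroup(64,73) *)

Section Structure73.

Local Open Scope nat_scope.
Local Open Scope group_scope.

Let SG := [set: SmallGroup64 73].
Let gen (a : bits3) : SmallGroup64 73 := (a, zero3).

Definition index2_set : {set SmallGroup64 73} := [set x | ~~ x.1.1.1].

Lemma index2_group_set : group_set index2_set.
Proof.
apply/group_setP; split=> [|x y]; first by rewrite inE.
by rewrite !inE /= => /negPf-> /negPf->.
Qed.
Canonical index2_group := Group index2_group_set.

Lemma card_index2 : #|index2_group| = 32.
Proof.
have := cardsC index2_set; rewrite card_prod !card_prod !card_bool => e.
have: #|index2_set| = #|~: index2_set|.
  (* Left multiplication by f1 exchanges the subgroup and its complement. *)
  rewrite -(card_imset _ (mulgI (gen (true, false, false)))); apply: eq_card => x.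
  rewrite !inE negbK; apply/imsetP/idP=> [[y]|x1].
    by rewrite inE => /negPf y1 ->; rewrite /= y1.
  exists (gen (true, false, false) * x)%g; first by rewrite inE /= x1.
  by rewrite mulgA; case: x {x1} => [[[[] []] []] [[[] []] []]].
by move=> e2; apply/eqP; rewrite -(@eqn_pmul2l 2) // mul2n -addnn [X in _ + X]e2 e.
Qed.

Lemma index2_sdprod : index2_group ><| <[gen (true, false, false)]> = SG.
Proof.
have o1 : #|<[gen (true, false, false)]>| = 2%N by rewrite -orderE; apply: nt_prime_order.
have ti : index2_group :&: <[gen (true, false, false)]> = 1.
  by rewrite setIC prime_TIg ?o1 // cycle_subG inE.
rewrite sdprodE //; last first.
  rewrite cycle_subG inE; apply/subsetP=> y; rewrite mem_conjg inE => y0.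
  rewrite inE.
  have -> : y = (y ^ (gen (true, false, false))^-1) ^ gen (true, false, false).
    by rewrite conjgKV.
  move: (_ ^ _) y0 => z; rewrite /conjg; case: z => [[[[] b] c] w] //.
apply/eqP; rewrite eqEcard subsetT (TI_cardMg ti) card_index2 o1.
by rewrite cardsT !card_prod !card_bool.
Qed.

Lemma cycle_isog_Z2 : <[gen (true, false, false)]> \isog [set: 'Z_2].
Proof.
have o1 : #|<[gen (true, false, false)]>| = 2%N by rewrite -orderE; apply: nt_prime_order.
rewrite isog_cyclic_card ?cycle_cyclic // o1 cardsT card_ord eqxx andbT.
by apply: prime_cyclic; rewrite cardsT card_ord.
Qed.

(** The subgroup generated by the involutions f2 and f3, with commutator f6. *)
Definition dihedral_set : {set SmallGroup64 73} :=
  [set x | [&& ~~ x.1.1.1, ~~ x.2.1.1 & ~~ x.2.1.2]].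

Lemma dihedral_group_set : group_set dihedral_set.
Proof.
apply/group_setP; split=> [|x y]; first by rewrite inE.
case: x y => [[[x1 x2] x3] [[z1 z2] z3]] [[[y1 y2] y3] [[w1 w2] w3]].
rewrite !inE /= => /and3P[/negPf-> /negPf-> /negPf->] /and3P[/negPf-> /negPf-> /negPf->].
by rewrite !andbF.
Qed.
Canonical dihedral_group := Group dihedral_group_set.

Lemma dihedral_isog : dihedral_group \isog [set: 'D_8].
Proof.
have oD : #|dihedral_set| = 8%N.
  pose emb (x : bits3) : SmallGroup64 73 := ((false, x.1.1, x.1.2), (false, false, x.2)).
  have -> : dihedral_set = [set emb x | x in [set: bits3]].
    apply/setP=> -[[[a b] c] [[d e] f]]; rewrite !inE /=.
    apply/and3P/imsetP=> [[/negPf-> /negPf-> /negPf->] | [[[b' c'] f'] _ [-> _ _ -> -> _]]] //.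
    by exists (b, c, f); rewrite ?in_setT.
  rewrite card_in_imset => [|[[? ?] ?] [[? ?] ?] _ _ /= [-> -> ->]] //.
  by rewrite cardsT !card_prod !card_bool.
pose S := [set gen (false, true, false); gen (false, false, true)].
have sSD : <<S>> = dihedral_set.
  apply/eqP; rewrite eqEsubset (gen_subG _ dihedral_group); apply/andP; split.
    by apply/subsetP=> x; rewrite !inE => /orP[]/eqP->.
  apply/subsetP=> x.
  have g2 : gen (false, true, false) \in <<S>> by rewrite mem_gen // !inE eqxx.
  have g3 : gen (false, false, true) \in <<S>> by rewrite mem_gen // !inE eqxx orbT.
  have g6 : [~ gen (false, false, true), gen (false, true, false)] \in <<S>> by rewrite groupR.
  rewrite inE => x0.
  have -> : x = gen (false, true, false) ^+ x.1.1.2 * gen (false, false, true) ^+ x.1.2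
    * [~ gen (false, false, true), gen (false, true, false)] ^+ x.2.2.
    by move: x x0 => [[[[] []] []] [[[] []] []]].
  by rewrite !groupM ?groupX.
have := @involutions_gen_dihedral _ (gen (false, true, false)) (gen (false, false, true)).
rewrite /= -/S sSD oD; apply=> //; exact: nt_prime_order.
Qed.

Let proj (x : SmallGroup64 73) : SmallGroup64 73 := (x.1, (false, false, x.2.2)).

(** Without f1, products of normal words create only powers of f6, so the f4 and f5 coordinates
    split off as direct factors. *)
Lemma index2_isog : index2_group \isog [set: 'Z_2 * 'Z_2 * 'D_8].
Proof.
have [phi injphi imphi] := isogP dihedral_isog.
pose F (x : SmallGroup64 73) : ('Z_2 * 'Z_2 * 'D_8)%type :=
  (inZp x.2.1.1 : 'Z_2, inZp x.2.1.2 : 'Z_2, phi (proj x)).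
have Dproj x : x \in index2_group -> proj x \in dihedral_group.
  by rewrite !inE => ->.
have FM : {in index2_group &, {morph F : x y / x * y}}.
  move=> x y Nx Ny; rewrite /F; have -> : proj (x * y) = proj x * proj y.
    move: Nx Ny; rewrite !inE; case: x y => [[[x1 x2] x3] z] [[[y1 y2] y3] w] /= /negPf-> /negPf->.
    by case: x2; case: x3; case: y2; case: y3.
  rewrite (morphM phi) ?Dproj //.
  have [e1 e2] : (x * y).2.1.1 = x.2.1.1 (+) y.2.1.1 /\ (x * y).2.1.2 = x.2.1.2 (+) y.2.1.2.
    move: Nx Ny; rewrite !inE; case: x y => [[[x1 x2] x3] z] [[[y1 y2] y3] w] /= /negPf-> /negPf->.
    by rewrite /= !andbF !addFb.
  rewrite e1 e2; move: x.2.1.1 y.2.1.1 x.2.1.2 y.2.1.2 => a b c d.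
  by congr (_, _, _); apply: val_inj; [case: a; case: b | case: c; case: d].
pose f := Morphism FM.
have injf : 'injm f.
  apply/injmP=> x y Nx Ny /= [exy1 exy2 /(injmP injphi) exy3].
  have := exy3 (Dproj x Nx) (Dproj y Ny); move: x y exy1 exy2 {Nx Ny exy3}.
  move=> [a [[b c] d]] [a' [[b' c'] d']] /= e1 e2 [-> ->].
  by case: b e1; case: b' => //; case: c e2; case: c'.
apply/isogP; exists f => //; apply/eqP; rewrite eqEcard subsetT card_injm // card_index2.
by rewrite cardsT !card_prod !card_ord -cardsT (@card_dihedral 4).
Qed.

End Structure73.

(** * The isoclinism family *)

Section Collection.

Local Open Scope group_scope.

Variable gT : finGroupType.
Implicit Types a b c p q r u v w : gT.

Lemma collect_commuting a b c a' b' c' :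
  commute b a' -> commute c a' -> commute c b' ->
  a * b * c * (a' * b' * c') = a * a' * (b * b') * (c * c').
Proof.
move=> ba ca cb; rewrite !mulgA -(mulgA (a * b) c a') ca !mulgA.
by rewrite -(mulgA a b a') ba !mulgA -(mulgA _ c b') cb !mulgA.
Qed.

(** Collection to the left in class two: u, v, w are the commutators created when q and r pass p'
    and r passes q'. *)
Lemma collect_swaps p q r p' q' r' u v w :
    q * p' = p' * q * u -> r * p' = p' * r * v -> r * q' = q' * r * w ->
    commute u r -> commute u q' -> commute u r' -> commute v q' -> commute v r' ->
    commute w r' ->
  p * q * r * (p' * q' * r') = p * p' * (q * q') * (r * r') * (w * (u * v)).
Proof.
move=> qp rp rq ur uq' ur' vq' vr' wr'.
rewrite !mulgA -(mulgA (p * q) r p') rp !mulgA -(mulgA p q p') qp !mulgA.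
rewrite -(mulgA _ u r) ur !mulgA -(mulgA _ v q') vq' !mulgA -(mulgA _ u q') uq' !mulgA.
rewrite -(mulgA _ v r') vr' !mulgA -(mulgA _ u r') ur' !mulgA.
by rewrite -(mulgA _ r q') rq !mulgA -(mulgA _ w r') wr' !mulgA.
Qed.

Lemma collect_squares p q r u v w : commute u q -> commute u r -> commute v r ->
  p * u * (q * v) * (r * w) = p * q * r * (u * v * w).
Proof.
move=> uq ur vr; rewrite !mulgA -(mulgA p u q) uq !mulgA.
by rewrite -(mulgA _ v r) vr !mulgA -(mulgA _ u r) ur !mulgA.
Qed.

Lemma collect_two p q u v : commute u q -> p * u * (q * v) = p * q * (u * v).
Proof. by move=> uq; rewrite !mulgA -(mulgA p u q) uq !mulgA. Qed.

End Collection.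

Section CollectedWords.

Local Open Scope group_scope.

Variables (gT : finGroupType) (f : nat -> gT) (s : bits3 * bits3 * bits3).

Let cw z := pcword f zero3 z.
Let x1 := f 1%N. Let x2 := f 2%N. Let x3 := f 3%N.

Hypotheses (central : forall i j : nat, (3 < i)%N -> commute (f i) (f j))
  (sqr1 : forall i : nat, (3 < i)%N -> f i ^+ 2 = 1)
  (comm21 : [~ x2, x1] = f 4%N) (comm31 : [~ x3, x1] = f 5%N)
  (comm32 : [~ x3, x2] = f 6%N)
  (sqr_x1 : x1 ^+ 2 = cw s.1.1) (sqr_x2 : x2 ^+ 2 = cw s.1.2) (sqr_x3 : x3 ^+ 2 = cw s.2).

Let commX (i j : nat) (b c : bool) : (3 < i)%N -> commute (f i ^+ b) (f j ^+ c).
Proof. by move=> lt3i; apply: commuteX2; apply: central. Qed.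

Let sqrX (i : nat) (b c : bool) : (3 < i)%N -> f i ^+ b * f i ^+ c = f i ^+ (b (+) c).
Proof.
by move=> lt3i; case: b; case: c; rewrite /= ?expg0 ?expg1 ?mulg1 ?mul1g // -(sqr1 lt3i).
Qed.

Let cwE z : cw z = f 4%N ^+ z.1.1 * f 5%N ^+ z.1.2 * f 6%N ^+ z.2.
Proof. by rewrite /cw /pcword !mul1g. Qed.

Let pcwordE a z : pcword f a z = x1 ^+ a.1.1 * x2 ^+ a.1.2 * x3 ^+ a.2 * cw z.
Proof. by rewrite cwE /pcword !mulgA. Qed.

Let cwM z w : cw z * cw w = cw (xor3 z w).
Proof. by rewrite !cwE collect_commuting ?sqrX //; apply: commX. Qed.

Let cw_commute z i (b : bool) : commute (cw z) (f i ^+ b).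
Proof.
by rewrite cwE; apply/commute_sym; do 2?apply: commuteM; apply: commute_sym; apply: commX.
Qed.

Let cw_scale (b : bool) z : cw (scale3 b z) = if b then cw z else 1.
Proof. by case: b; [case: z => [[? ?] ?] | rewrite cwE /= !expg0 !mulg1]. Qed.

Let swap (i j : nat) z (b c : bool) : [~ f i, f j] = cw z ->
  f i ^+ b * f j ^+ c = f j ^+ c * f i ^+ b * cw (scale3 (b && c) z).
Proof.
move=> comm_ij; rewrite cw_scale.
case: b; case: c; rewrite /= ?expg0 ?expg1 ?mulg1 ?mul1g //.
by rewrite commgC comm_ij.
Qed.

Let square (i : nat) z (b c : bool) : f i ^+ 2 = cw z ->
  f i ^+ b * f i ^+ c = f i ^+ (b (+) c) * cw (scale3 (b && c) z).
Proof.
move=> sq; rewrite cw_scale.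
by case: b; case: c; rewrite /= ?expg0 ?expg1 ?mulg1 ?mul1g // -sq.
Qed.

(** In any group satisfying the relations, collection yields the product formula of [sg64_mul]; this
    is what makes the word map a homomorphism. *)
Lemma pcwordM a z b w : pcword f a z * pcword f b w
  = pcword f (xor3 a b) (xor3 (tail3 s a b) (xor3 z w)).
Proof.
have c4E : cw (true, false, false) = f 4%N by rewrite cwE !mulg1.
have c5E : cw (false, true, false) = f 5%N by rewrite cwE mul1g mulg1.
have c6E : cw (false, false, true) = f 6%N by rewrite cwE !mul1g.
have e21 := @swap 2 1 _ a.1.2 b.1.1 (etrans comm21 (esym c4E)).
have e31 := @swap 3 1 _ a.2 b.1.1 (etrans comm31 (esym c5E)).
have e32 := @swap 3 2 _ a.2 b.1.2 (etrans comm32 (esym c6E)).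
have regroup (g p q r : gT) : g * p * q * r = g * (p * q * r) by rewrite !mulgA.
rewrite !pcwordE collect_two; last by do 2?apply: commuteM; apply: cw_commute.
rewrite (@collect_swaps _ _ _ _ _ _ _ _ _ _ e21 e31 e32); try exact: cw_commute.
rewrite (square a.1.1 b.1.1 sqr_x1) (square a.1.2 b.1.2 sqr_x2) (square a.2 b.2 sqr_x3).
rewrite [X in X * _ * _]collect_squares; try exact: cw_commute.
rewrite regroup !cwM. congr (_ * cw _).
rewrite /tail3 /xor3 /scale3 /=.
move: (a.1.1 && b.1.1) (a.1.2 && b.1.2) (a.2 && b.2) => p q r.
move: (a.1.2 && b.1.1) (a.2 && b.1.1) (a.2 && b.1.2) => p' q' r'.
congr (_, _, _); rewrite ?andbT ?andbF ?addbF ?addFb; congr (_ (+) _);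
  by move: (p && _) (q && _) (r && _) => u v w'; case: p' q' r' u v w' => [] [] [] [] [] [].
Qed.

End CollectedWords.

(** * Groups satisfying the relations *)

Section Presentation.

Local Open Scope group_scope.

Variable gT : finGroupType.
Implicit Type f : nat -> gT.

Definition presents f (s : bits3 * bits3 * bits3) : Prop :=
  [/\ [/\ f 1%N ^+ 2 = pcword f zero3 s.1.1, f 2%N ^+ 2 = pcword f zero3 s.1.2
        & f 3%N ^+ 2 = pcword f zero3 s.2],
      [/\ [~ f 2%N, f 1%N] = f 4%N, [~ f 3%N, f 1%N] = f 5%N & [~ f 3%N, f 2%N] = f 6%N]
    & forall i : nat, (3 < i)%N -> f i ^+ 2 = 1 /\ forall j, commute (f i) (f j)].

(** The 2 by 2 minors of a and b: the exterior product on F_2^3, giving the exponents of a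
    commutator. *)
Definition cross3 (a b : bits3) : bits3 :=
  ((a.1.2 && b.1.1) (+) (b.1.2 && a.1.1), (a.2 && b.1.1) (+) (b.2 && a.1.1),
   (a.2 && b.1.2) (+) (b.2 && a.1.2)).

Lemma tail3_swap s a b : tail3 s a b = xor3 (tail3 s b a) (cross3 a b).
Proof.
rewrite /tail3 /xor3 /scale3 /cross3 /= !(andbC b.1.1) !(andbC b.1.2) !(andbC b.2).
by congr (_, _, _); rewrite [RHS]addbC [RHS]addbA addbK.
Qed.

Lemma tail3_0l s a : tail3 s zero3 a = zero3.
Proof. by []. Qed.

Lemma tail3_0r s a : tail3 s a zero3 = zero3.
Proof. by rewrite /tail3 /= !andbF. Qed.

Lemma xor3_0l a : xor3 zero3 a = a.
Proof. by case: a => [[? ?] ?]. Qed.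

Lemma xor3_0r a : xor3 a zero3 = a.
Proof. by rewrite xor3C xor3_0l. Qed.

Lemma xor3_aa a : xor3 a a = zero3.
Proof. by rewrite -{1}(xor3_0l a) xor3K. Qed.

Section Presented.

Variables (f : nat -> gT) (s : bits3 * bits3 * bits3).
Hypothesis fs : presents f s.

Lemma presentsM a z b w : pcword f a z * pcword f b w
  = pcword f (xor3 a b) (xor3 (tail3 s a b) (xor3 z w)).
Proof.
have [[? ? ?] [? ? ?] cen] := fs.
by apply: pcwordM => // i => [j|] /cen[].
Qed.

Lemma pcword1 : pcword f zero3 zero3 = 1.
Proof. by rewrite /pcword !mulg1. Qed.

Lemma pcword_sqr a z : pcword f a z ^+ 2 = pcword f zero3 (tail3 s a a).
Proof. by rewrite expgS expg1 presentsM !xor3_aa xor3_0r. Qed.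

Lemma pcword_comm a z b w : [~ pcword f a z, pcword f b w] = pcword f zero3 (cross3 a b).
Proof.
apply: (mulgI (pcword f b w * pcword f a z)); rewrite -commgC !presentsM xor3_0r.
rewrite tail3_0r xor3_0l [xor3 a b]xor3C [xor3 z w]xor3C tail3_swap; congr pcword.
by rewrite -[LHS]xor3A -[RHS]xor3A [xor3 (cross3 a b) _]xor3C.
Qed.

Lemma pcword_center z b w : commute (pcword f zero3 z) (pcword f b w).
Proof. by rewrite /commute !presentsM tail3_0r tail3_0l [xor3 z w]xor3C [xor3 zero3 b]xor3C. Qed.

Hypothesis f_free : forall z, pcword f zero3 z = 1 -> z = zero3.

(** Independence of f4, f5, f6 suffices: a trivial word commutes with everything, so its vector a
    has zero exterior product with every b and must be zero. *)
Lemma pcword_eq1 a z : pcword f a z = 1 -> a = zero3 /\ z = zero3.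
Proof.
move=> az1; have a0 : a = zero3.
  have c b : cross3 a b = zero3.
    by apply: f_free; rewrite -(pcword_comm a z b zero3) az1 comm1g.
  have := c (true, false, false); have := c (false, true, false).
  by move: a {az1 c} => [[[] []] []].
by split=> //; apply: f_free; rewrite -a0.
Qed.

End Presented.

Lemma presented_isog k f (G : {group gT}) :
    presents f (squares64 k) -> (forall z, pcword f zero3 z = 1 -> z = zero3) ->
    (forall i : nat, f i \in G) -> #|G| = 64 ->
  G \isog [set: SmallGroup64 k].
Proof.
move=> fs f_free Gf oG; rewrite isog_sym; apply/isogP.
pose F (x : SmallGroup64 k) := pcword f x.1 x.2.
have FM : {in [set: SmallGroup64 k] &, {morph F : x y / x * y}}.
  by move=> x y _ _; rewrite /F (presentsM fs).
have injF : 'injm (Morphism FM).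
  apply/subsetP=> x /mker /(pcword_eq1 fs f_free)[x1 x2].
  by rewrite inE; apply/eqP; rewrite [x]surjective_pairing x1 x2.
exists (Morphism FM) => //; apply/eqP; rewrite eqEcard card_injm // sg64_order oG leqnn andbT.
apply/subsetP=> _ /morphimP[x _ _ ->] /=.
by rewrite !groupM ?groupX.
Qed.

End Presentation.

(** * Change of generators *)

Section BaseChange.

Local Open Scope group_scope.

Definition lin3 (B : bits3 * bits3 * bits3) (a : bits3) : bits3 :=
  xor3 (scale3 a.1.1 B.1.1) (xor3 (scale3 a.1.2 B.1.2) (scale3 a.2 B.2)).

(** The exponents of the commutators of the new generators, that is, the matrix induced by B on the
    exterior square. *)
Definition exterior_square (B : bits3 * bits3 * bits3) : bits3 * bits3 * bits3 :=
  (cross3 B.1.2 B.1.1, cross3 B.2 B.1.1, cross3 B.2 B.1.2).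

Definition bits3_enum : seq bits3 :=
  let bools := [:: false; true] in allpairs pair (allpairs pair bools bools) bools.

Definition triple_enum : seq (bits3 * bits3 * bits3) :=
  allpairs pair (allpairs pair bits3_enum bits3_enum) bits3_enum.

(* The closed computation below avoids [==], whose canonical instances on     *)
(* products are expensive to evaluate.                                        *)
Definition is_zero3 (a : bits3) : bool := ~~ [|| a.1.1, a.1.2 | a.2].

Definition is_basis (B : bits3 * bits3 * bits3) : bool :=
  all (fun z => is_zero3 (lin3 B z) ==> is_zero3 z) bits3_enum.

(* Replacing f1, f2, f3 by the words of exponents B.1.1, B.1.2, B.2 turns the *)
(* squares s into the squares t.                                              *)
Definition change_squares (s t B : bits3 * bits3 * bits3) : bool :=
  let D := exterior_square B in
  [&& is_zero3 (xor3 (tail3 s B.1.1 B.1.1) (lin3 D t.1.1)),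
      is_zero3 (xor3 (tail3 s B.1.2 B.1.2) (lin3 D t.1.2))
    & is_zero3 (xor3 (tail3 s B.2 B.2) (lin3 D t.2))].

Lemma mem_bits3_enum z : z \in bits3_enum.
Proof. by case: z => [[[] []] []]. Qed.

Lemma mem_triple_enum s : s \in triple_enum.
Proof.
by case: s => [[a b] c]; rewrite !allpairs_f ?mem_bits3_enum.
Qed.

Lemma is_zero3P a : reflect (a = zero3) (is_zero3 a).
Proof. by case: a => [[[] []] []]; constructor. Qed.

Lemma xor3_eq a b : xor3 a b = zero3 -> a = b.
Proof. by move=> ab0; rewrite -(xor3K b a) ab0 xor3_0l. Qed.

(** Invertibility is imposed on the exterior square, because the new f4, f5, f6 must stay
    independent. The list of such base changes is passed as an argument, so that call-by-value
    evaluation builds it once and not once per triple. *)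
Lemma change_squares_check :
  (fun bases => lazy_all (fun s =>
    lazy_has (fun k => lazy_has (change_squares s (squares64 k)) bases) (iota 73 10))
    triple_enum) [seq B <- triple_enum | is_basis (exterior_square B)].
Proof. vm_cast_no_check (erefl true). Qed.

Lemma change_squares_exists s : exists k B,
  [/\ (73 <= k <= 82)%N, is_basis (exterior_square B) & change_squares s (squares64 k) B].
Proof.
have := change_squares_check; cbv beta; rewrite lazy_allE => /allP/(_ s (mem_triple_enum s)).
rewrite lazy_hasE => /hasP[k]; rewrite mem_iota lazy_hasE => kP /hasP[B].
by rewrite mem_filter => /andP[B_basis _] sB; exists k, B.
Qed.

Variables (gT : finGroupType) (f : nat -> gT) (s : bits3 * bits3 * bits3).
Hypothesis fs : presents f s.

Definition change_generators B (i : nat) : gT :=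
  match i with
  | 1%N => pcword f B.1.1 zero3 | 2%N => pcword f B.1.2 zero3 | 3%N => pcword f B.2 zero3
  | 4%N => pcword f zero3 (exterior_square B).1.1
  | 5%N => pcword f zero3 (exterior_square B).1.2
  | 6%N => pcword f zero3 (exterior_square B).2
  | _ => 1
  end.

Lemma change_generators_word B z :
  pcword (change_generators B) zero3 z = pcword f zero3 (lin3 (exterior_square B) z).
Proof.
have scale (b : bool) w : pcword f zero3 w ^+ b = pcword f zero3 (scale3 b w).
  by case: b; [case: w => [[? ?] ?] | rewrite /pcword !mulg1].
by rewrite {1}/pcword /= !mul1g !scale !(presentsM fs) /= !xor3_0l /lin3 xor3A.
Qed.

Lemma change_generators_presents B t :
  change_squares s t B -> presents (change_generators B) t.
Proof.
case/and3P=> /is_zero3P/xor3_eq s1 /is_zero3P/xor3_eq s2 /is_zero3P/xor3_eq s3; split.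
- by rewrite !change_generators_word -s1 -s2 -s3 /= !(pcword_sqr fs).
- by rewrite /= !(pcword_comm fs).
move=> i lt3i; have [z ->] : exists z, change_generators B i = pcword f zero3 z.
  case: i lt3i => [|[|[|[|[|[|[|i]]]]]]] //= _; try by eexists.
  by exists zero3; rewrite pcword1.
split=> [|j]; first by rewrite (pcword_sqr fs) pcword1.
case: j => [|[|[|[|[|[|[|j]]]]]]] /=; try exact: (pcword_center fs).
all: exact: commute1.
Qed.

Lemma change_generators_free B : is_basis (exterior_square B) ->
    (forall z, pcword f zero3 z = 1 -> z = zero3) ->
  forall z, pcword (change_generators B) zero3 z = 1 -> z = zero3.
Proof.
move=> /allP basis f_free z; rewrite change_generators_word => /f_free D0.
by apply/is_zero3P; apply: (implyP (basis z (mem_bits3_enum z))); apply/is_zero3P.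
Qed.

End BaseChange.

Lemma presented_family (gT : finGroupType) (G : {group gT}) f s :
    presents f s -> (forall z, pcword f zero3 z = 1%g -> z = zero3) ->
    (forall i : nat, f i \in G) -> #|G| = 64 ->
  exists2 k, (73 <= k <= 82)%N & G \isog [set: SmallGroup64 k].
Proof.
move=> fs f_free Gf oG; have [k [B [kP basisB sB]]] := change_squares_exists s; exists k => //.
have yP := change_generators_presents fs sB.
have y_free := change_generators_free fs basisB f_free.
apply: (presented_isog yP y_free) => // i.
by case: i => [|[|[|[|[|[|[|i]]]]]]]; rewrite /= ?group1 // /pcword !groupM ?groupX.
Qed.

(** * Isoclinism and isomorphism in order 64 *)

Section Isoclinism.

Local Open Scope group_scope.

Lemma pcgen_presents k : presents (pcgen k) (squares64 k).
Proof.
by have [sq cm cen] := SmallGroup64_relations k; split=> // i /cen[-> c]; split.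
Qed.

Lemma sg64_comm k (x y : SmallGroup64 k) :
  [~ x, y] = (zero3, cross3 x.1 y.1) :> SmallGroup64 k.
Proof.
rewrite {1}(SmallGroup64_normal_form x) {1}(SmallGroup64_normal_form y).
by rewrite (pcword_comm (pcgen_presents k)) [RHS]SmallGroup64_normal_form.
Qed.

Lemma sg64_der1 k : [set: SmallGroup64 k]^`(1) = 'Z([set: SmallGroup64 k]).
Proof.
apply/eqP; rewrite eqEsubset; apply/andP; split.
  rewrite gen_subG; apply/subsetP=> _ /imset2P[x y _ _ ->].
  by rewrite sg64_center sg64_comm.
apply/subsetP=> x; rewrite sg64_center => /eqP x0.
have [_ [c4 c5 c6] _] := SmallGroup64_relations k.
rewrite [x]SmallGroup64_normal_form x0 /pcword !mul1g -c4 -c5 -c6.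
by rewrite !groupM ?groupX ?mem_commg ?in_setT.
Qed.

Lemma sg64_card_center k : #|'Z([set: SmallGroup64 k])| = 8%N.
Proof.
have -> : 'Z([set: SmallGroup64 k]) = [set ((zero3, z) : SmallGroup64 k) | z in [set: bits3]].
  apply/setP=> x; rewrite sg64_center; apply/eqP/imsetP=> [x0 | [z _ ->] //].
  by exists x.2; rewrite ?in_setT // -x0 -surjective_pairing.
rewrite card_imset; [by rewrite cardsT !card_prod !card_bool | by move=> z w []].
Qed.

Lemma sg64_coset k (x y : SmallGroup64 k) :
  (coset 'Z([set: SmallGroup64 k]) x == coset 'Z([set: SmallGroup64 k]) y) = (x.1 == y.1).
Proof.
have N (u : SmallGroup64 k) : u \in 'N('Z([set: SmallGroup64 k])).
  by rewrite (subsetP (normal_norm (center_normal _))) ?in_setT.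
apply/eqP/eqP=> [/(rcoset_kercosetP (N x) (N y))|xy].
  by rewrite mem_rcoset sg64_center => /eqP/xor3_eq.
by apply/(rcoset_kercosetP (N x) (N y)); rewrite mem_rcoset sg64_center /= xy xor3_aa.
Qed.

Section FromFamily.

Variables (gT : finGroupType) (G : {group gT}) (k : nat).
Variable h : {morphism G >-> SmallGroup64 k}.
Hypotheses (injh : 'injm h) (imh : h @* G = [set: SmallGroup64 k]).

Local Notation S := [set: SmallGroup64 73].

Let centerG x : x \in G -> (x \in 'Z(G)) = ((h x).1 == zero3).
Proof.
move=> Gx; rewrite -sg64_center.
apply/centerP/centerP=> -[_ c]; split=> //; first exact: in_setT.
  by move=> y; rewrite -imh => /morphimP[y' _ Gy' ->]; rewrite /commute -!morphM ?c.
by move=> y Gy; apply: (injmP injh); rewrite ?groupM // !morphM ?c ?in_setT.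
Qed.

Let lift_fst (x : gT) : SmallGroup64 73 := ((h x).1, zero3).
Let lift_snd (x : gT) : SmallGroup64 73 := (zero3, (h x).2).

(** [lift_fst] forgets the squares, which depend on k; working modulo the centre restores
    multiplicativity. *)
Let lift_fstM : {in G &, {morph (fun x => coset 'Z(S) (lift_fst x)) : x y / x * y}}.
Proof.
move=> x y Gx Gy /=; have N u : u \in 'N('Z(S)).
  by rewrite (subsetP (normal_norm (center_normal _))) ?in_setT.
by rewrite -morphM //; apply/eqP; rewrite sg64_coset /= morphM.
Qed.

Let g : {morphism G >-> coset_of 'Z(S)} := Morphism lift_fstM.

Let ker_g : 'ker g = 'Z(G).
Proof.
apply/setP=> x; have [Gx | nGx] := boolP (x \in G); last first.
  by rewrite !inE (negPf nGx).
rewrite !inE Gx /= -[1](morph1 (coset_morphism 'Z(S))) sg64_coset -(centerG Gx).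
by rewrite !inE Gx.
Qed.

Let ker_coset_g : 'ker (coset 'Z(G)) \subset 'ker g.
Proof. by rewrite ker_coset ker_g. Qed.

Let G_norm : G \subset 'N('Z(G)).
Proof. exact: normal_norm (center_normal G). Qed.

Let phi := factm_morphism ker_coset_g G_norm.

Let phi_isom : isom (G / 'Z(G)) (S / 'Z(S)) phi.
Proof.
apply/isomP; split; first by rewrite ker_factm ker_g; apply/trivgP; apply: trivg_quotient.
rewrite morphim_factm; apply/setP=> q; apply/morphimP/morphimP=> [[x _ Gx ->] | [u Nu _ ->]].
  exists (lift_fst x); rewrite ?in_setT //.
  by rewrite (subsetP (normal_norm (center_normal _))) ?in_setT.
have /morphimP[x _ Gx hx]: ((u.1, zero3) : SmallGroup64 k) \in h @* G by rewrite imh in_setT.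
by exists x => //; apply/eqP; rewrite sg64_coset /= -hx.
Qed.

Let der1_fst x : x \in G^`(1) -> (h x).1 = zero3.
Proof.
move=> G'x; apply/eqP; rewrite -sg64_center -sg64_der1 -imh -morphim_der //.
by apply: mem_morphim => //; apply: (subsetP (der_sub 1 G)).
Qed.

Let lift_sndM : {in G^`(1) &, {morph lift_snd : x y / x * y}}.
Proof.
move=> x y G'x G'y; have sub := subsetP (der_sub 1 G).
rewrite /lift_snd morphM ?sub //=; congr pair.
by rewrite (der1_fst G'x) /= tail3_0l xor3_0l.
Qed.

Let psi := Morphism lift_sndM.

Let psi_isom : isom G^`(1) S^`(1) psi.
Proof.
have injpsi : 'injm psi.
  apply/injmP=> x y G'x G'y /= [hxy]; have sub := subsetP (der_sub 1 G).
  apply: (injmP injh); rewrite ?sub //.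
  by rewrite [h x]surjective_pairing [h y]surjective_pairing !der1_fst // hxy.
apply/isomP; split=> //; apply/eqP; rewrite eqEcard card_injm //= sg64_der1.
rewrite sg64_card_center -(card_injm injh (der_sub 1 G)) morphim_der // imh sg64_der1.
rewrite sg64_card_center leqnn andbT; apply/subsetP=> _ /morphimP[x _ _ ->].
by rewrite sg64_center.
Qed.

(** Commutators are given by [cross3] for every k, so identifying the coordinates of the central
    quotients and of the derived subgroups respects the pairings. *)
Lemma injm_isoclinic : isoclinic G [set: SmallGroup64 73]%G.
Proof.
have phiE x : x \in G -> phi (coset 'Z(G) x) = coset 'Z(S) (lift_fst x).
  exact: (factmE ker_coset_g G_norm).
exists phi, psi; split=> // x y x' y' Gx Gy _ _.
rewrite !phiE // => /eqP; rewrite sg64_coset => /eqP ex /eqP.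
rewrite sg64_coset => /eqP ey; rewrite sg64_comm -ex -ey /= /lift_snd.
by rewrite morphR // sg64_comm.
Qed.

End FromFamily.

Section ToFamily.

Variables (gT : finGroupType) (G : {group gT}).
Hypotheses (oG : #|G| = 64%N) (isoG : isoclinic G [set: SmallGroup64 73]%G).

Local Notation S := [set: SmallGroup64 73].
Local Notation e := (pcgen 73).

(** Lifts of f1, f2, f3 through [phi] have commutators that [psi] sends to f4, f5, f6, hence
    independent ones. Comparing orders, the centre has order 8 and consists of the words in these
    commutators; it contains the squares of the lifts. So the relations hold with some triple of
    squares. *)
Lemma isoclinic_family : exists2 k, (73 <= k <= 82)%N & G \isog [set: SmallGroup64 k].
Proof.
have [phi [psi [/isomP[injphi imphi] /isomP[injpsi impsi] compat]]] := isoG.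
have G_norm : G \subset 'N('Z(G)) := normal_norm (center_normal G).
have lift i : exists2 x, x \in G & phi (coset 'Z(G) x) = coset 'Z(S) (e i).
  have : coset 'Z(S) (e i) \in S / 'Z(S).
    apply: mem_quotient; exact: in_setT.
  rewrite -imphi => /morphimP[_ _ /morphimP[x _ Gx ->] exi].
  by exists x.
have [x1 Gx1 ex1] := lift 1%N; have [x2 Gx2 ex2] := lift 2%N; have [x3 Gx3 ex3] := lift 3%N.
pose f (i : nat) := match i with
  | 1%N => x1 | 2%N => x2 | 3%N => x3
  | 4%N => [~ x2, x1] | 5%N => [~ x3, x1] | 6%N => [~ x3, x2] | _ => 1 end.
have G'f (i : nat) : (3 < i)%N -> f i \in G^`(1).
  by case: i => [|[|[|[|[|[|[|i]]]]]]] //= _; rewrite ?group1 ?mem_commg.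
have Gf (i : nat) : f i \in G.
  have [|le_i3] := ltnP 3 i; first by move/G'f; apply: (subsetP (der_sub 1 G)).
  by case: i le_i3 => [|[|[|[|i]]]] //= _; exact: group1.
have f123 : [/\ f 1%N = x1, f 2%N = x2 & f 3%N = x3] by [].
have f456 : [/\ f 4%N = [~ x2, x1], f 5%N = [~ x3, x1] & f 6%N = [~ x3, x2]] by [].
clearbody f; case: f123 f456 => f1 f2 f3 [f4 f5 f6].
have psi_word z : psi (pcword f zero3 z) = ((zero3, z) : SmallGroup64 73).
  have [_ [c4 c5 c6] _] := SmallGroup64_relations 73.
  have p4 : psi (f 4%N) = e 4%N by rewrite f4 -c4; apply: compat; rewrite ?in_setT.
  have p5 : psi (f 5%N) = e 5%N by rewrite f5 -c5; apply: compat; rewrite ?in_setT.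
  have p6 : psi (f 6%N) = e 6%N by rewrite f6 -c6; apply: compat; rewrite ?in_setT.
  rewrite [RHS]SmallGroup64_normal_form /pcword !mul1g.
  by rewrite !morphM ?morphX ?groupM ?groupX ?G'f // p4 p5 p6.
have f_free z : pcword f zero3 z = 1 -> z = zero3.
  by move=> z1; have := psi_word z; rewrite z1 morph1 => -[].
have isoQ : G / 'Z(G) \isog S / 'Z(S) by apply/isogP; exists phi.
have G'Z : G^`(1) \subset 'Z(G).
  apply: der1_min => //; rewrite (isog_abelian isoQ).
  by apply: sub_der1_abelian; rewrite sg64_der1.
have oS : (#|(S / 'Z(S))%g| * 8)%N = 64%N.
  have := Lagrange (center_sub S); rewrite sg64_card_center sg64_order mulnC; apply: etrans.
  by rewrite card_quotient ?normal_norm ?center_normal.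
have oZ : #|'Z(G)| = 8%N.
  have := Lagrange (center_sub G); rewrite -card_quotient // oG.
  rewrite (card_isog isoQ).
  move=> Ze; apply/eqP; rewrite -(@eqn_pmul2r #|(S / 'Z(S))%g|) ?cardG_gt0 // Ze mulnC.
  by apply/eqP; rewrite -[LHS]oS.
have ZE : [set pcword f zero3 z | z in [set: bits3]] = 'Z(G).
  apply/eqP; rewrite eqEcard oZ; apply/andP; split.
    apply/subsetP=> _ /imsetP[z _ ->]; apply: (subsetP G'Z).
    by rewrite /pcword !mul1g !groupM ?groupX ?G'f.
  rewrite card_imset ?cardsT ?card_prod ?card_bool // => z w /(congr1 psi).
  by rewrite !psi_word => -[].
(* Squares vanish in S / Z(S) and [phi] is injective, so the square of a lift is central. *)
have sqr x i : x \in G -> phi (coset 'Z(G) x) = coset 'Z(S) (e i) ->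
    exists z, x ^+ 2 = pcword f zero3 z.
  move=> Gx ex; suffices: x ^+ 2 \in 'Z(G) by rewrite -ZE => /imsetP[z _ ->]; exists z.
  have Nx : x \in 'N('Z(G)) := subsetP G_norm x Gx.
  apply: coset_idr; first exact: groupX.
  apply: (injmP injphi); rewrite ?group1 ?mem_quotient ?groupX //.
  rewrite morph1 morphX // morphX ?mem_quotient // ex -morphX; last first.
    by rewrite (subsetP (normal_norm (center_normal _))) ?in_setT.
  rewrite -[1](morph1 (coset_morphism 'Z(S))); apply/eqP; rewrite sg64_coset.
  by rewrite expgS expg1 /= xor3_aa.
have [s1 sq1] := sqr _ _ Gx1 ex1; have [s2 sq2] := sqr _ _ Gx2 ex2.
have [s3 sq3] := sqr _ _ Gx3 ex3.
apply: (@presented_family _ G f (s1, s2, s3)) => //.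
split; [by rewrite f1 f2 f3 | by rewrite f1 f2 f3 f4 f5 f6 | move=> i lt3i; split=> [|j]].
  have : f i \in 'Z(G) := subsetP G'Z _ (G'f i lt3i); rewrite -ZE => /imsetP[z _ fiE].
  apply: (injmP injpsi); rewrite ?group1 ?groupX ?G'f // morph1 morphX ?G'f // fiE psi_word.
  by case: z {fiE} => [[[] []] []].
have /centerP[_ c] := subsetP G'Z _ (G'f i lt3i).
exact: c.
Qed.

End ToFamily.

End Isoclinism.

Local Open Scope nat_scope.
Local Open Scope group_scope.

Theorem corollary3p4
    (SG : forall k, {group SmallGroup64 k} :=
       fun k => [set: SmallGroup64 k]%G) :
  [/\ (* such groups exist *)
      exists (gT : finGroupType) (G : {group gT}),
        has_external_conductor_prime G,
      (* 64 is the smallest order *)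
      (forall (gT : finGroupType) (G : {group gT}),
         has_external_conductor_prime G -> 64 <= #|G|)
      /\ (#|SG 73| = 64 /\ has_external_conductor_prime (SG 73)),
      (* structure of SmallGroup(64,73) *)
      [/\ exists N H : {group SmallGroup64 73},
            [/\ N ><| H = SG 73,
                N \isog [set: 'Z_2 * 'Z_2 * 'D_8]
              & H \isog [set: 'Z_2]],
          CA_group (SG 73)
        & #|max_abelian_subgroups (SG 73)| = 7],
      (* its isoclinism family in order 64 *)
      forall (gT : finGroupType) (G : {group gT}),
        #|G| = 64 /\ isoclinic G (SG 73) <->
        exists2 k, 73 <= k <= 82 & G \isog SG k
    & (* the invariants shared by the family *)
      forall k, 73 <= k <= 82 ->
        [/\ has_external_conductor_prime (SG k),
            lattice_rank rat (comm_lattice (SG k)) = 7,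
            smith_spectrum (comm_lattice (SG k)) [:: 6],
            comm_conductor (SG k) =i \pi(6)
            /\ comm_conductor (SG k) =i [:: 2; 3]
          & ~~ (3 %| 64)]].
Proof.
split.
- by exists (SmallGroup64 73), (SG 73); apply: sg64_external.
- split; first exact: external_order.
  by split; [apply: sg64_order | apply: sg64_external].
- split; last exact: sg64_max_abelian; last exact: sg64_CA.
  exists index2_group, <[((true, false, false), zero3) : SmallGroup64 73]>%G.
  by split; [apply: index2_sdprod | apply: index2_isog | apply: cycle_isog_Z2].
- move=> gT G; split=> [[oG isoG] | [k kP isoGk]]; first exact: isoclinic_family.
  split; first by rewrite (card_isog isoGk) sg64_order.
  by have [h injh imh] := isogP isoGk; apply: injm_isoclinic imh.
move=> k _; split; [exact: sg64_external | exact: sg64_rank | exact: sg64_spectrum | | by []].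
by have C6 := @sg64_conductor k; split=> // p; rewrite C6.
Qed.
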